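(* Let $n\ge 3$ and let $p_1,\dots,p_n\ge 2$ be pairwise coprime integers, $P=p_1\cdots p_n$. For $\tau\in\mathbb{H}$ with $\operatorname{Re}(\tau)\neq 0$, the function $\widehat{\Psi}(\tau)=\Psi(q)-\mathcal{P}(q)$ ($q=e^{2\pi i\tau}$) satisfies $$\widehat{\Psi}\left(-\frac1\tau\right)=\operatorname{sgn}(\operatorname{Re}(\tau))\sum_{k=0}^{n-3}\frac{(-1)^{\iota}(-i)^{1/2}(2P)^{\frac{k-1}{2}}\tau^{\kappa+\iota+\frac12}}{(2\pi i)^{\kappa}}\sum_{r=0}^{\kappa}d_{\kappa,\iota,r}\,\tau^{r}\,\widetilde{\eta}_{k,r}(\tau)+i\sum_{k=0}^{n-3}(2P)^{k/2}\int_0^{i\infty}\frac{\eta_{k+1}(z)}{\sqrt{-i(z+1/\tau)}}\,dz,$$ where for each $k$ the integers $\kappa\ge 0$ and $\iota\in\{0,1\}$ are defined by $k=2\kappa+\iota$.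
   Context: $\mathbb{H}$ is the upper half-plane; $q=e^{2\pi i\tau}$ and $q^{a}=e^{2\pi i a\tau}$ for $a\in\mathbb{Q}$. Square roots are taken with $\arg\sqrt z\in(-\pi/2,\pi/2]$, and $\tau^{N+1/2}=\tau^N\sqrt\tau$ for integers $N$. $\operatorname{sgn}$ is the usual sign function with $\operatorname{sgn}(0)=0$. For $\boldsymbol{\varepsilon}=(\varepsilon_1,\dots,\varepsilon_n)\in\{\pm1\}^n$, the integers $m_0=m_0(\boldsymbol\varepsilon)\in\mathbb{Z}$ and $\ell=\ell(\boldsymbol\varepsilon)\in\{1,\dots,2P-1\}$ are the unique ones with $P\bigl(n-2+\sum_{j=1}^n\varepsilon_j/p_j\bigr)=2Pm_0+\ell$. $\genfrac{[}{]}{0pt}{}{a}{b}$ is the (unsigned) Stirling number of the first kind: $\genfrac{[}{]}{0pt}{}{0}{0}=1$, $\genfrac{[}{]}{0pt}{}{a}{0}=\genfrac{[}{]}{0pt}{}{0}{b}=0$ for $a,b\ge1$, $\genfrac{[}{]}{0pt}{}{a+1}{b}=\genfrac{[}{]}{0pt}{}{a}{b-1}+a\genfrac{[}{]}{0pt}{}{a}{b}$. Define $$\Psi(q)=\sum_{\boldsymbol\varepsilon\in\{\pm1\}^n}\varepsilon_1\cdots\varepsilon_n\sum_{m=0}^\infty\binom{m+n-3}{n-3}q^{\frac{1}{4P}\left(2Pm+P\left(n-2+\sum_{j}\varepsilon_j/p_j\right)\right)^2},$$ $$c_{\boldsymbol\varepsilon}(k)=\frac{(-1)^k}{P^k(n-3)!}\sum_{l=k}^{n-3}(-2)^{-l}\Bigl(n-2+\sum_{j=1}^n\frac{\varepsilon_j}{p_j}\Bigr)^{l-k}\genfrac{[}{]}{0pt}{}{n-2}{l+1}\binom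 lk,$$ $\operatorname{sgn}_{\boldsymbol\varepsilon}(m)=+1$ if $m\ge 2Pm_0+\ell$, $-1$ if $m\le 2P(m_0-n+2)+\ell$, $0$ otherwise, and $$\mathcal{P}(q)=\frac12\sum_{\boldsymbol\varepsilon\in\{\pm1\}^n}\varepsilon_1\cdots\varepsilon_n\sum_{k=0}^{n-3}c_{\boldsymbol\varepsilon}(k)\sum_{m\equiv\ell\ (2P)}(\operatorname{sgn}_{\boldsymbol\varepsilon}(m)-\operatorname{sgn}(m))m^kq^{\frac{m^2}{4P}}.$$ Let $L=\sqrt{2P}\,\mathbb{Z}$, $L'=\frac{1}{\sqrt{2P}}\mathbb{Z}$. For $k\ge0$ and $\mu\in L'/L$ put $\theta_{k,\mu}(\tau)=\sum_{x\in L+\mu}x^kq^{x^2/2}$ and $\widetilde\theta_{k,\mu}(\tau)=\sum_{x\in L+\mu}\operatorname{sgn}(x)x^kq^{x^2/2}$. For $0\le k\le n-3$, $k=2\kappa+\iota$, $0\le r\le\kappa$, put $$\widetilde\eta_{k,r}(\tau)=-\frac12\sum_{\nu=0}^{2P-1}\sum_{\boldsymbol\varepsilon\in\{\pm1\}^n}\varepsilon_1\cdots\varepsilon_n\,c_{\boldsymbol\varepsilon}(k)e^{2\pi i\frac{\ell\nu}{2P}}\,\widetilde\theta_{2r+\iota,\frac{\nu}{\sqrt{2P}}}(\tau),$$ $$\eta_{k+1}(\tau)=-\frac12\sum_{\boldsymbol\varepsilon\in\{\pm1\}^n}\varepsilon_1\cdots\varepsilon_n\,c_{\boldsymbol\varepsilon}(k)\,\theta_{k+1,\frac{\ell}{\sqrt{2P}}}(\tau),\qquad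 d_{\kappa,\iota,r}=\frac{(4\pi i)^r(2\kappa+\iota)!}{2^\kappa(\kappa-r)!(2r+\iota)!}.$$ The integral is along the positive imaginary axis. (The function $\Psi$ is a factor of the homological block of the Seifert fibered integral homology sphere with singular fibers of orders $p_1,\dots,p_n$.) *)

(* Defs.v *)
From HB Require Import structures.
From mathcomp Require Import all_boot all_order all_algebra.
From mathcomp Require Import complex zify.
From mathcomp Require Import all_classical all_reals all_analysis.

Set Implicit Arguments.
Unset Strict Implicit.
Unset Printing Implicit Defensive.

Import Order.TTheory GRing.Theory Num.Theory.
Import numFieldNormedType.Exports.

Local Open Scope classical_set_scope.
Local Open Scope ring_scope.
Local Open Scope complex_scope.

(* The real-valued projections, not ['Re] and ['Im] of a numClosedFieldType. *)
Notation Re := complex.Re.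
Notation Im := complex.Im.

Section ComplexAnalysis.
Context {R : realType}.
Implicit Types (z tau : R[i]) (a : R).

Definition cexp z : R[i] := (expR (Re z))%:C * (cos (Im z) +i* sin (Im z)).

(* [qpow tau a] is q^a for q = e^(2 i pi tau); it depends on tau, not only
   on q, when a is not an integer. *)
Definition qpow tau a : R[i] := cexp ((2 * pi * a)%:C * 'i * tau).

(* tau^(N + 1/2); [sqrtc] is the root with argument in ]-pi/2, pi/2]. *)
Definition half_pow tau (N : nat) : R[i] := tau ^+ N * sqrtc tau.

(* [R[i]^o] only selects the normed-module topology of the field R[i]. *)
Definition csum (u : nat -> R[i]) : R[i] := limn (series (u : nat -> R[i]^o)).

Definition zsum (u : int -> R[i]) : R[i] :=
  csum (fun j => u (Posz j)) + csum (fun j => u (Negz j)).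

Definition cintegrable (D : set R) (f : R -> R[i]) : Prop :=
  (@lebesgue_measure R).-integrable D (fun y => (Re (f y))%:E) /\
  (@lebesgue_measure R).-integrable D (fun y => (Im (f y))%:E).

Definition cintegral (D : set R) (f : R -> R[i]) : R[i] :=
  (\int[@lebesgue_measure R]_(y in D) Re (f y)) +i*
  (\int[@lebesgue_measure R]_(y in D) Im (f y)).

(* Contour integrals from 0 to i*oo, parametrized by z = i y, dz = i dy. *)
Definition iR_integrable (F : R[i] -> R[i]) : Prop :=
  cintegrable `]0, +oo[ (fun y => F (y *i)).

Definition iR_integral (F : R[i] -> R[i]) : R[i] :=
  'i * cintegral `]0, +oo[ (fun y => F (y *i)).

End ComplexAnalysis.

Fixpoint stirling1 (a b : nat) : nat :=
  match a, b with
  | 0, 0 => 1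
  | 0, _.+1 => 0
  | _.+1, 0 => 0
  | a'.+1, b'.+1 => (stirling1 a' b' + a' * stirling1 a' b'.+1)%N
  end.

Section Seifert.
Variables (n : nat) (p : 'I_n -> nat).

(* eps in {1,-1}^n is encoded by booleans: eps_j = (-1) ^+ eps j. *)
Implicit Types (eps : {ffun 'I_n -> bool}).

Definition bigP : nat := \prod_j p j.

(* The integer P (n - 2 + sum_j eps_j / p_j); see [numerE]. *)
Definition numer eps : int :=
  (bigP * (n - 2))%:Z + \sum_j (-1) ^+ eps j * (bigP %/ p j)%:Z.

Definition m0 eps : int := (numer eps %/ (2 * bigP)%:Z)%Z.
Definition ell eps : int := (numer eps %% (2 * bigP)%:Z)%Z.

Definition sgn_eps eps (m : int) : int :=
  if m0 eps * (2 * bigP)%:Z + ell eps <= m then 1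
  else if m <= (m0 eps - n%:Z + 2) * (2 * bigP)%:Z + ell eps then -1
  else 0.

Section Functions.
Context (R : realType).
Implicit Types (tau : R[i]) (mu : R).

Definition sign_prod eps : R := \prod_j (-1) ^+ eps j.

Definition shift eps : R := (n - 2)%:R + \sum_j (-1) ^+ eps j / (p j)%:R.

Definition Psi tau : R[i] :=
  \sum_(eps : {ffun 'I_n -> bool}) (sign_prod eps)%:C *
    csum (fun m => 'C(m + n - 3, n - 3)%:R *
      qpow tau ((2 * bigP%:R * m%:R + bigP%:R * shift eps) ^+ 2
                / (4 * bigP%:R))).

Definition coef eps (k : nat) : R :=
  (-1) ^+ k / (bigP%:R ^+ k * ((n - 3)`!)%:R) *
  \sum_(k <= l < (n - 3).+1)
    (- 2) ^- l * shift eps ^+ (l - k) * (stirling1 (n - 2) l.+1)%:R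
    * 'C(l, k)%:R.

(* The sum over m congruent to ell modulo 2 P is indexed by m = ell + 2 P t. *)
Definition calP tau : R[i] :=
  2^-1 * \sum_(eps : {ffun 'I_n -> bool}) (sign_prod eps)%:C *
    \sum_(k < (n - 3).+1) (coef eps k)%:C *
      zsum (fun t => let m := ell eps + (2 * bigP)%:Z * t in
        (sgn_eps eps m - Num.sg m)%:~R * m%:~R ^+ k *
        qpow tau (m%:~R ^+ 2 / (4 * bigP%:R))).

Definition hatPsi tau : R[i] := Psi tau - calP tau.

Definition sqrt2P : R := Num.sqrt (2 * bigP%:R).

(* Sums over x in L + mu are indexed by x = sqrt(2P) t + mu; [mu] is a real
   representative of a class of L'/L. *)
Definition theta (k : nat) mu tau : R[i] :=
  zsum (fun t => let x := sqrt2P * t%:~R + mu in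
    (x ^+ k)%:C * qpow tau (x ^+ 2 / 2)).

Definition theta_tilde (k : nat) mu tau : R[i] :=
  zsum (fun t => let x := sqrt2P * t%:~R + mu in
    (Num.sg x * x ^+ k)%:C * qpow tau (x ^+ 2 / 2)).

(* For k = 2 kappa + iota: kappa = k./2 and iota = odd k. *)
Definition eta_tilde (k r : nat) tau : R[i] :=
  - 2^-1 * \sum_(nu < 2 * bigP) \sum_(eps : {ffun 'I_n -> bool})
    (sign_prod eps * coef eps k)%:C *
    cexp ((2 * pi * (ell eps)%:~R * nu%:R / (2 * bigP%:R))%:C * 'i) *
    theta_tilde (2 * r + odd k) (nu%:R / sqrt2P) tau.

(* [eta1 k] is eta_{k+1}. *)
Definition eta1 (k : nat) tau : R[i] :=
  - 2^-1 * \sum_(eps : {ffun 'I_n -> bool})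
    (sign_prod eps * coef eps k)%:C *
    theta k.+1 ((ell eps)%:~R / sqrt2P) tau.

End Functions.

End Seifert.

Definition dcoef (R : realType) (kappa iota r : nat) : R[i] :=
  ((4 * pi)%:C * 'i) ^+ r * (2 * kappa + iota)`!%:R /
  (2 ^+ kappa * (kappa - r)`!%:R * (2 * r + iota)`!%:R).

Arguments hatPsi {n} p {R} tau.
Arguments eta_tilde {n} p {R} k r tau.
Arguments eta1 {n} p {R} k tau.

Section NumerFacts.
Variables (n : nat) (p : 'I_n -> nat).
Hypothesis p_ge2 : forall i, (2 <= p i)%N.

Lemma bigP_gt0 : (0 < bigP p)%N.
Proof. by apply: prodn_gt0 => i; apply: leq_trans (p_ge2 i). Qed.

Lemma numerE (R : realType) (eps : {ffun 'I_n -> bool}) :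
  (numer p eps)%:~R = (bigP p)%:R * shift p R eps.
Proof.
rewrite /numer /shift mulrDr rmorphD /= -[X in X + _]/((_ * _)%N%:R) natrM.
congr (_ + _).
rewrite rmorph_sum mulr_sumr /=; apply: eq_bigr => j _.
rewrite rmorphM rmorphXn rmorphN1 /= mulrCA; congr (_ * _).
have pj0 : (p j)%:R != 0 :> R.
  by rewrite pnatr_eq0 -lt0n (leq_trans _ (p_ge2 j)).
apply: (mulIf pj0); rewrite mulfVK // -[_%:~R]/((_ %/ _)%N%:R) -natrM divnK //.
by rewrite /bigP (bigD1 j) //= dvdn_mulr.
Qed.

Lemma m0_ellE (eps : {ffun 'I_n -> bool}) :
  numer p eps = (2 * bigP p)%:Z * m0 p eps + ell p eps.
Proof. by rewrite mulrC -divz_eq. Qed.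

Lemma ell_bounds (eps : {ffun 'I_n -> bool}) :
  (0 < n)%N -> (forall i j, i != j -> coprime (p i) (p j)) ->
  1 <= ell p eps <= (2 * bigP p)%:Z - 1.
Proof.
move=> n0 copp; have P0 := bigP_gt0.
have M0 : 0 < (2 * bigP p)%:Z by rewrite ltz_nat muln_gt0.
have lt0e : 0 < ell p eps; last first.
  have ltM : ell p eps < (2 * bigP p)%:Z by exact: ltz_pmod.
  by move: (ell p eps) lt0e ltM => l; lia.
have ge0e : 0 <= ell p eps by apply: modz_ge0; apply: lt0r_neq0.
rewrite lt_neqAle ge0e andbT eq_sym; apply/negP => /eqP ell0.
pose j := Ordinal n0.
have copj : coprime (p j) (bigP p %/ p j).
  rewrite /bigP (bigD1 j) //= mulKn ?(leq_trans _ (p_ge2 j)) //.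
  elim/big_rec: _ => [|i x ij cx]; first by rewrite coprimen1.
  by rewrite coprimeMr cx andbT copp // eq_sym.
have dvP : (p j %| bigP p)%N by rewrite /bigP (bigD1 j) //= dvdn_mulr.
have : ((p j)%:Z %| numer p eps)%Z.
  by rewrite m0_ellE ell0 addr0 dvdz_mulr // dvdzE /= dvdn_mull.
rewrite /numer (bigD1 j) //= addrCA rpredDr; last first.
  apply: rpredD; first by rewrite dvdzE /= dvdn_mulr.
  apply: rpred_sum => i ij; apply: dvdz_mull; rewrite dvdzE /=.
  rewrite /bigP (bigD1 i) //= mulKn ?(leq_trans _ (p_ge2 i)) //.
  by rewrite (bigD1 j) 1?eq_sym //= dvdn_mulr.
rewrite dvdzE abszMsign /= => dvd.
have : (p j %| gcdn (p j) (bigP p %/ p j))%N by rewrite dvdn_gcd dvdnn.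
by rewrite (eqP copj) dvdn1 => /eqP pj1; move: (p_ge2 j); rewrite pj1.
Qed.

End NumerFacts.

(* Main.v *)
Require Import Defs.
From mathcomp Require Import all_boot all_order all_algebra.
From mathcomp Require Import complex ring lra zify.
From mathcomp Require Import all_classical all_reals all_analysis.
From mathcomp Require Import measurable_realfun.
Set Implicit Arguments.
Unset Strict Implicit.
Unset Printing Implicit Defensive.
Import Order.TTheory GRing.Theory Num.Theory.
Import numFieldNormedType.Exports.
Local Open Scope classical_set_scope.
Local Open Scope ring_scope.
Local Open Scope complex_scope.
Notation Re := complex.Re.
Notation Im := complex.Im.
Notation normc := ComplexField.Normc.normc.

(** Put a = -i tau and b = -1/a. At -1/tau the Gaussian q^(x^2/2) is exp(pi b x^2), where Re b < 0
    and, since Re tau is nonzero, Im b is nonzero.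

    [hatPsi] is a combination of false theta functions ([hatPsiE]). The numbers [coef] rewrite the
    binomial coefficient as a polynomial in 2Pm + P shift ([coef_bpoly]). The reflection symmetry of
    this polynomial, combined with eps -> -eps, turns the sum over m >= 0 into half of a sum over
    all integers with the sign [sgn_eps] ([zsum_sgn_eps], [PsiE]); subtracting [calP] replaces
    [sgn_eps] by the sign of the lattice point.

    False theta functions are reduced to true ones by [key_identity]: sgn(x) exp(pi b x^2) =
    int_0^oo x exp(-pi x^2 y) / sqrt(y + b) dy + sqrt(b) x int_R (1 + w^2)^(-3/2) exp(pi b x^2 / (1
    + w^2)) dw. Both integrals are error functions in disguise, and the error functions cancel.
    After multiplication by x^k and summation over the lattice ([theta_split]), both integrands
    contain a genuine theta series [Th] of degree k + 1. The first integral is the Eichler integral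
    of eta_{k+1}. In the second, Poisson summation ([theta_inversion]) replaces the parameter -b/(1
    + w^2) by its inverse a(1 + w^2), so every dual term is a Hermite polynomial times a Gaussian in
    w. Its integral has a closed form ([gaV_integral]), proportional to sgn(xi) times a Hermite
    polynomial times exp(-pi a xi^2): the dual series is again a false theta series, now at tau.
    Sorting frequencies modulo 2P gives [eta_tilde] ([dual_eta]), the coefficients d are those of
    the Hermite polynomials ([hermq_dcoef]), and sgn(Re tau) comes from sqrt(b) tau = sgn(Re tau)
    sqrt(-i) sqrt(tau) ([sqrtc_inv_mul]).

    Convergence rests on two facts. The signed weights sum to zero ([weight_sum0]), so the dual
    series has no zero frequency and [Th] stays bounded as its argument tends to 0 in a sector. The
    lattice points stay away from 0, so [Th] decays exponentially at infinity. Sum and integral are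
    first interchanged under a damping exp(-pi d x^2), and then d tends to 0. Poisson summation is
    proved with Fejér kernels ([poisson_real]), and complex Gaussian integrals are found from
    primitives built on the error function [cerf]. *)

(** * Arithmetic, modulus and exponential of complex numbers *)

Section ComplexBasics.
Context {R : realType}.
Implicit Types (z w : R[i]) (x y : R).

Lemma reD z w : Re (z + w) = Re z + Re w. Proof. by case: z w => [? ?] [? ?]. Qed.
Lemma imD z w : Im (z + w) = Im z + Im w. Proof. by case: z w => [? ?] [? ?]. Qed.
Lemma reN z : Re (- z) = - Re z. Proof. by case: z. Qed.
Lemma imN z : Im (- z) = - Im z. Proof. by case: z. Qed.
Lemma reM z w : Re (z * w) = Re z * Re w - Im z * Im w.
Proof. by case: z w => [? ?] [? ?]. Qed.
Lemma imM z w : Im (z * w) = Re z * Im w + Im z * Re w.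
Proof. by case: z w => [? ?] [? ?]. Qed.
Lemma re_real x : Re x%:C = x. Proof. by []. Qed.
Lemma im_real x : Im x%:C = 0. Proof. by []. Qed.
Lemma re_i : Re ('i : R[i]) = 0. Proof. by []. Qed.
Lemma im_i : Im ('i : R[i]) = 1. Proof. by []. Qed.
Lemma re_nat n : Re (n%:R : R[i]) = n%:R.
Proof. by rewrite -(rmorph_nat (real_complex R)). Qed.
Lemma im_nat n : Im (n%:R : R[i]) = 0.
Proof. by rewrite -(rmorph_nat (real_complex R)). Qed.


Definition complexRI := (reD, imD, reN, imN, reM, imM, re_real, im_real, re_i, im_i,
  re_nat, im_nat).

Lemma realcD x y : (x + y)%:C = x%:C + y%:C :> R[i]. Proof. exact: rmorphD. Qed.
Lemma realcN x : (- x)%:C = - x%:C :> R[i]. Proof. exact: rmorphN. Qed.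
Lemma realcM x y : (x * y)%:C = x%:C * y%:C :> R[i]. Proof. exact: rmorphM. Qed.
Lemma realcX x n : (x ^+ n)%:C = x%:C ^+ n :> R[i]. Proof. exact: rmorphXn. Qed.
Lemma realcV x : (x^-1)%:C = (x%:C)^-1 :> R[i]. Proof. exact: fmorphV. Qed.
Lemma realc_nat n : n%:R%:C = n%:R :> R[i]. Proof. exact: rmorph_nat. Qed.
Lemma realc_int (m : int) : m%:~R%:C = m%:~R :> R[i]. Proof. exact: rmorph_int. Qed.

Definition realcE := (realc_nat, realc_int, realcX, realcV, realcN, realcM).

Lemma realc_neq0 x : (x%:C != 0 :> R[i]) = (x != 0).
Proof. by rewrite fmorph_eq0. Qed.

Lemma complex_ext z w : Re z = Re w -> Im z = Im w -> z = w.
Proof. by case: z w => [a b] [c d] /= -> ->. Qed.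

Lemma re_sum I (s : seq I) (P : pred I) (F : I -> R[i]) :
  Re (\sum_(i <- s | P i) F i) = \sum_(i <- s | P i) Re (F i).
Proof. by elim/big_rec2: _ => //= i x y _ <-; rewrite reD. Qed.
Lemma im_sum I (s : seq I) (P : pred I) (F : I -> R[i]) :
  Im (\sum_(i <- s | P i) F i) = \sum_(i <- s | P i) Im (F i).
Proof. by elim/big_rec2: _ => //= i x y _ <-; rewrite imD. Qed.

Lemma normc_ge0 z : 0 <= normc z.
Proof. by case: z => a b; rewrite sqrtr_ge0. Qed.
Lemma sqr_normcE z : normc z ^+ 2 = Re z ^+ 2 + Im z ^+ 2.
Proof. by case: z => a b; rewrite sqr_sqrtr // addr_ge0 ?sqr_ge0. Qed.
Lemma normcM z w : normc (z * w) = normc z * normc w.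
Proof. exact: ComplexField.Normc.normcM. Qed.
Lemma normcV z : normc z^-1 = (normc z)^-1.
Proof. exact: ComplexField.Normc.normcV. Qed.
Lemma normc0 : normc (0 : R[i]) = 0.
Proof. exact: ComplexField.Normc.normc0. Qed.
Lemma normc1 : normc (1 : R[i]) = 1.
Proof. exact: ComplexField.Normc.normc1. Qed.
Lemma ler_normcD z w : normc (z + w) <= normc z + normc w.
Proof. exact: le_normcD. Qed.
Lemma normc_real x : normc x%:C = `|x|.
Proof. by rewrite /= expr0n /= addr0 sqrtr_sqr. Qed.
Lemma normc_i : normc ('i : R[i]) = 1.
Proof. by rewrite /= expr0n /= add0r expr1n sqrtr1. Qed.
Lemma normcX z n : normc (z ^+ n) = normc z ^+ n.
Proof. by elim: n => [|n IH]; rewrite ?normc1 // !exprS normcM IH. Qed.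
Lemma normc_nat n : normc (n%:R : R[i]) = n%:R.
Proof. by rewrite -(rmorph_nat (real_complex R)) normc_real normr_nat. Qed.
Lemma normc_eq0 z : (normc z == 0) = (z == 0).
Proof.
apply/eqP/eqP => [/ComplexField.Normc.eq0_normc //|->]; exact: normc0.
Qed.
Lemma normc_gt0 z : (0 < normc z) = (z != 0).
Proof. by rewrite lt_def normc_eq0 normc_ge0 andbT. Qed.

Lemma Re_le_normc z : `|Re z| <= normc z.
Proof.
rewrite -(@ler_pXn2r _ 2) ?nnegrE ?normc_ge0 // sqr_normcE real_normK ?num_real //.
by rewrite lerDl sqr_ge0.
Qed.
Lemma Im_le_normc z : `|Im z| <= normc z.
Proof.
rewrite -(@ler_pXn2r _ 2) ?nnegrE ?normc_ge0 // sqr_normcE real_normK ?num_real //.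
by rewrite lerDr sqr_ge0.
Qed.
Lemma normc_le z : normc z <= `|Re z| + `|Im z|.
Proof.
rewrite -(@ler_pXn2r _ 2) ?nnegrE ?normc_ge0 ?addr_ge0 // sqr_normcE.
rewrite sqrrD !real_normK ?num_real // -addrA lerD2l lerDr.
by rewrite mulrn_wge0 // mulr_ge0.
Qed.

Lemma normc_sum I (s : seq I) (P : pred I) (F : I -> R[i]) :
  normc (\sum_(i <- s | P i) F i) <= \sum_(i <- s | P i) normc (F i).
Proof.
elim/big_rec2: _ => [|i x y _ H]; first by rewrite normc0.
by apply: le_trans (ler_normcD _ _) _; rewrite lerD2l.
Qed.

Lemma re_cexp z : Re (cexp z) = expR (Re z) * cos (Im z).
Proof. by rewrite /cexp reM re_real im_real mul0r subr0. Qed.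
Lemma im_cexp z : Im (cexp z) = expR (Re z) * sin (Im z).
Proof. by rewrite /cexp imM re_real im_real mul0r addr0. Qed.

Lemma cexpD z w : cexp (z + w) = cexp z * cexp w.
Proof.
by apply: complex_ext; rewrite !(complexRI, re_cexp, im_cexp) expRD ?cosD ?sinD; ring.
Qed.
Lemma cexp_real x : cexp x%:C = (expR x)%:C.
Proof. by apply: complex_ext; rewrite ?re_cexp ?im_cexp /= ?cos0 ?sin0 ?mulr1 ?mulr0. Qed.
Lemma cexp0 : cexp (0 : R[i]) = 1.
Proof. by rewrite -[0]/(0%:C) cexp_real expR0. Qed.
Lemma normc_cexp z : normc (cexp z) = expR (Re z).
Proof.
rewrite /cexp normcM normc_real ger0_norm ?expR_ge0 //=.
by rewrite cos2Dsin2 sqrtr1 mulr1.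
Qed.
Lemma cexp_i y : cexp (y%:C * 'i) = cos y +i* sin y.
Proof.
have r : Re (y%:C * 'i : R[i]) = 0 by rewrite !complexRI mulr0 mul0r subr0.
have i : Im (y%:C * 'i : R[i]) = y by rewrite !complexRI mulr1 mul0r addr0.
by apply: complex_ext; rewrite ?re_cexp ?im_cexp r i expR0 mul1r.
Qed.

Lemma normc_opp z : normc (- z) = normc z. Proof. exact: normcN. Qed.

Definition normcE :=
  (normc_cexp, normc_nat, normc_i, normc_real, normc_opp, normcX, normcV, normcM).

Lemma cexp_neq0 z : cexp z != 0.
Proof. by rewrite -normc_gt0 normc_cexp expR_gt0. Qed.
Lemma cexpN z : cexp (- z) = (cexp z)^-1.
Proof.
by apply: (mulfI (cexp_neq0 z)); rewrite -cexpD subrr cexp0 divff ?cexp_neq0.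
Qed.
Lemma cexp_sum I (s : seq I) (P : pred I) (F : I -> R[i]) :
  cexp (\sum_(i <- s | P i) F i) = \prod_(i <- s | P i) cexp (F i).
Proof. by elim/big_rec2: _ => [|i x y _ <-]; rewrite ?cexp0 // cexpD. Qed.
Lemma pi_neq0 : (pi : R) != 0. Proof. by rewrite gt_eqF ?pi_gt0. Qed.

Lemma cexp_2pi_int (m : int) : cexp ((2 * pi * m%:~R)%:C * 'i) = 1 :> R[i].
Proof.
have nat_case (k : nat) : cexp ((2 * pi * k%:R)%:C * 'i) = 1 :> R[i].
  elim: k => [|k IH]; first by rewrite mulr0 mul0r cexp0.
  rewrite -[k.+1]addn1 natrD mulrDr mulr1 rmorphD mulrDl cexpD IH mul1r /cexp.
  have -> : Re ((2 * pi)%:C * 'i : R[i]) = 0 by rewrite !complexRI; rewrite ?(mulr0, mul0r, subrr).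
  have -> : Im ((2 * pi)%:C * 'i : R[i]) = pi *+ 2.
    by rewrite !complexRI mulr1 mul0r addr0 mulr_natl.
  by rewrite cos2pi sin2pi expR0 mul1r.
case: m => k; first exact: nat_case.
rewrite NegzE mulrNz mulrN rmorphN mulNr cexpN nat_case invr1 //.
Qed.
End ComplexBasics.
Arguments pi_neq0 R : clear implicits.

(** * Limits and derivatives of complex functions, taken componentwise *)

Section ComplexLimits.
Context {R : realType}.
Implicit Types (z w : R[i]).

(** Componentwise, so that real limit theorems transfer directly; [csum_eq] is the bridge to the
    norm topology in which [csum] is defined. *)
Definition ccvg {T} (F : set_system T) (f : T -> R[i]) (l : R[i]) :=
  Re (f x) @[x --> F] --> Re l /\ Im (f x) @[x --> F] --> Im l.

Lemma ccvg_cst T (F : set_system T) {FF : Filter F} l : ccvg F (fun=> l) l.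
Proof. by split; exact: cvg_cst. Qed.

Lemma ccvgD T (F : set_system T) {FF : Filter F} f g l m :
  ccvg F f l -> ccvg F g m -> ccvg F (fun x => f x + g x) (l + m).
Proof.
move=> [fr fi] [gr gi]; split; rewrite ?reD ?imD.
- by under eq_fun do rewrite reD; exact: cvgD.
- by under eq_fun do rewrite imD; exact: cvgD.
Qed.

Lemma ccvgN T (F : set_system T) {FF : Filter F} f l :
  ccvg F f l -> ccvg F (fun x => - f x) (- l).
Proof.
move=> [fr fi]; split; rewrite ?reN ?imN.
- by under eq_fun do rewrite reN; exact: cvgN.
- by under eq_fun do rewrite imN; exact: cvgN.
Qed.

Lemma ccvgM T (F : set_system T) {FF : Filter F} f g l m :
  ccvg F f l -> ccvg F g m -> ccvg F (fun x => f x * g x) (l * m).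
Proof.
move=> [fr fi] [gr gi]; split; rewrite ?reM ?imM.
- by under eq_fun do rewrite reM; apply: cvgB; exact: cvgM.
- by under eq_fun do rewrite imM; apply: cvgD; exact: cvgM.
Qed.

Lemma ccvg_real T (F : set_system T) {FF : Filter F} (f : T -> R) (x : R) :
  f t @[t --> F] --> x -> ccvg F (fun t => (f t)%:C) x%:C.
Proof. by split=> //=; exact: cvg_cst. Qed.

Lemma ccvg_sum T (F : set_system T) {FF : Filter F} I (s : seq I) (P : pred I)
    (f : I -> T -> R[i]) l :
  (forall i, P i -> ccvg F (f i) (l i)) ->
  ccvg F (fun x => \sum_(i <- s | P i) f i x) (\sum_(i <- s | P i) l i).
Proof.
move=> fl; elim: s => [|i s IH].
  by under eq_fun do rewrite big_nil; rewrite big_nil; exact: ccvg_cst.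
under eq_fun do rewrite big_cons; rewrite big_cons.
by case: ifPn => // Pi; apply: ccvgD => //; exact: fl.
Qed.

Lemma ccvg_cexp T (F : set_system T) {FF : Filter F} f l :
  ccvg F f l -> ccvg F (fun x => cexp (f x)) (cexp l).
Proof.
move=> [fr fi]; rewrite /cexp; apply: ccvgM.
  by apply: ccvg_real; apply: continuous_cvg => //; exact: continuous_expR.
split=> /=; apply: continuous_cvg => //.
- exact: continuous_cos.
- exact: continuous_sin.
Qed.

Lemma ccvg_unique T (F : set_system T) {FF : ProperFilter F} (f : T -> R[i]) l m :
  ccvg F f l -> ccvg F f m -> l = m.
Proof.
move=> [lr li] [mr mi]; apply: complex_ext.
- exact: (cvg_unique _ lr mr).
- exact: (cvg_unique _ li mi).
Qed.

Lemma ccvg_norm T (F : set_system T) {FF : Filter F} f l (h : T -> R) :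
  (\forall x \near F, normc (f x - l) <= h x) -> h x @[x --> F] --> 0 ->
  ccvg F f l.
Proof.
move=> fh h0; split; apply/cvgrPdist_le => e e0;
  move/cvgrPdist_le: h0 => /(_ e e0) h0; near=> x.
- have H : normc (f x - l) <= h x by near: x.
  have : `|0 - h x| <= e by near: x.
  rewrite sub0r normrN; apply: le_trans; apply: le_trans (ler_norm _).
  apply: le_trans H; rewrite distrC -reN -reD; exact: Re_le_normc.
- have H : normc (f x - l) <= h x by near: x.
  have : `|0 - h x| <= e by near: x.
  rewrite sub0r normrN; apply: le_trans; apply: le_trans (ler_norm _).
  apply: le_trans H; rewrite distrC -imN -imD; exact: Im_le_normc.
Unshelve. all: by end_near. Qed.

Lemma ccvg_normc T (F : set_system T) {FF : Filter F} f l :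
  ccvg F f l -> normc (f x) @[x --> F] --> normc l.
Proof.
move=> [fr fi].
have E z : normc z = Num.sqrt (Re z ^+ 2 + Im z ^+ 2) by case: z.
rewrite E; under eq_fun do rewrite E.
apply: continuous_cvg; first exact: sqrt_continuous.
rewrite !expr2; under eq_fun do rewrite !expr2.
by apply: cvgD; apply: cvgM.
Qed.

Lemma csum_eq (u : nat -> R[i]) l :
  ccvg \oo (fun N => \sum_(0 <= j < N) u j) l -> csum u = l.
Proof.
move=> [ur ui]; rewrite /csum; apply: (cvg_lim (@norm_hausdorff _ R[i]^o)).
apply/cvgrPdist_le => e e0.
(* A positive element of [R[i]] is real, so [Re e] is the actual radius; each component receives
   half of it. *)
have e0' : 0 < Re e / 2.
  by move: e0; rewrite ltcE => /andP[_ /= e0]; rewrite divr_gt0.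
move/cvgrPdist_le: ur => /(_ _ e0') ur; move/cvgrPdist_le: ui => /(_ _ e0') ui.
near=> n.
have A : `|Re l - Re (\sum_(0 <= j < n) u j)| <= Re e / 2 by near: n.
have B : `|Im l - Im (\sum_(0 <= j < n) u j)| <= Re e / 2 by near: n.
rewrite -[`|_|]/((normc _)%:C) lecE /=; apply/andP; split.
  by move: e0; rewrite ltcE => /andP[].
apply: le_trans (normc_le _) _.
rewrite [leRHS](splitr (Re e)) reD imD reN imN.
exact: lerD.
Unshelve. all: by end_near. Qed.

(** Derivative in a real parameter. Entire functions are differentiated along curves, which takes
    the place of holomorphy throughout. *)
Definition cder (f : R -> R[i]) (y : R) (d : R[i]) :=
  is_derive y 1 (fun t => Re (f t)) (Re d) /\
  is_derive y 1 (fun t => Im (f t)) (Im d).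

Lemma cder_cst c y : cder (fun=> c) y 0.
Proof. by split; exact: is_derive_cst. Qed.

Lemma cder_real (f : R -> R) (y d : R) : is_derive y 1 f d ->
  cder (fun t => (f t)%:C) y d%:C.
Proof. by split=> //=; exact: is_derive_cst. Qed.

Lemma cderD f g y d e : cder f y d -> cder g y e ->
  cder (fun t => f t + g t) y (d + e).
Proof.
move=> [fr fi] [gr gi]; split; rewrite ?reD ?imD.
- by under eq_fun do rewrite reD; exact: is_deriveD.
- by under eq_fun do rewrite imD; exact: is_deriveD.
Qed.

Lemma is_derive_mul (f g : R -> R) (y d e : R) :
  is_derive y 1 f d -> is_derive y 1 g e ->
  is_derive y 1 (fun t => f t * g t) (d * g y + f y * e).
Proof.
move=> fd ge; apply: (is_derive_eq (is_deriveM fd ge)).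
by rewrite /GRing.scale /=; ring.
Qed.

Lemma is_derive_add (f g : R -> R) (y d e : R) :
  is_derive y 1 f d -> is_derive y 1 g e -> is_derive y 1 (fun t => f t + g t) (d + e).
Proof. exact: is_deriveD. Qed.

Lemma is_derive_sub (f g : R -> R) (y d e : R) :
  is_derive y 1 f d -> is_derive y 1 g e -> is_derive y 1 (fun t => f t - g t) (d - e).
Proof. exact: is_deriveB. Qed.

Lemma is_derive_const (k y : R) : is_derive y 1 (fun=> k) 0.
Proof. exact: is_derive_cst. Qed.

Lemma cderM f g y d e : cder f y d -> cder g y e ->
  cder (fun t => f t * g t) y (d * g y + f y * e).
Proof.
move=> [fr fi] [gr gi]; split.
- under eq_fun do rewrite reM.
  apply: (is_derive_eq (is_deriveB (is_derive_mul fr gr) (is_derive_mul fi gi))).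
  by rewrite !complexRI; ring.
- under eq_fun do rewrite imM.
  apply: (is_derive_eq (is_deriveD (is_derive_mul fr gi) (is_derive_mul fi gr))).
  by rewrite !complexRI; ring.
Qed.

Lemma cderZ c f y d : cder f y d -> cder (fun t => c * f t) y (c * d).
Proof.
by move=> /(cderM (cder_cst c y)); rewrite mul0r add0r.
Qed.

Lemma cder_eq f y d e : cder f y d -> d = e -> cder f y e.
Proof. by move=> ? <-. Qed.

Lemma cder_exp f y d : cder f y d -> cder (fun t => cexp (f t)) y (d * cexp (f y)).
Proof.
move=> [fr fi].
have A := is_derive1_comp (is_derive_expR (Re (f y))) fr.
split.
- have B := is_derive1_comp (is_derive_cos (Im (f y))) fi.
  under eq_fun do rewrite re_cexp.
  apply: (is_derive_eq (is_derive_mul A B)).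
  by rewrite reM re_cexp im_cexp /=; ring.
- have B := is_derive1_comp (is_derive_sin (Im (f y))) fi.
  under eq_fun do rewrite im_cexp.
  apply: (is_derive_eq (is_derive_mul A B)).
  by rewrite imM re_cexp im_cexp /=; ring.
Qed.

Lemma cder_cvg f y d : cder f y d -> ccvg (nbhs y) f (f y).
Proof.
by move=> [fr fi]; split; apply/differentiable_continuous/derivable1_diffP;
  apply: ex_derive.
Qed.
End ComplexLimits.

(** * Complex Lebesgue integrals, dominated convergence, improper primitives *)

Section ComplexIntegrals.
Context {R : realType}.
Implicit Types (D : set R) (f g : R -> R[i]) (h : R -> R).
Local Notation mu := (@lebesgue_measure R).

Definition cmeas D f :=
  measurable_fun D (fun y => Re (f y)) /\ measurable_fun D (fun y => Im (f y)).

Definition rintegrable D h := mu.-integrable D (fun y => (h y)%:E).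

Lemma cmeas_cst D c : cmeas D (fun=> c).
Proof. by split; exact: measurable_cst. Qed.

Lemma cmeasD D f g : cmeas D f -> cmeas D g -> cmeas D (fun y => f y + g y).
Proof.
move=> [fr fi] [gr gi]; split.
- by under eq_fun do rewrite reD; exact: measurable_funD.
- by under eq_fun do rewrite imD; exact: measurable_funD.
Qed.

Lemma cmeasM D f g : cmeas D f -> cmeas D g -> cmeas D (fun y => f y * g y).
Proof.
move=> [fr fi] [gr gi]; split.
- under eq_fun do rewrite reM.
  by apply: measurable_funB; exact: measurable_funM.
- under eq_fun do rewrite imM.
  by apply: measurable_funD; exact: measurable_funM.
Qed.

Lemma cmeas_real D h : measurable_fun D h -> cmeas D (fun y => (h y)%:C).
Proof. by split=> //=; exact: measurable_cst. Qed.

Lemma cmeas_sum D I (s : seq I) (F : I -> R -> R[i]) :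
  (forall i, cmeas D (F i)) -> cmeas D (fun y => \sum_(i <- s) F i y).
Proof.
move=> mF; elim: s => [|i s IH].
  by under eq_fun do rewrite big_nil; exact: cmeas_cst.
by under eq_fun do rewrite big_cons; exact: cmeasD.
Qed.

Lemma cmeas_cexp D f : cmeas D f -> cmeas D (fun y => cexp (f y)).
Proof.
move=> [fr fi]; split.
- under eq_fun do rewrite re_cexp; apply: measurable_funM.
    by apply: measurableT_comp fr.
  by apply: measurableT_comp fi; apply: continuous_measurable_fun; exact: continuous_cos.
- under eq_fun do rewrite im_cexp; apply: measurable_funM.
    by apply: measurableT_comp fr.
  by apply: measurableT_comp fi; apply: continuous_measurable_fun; exact: continuous_sin.
Qed.

Lemma cmeas_continuous D f : measurable D -> (forall y, ccvg (nbhs y) f (f y)) -> cmeas D f.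
Proof.
move=> mD cf; split; apply: measurable_funTS; apply: continuous_measurable_fun => y.
- by have [] := cf y.
- by have [] := cf y.
Qed.

Lemma cmeas_lim D (u : nat -> R -> R[i]) f : measurable D ->
  (forall n, cmeas D (u n)) -> (forall y, D y -> ccvg \oo (u^~ y) (f y)) -> cmeas D f.
Proof.
move=> mD mu uf; split.
- apply: (measurable_fun_cvg (h := fun n y => Re (u n y))) => [n|y Dy].
    by have [] := mu n.
  by have [] := uf y Dy.
- apply: (measurable_fun_cvg (h := fun n y => Im (u n y))) => [n|y Dy].
    by have [] := mu n.
  by have [] := uf y Dy.
Qed.

Lemma rintegrable_le D (h k : R -> R) : measurable D -> measurable_fun D h ->
  (forall y, D y -> `|h y| <= k y) -> rintegrable D k -> rintegrable D h.
Proof.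
move=> mD mh hk ik; apply: le_integrable ik => //; first exact/measurable_EFinP.
move=> y Dy; rewrite lee_fin; apply: le_trans (hk _ Dy) _; exact: ler_norm.
Qed.

Lemma cintegrable_le D f h : measurable D -> cmeas D f ->
  (forall y, D y -> normc (f y) <= h y) -> rintegrable D h -> cintegrable D f.
Proof.
move=> mD [mr mi] fh ih; split; apply: rintegrable_le ih => // y Dy.
- exact: le_trans (Re_le_normc _) (fh y Dy).
- exact: le_trans (Im_le_normc _) (fh y Dy).
Qed.

Lemma cintegrableD D f g : measurable D -> cintegrable D f -> cintegrable D g ->
  cintegrable D (fun y => f y + g y).
Proof.
move=> mD [fr fi] [gr gi]; split.
- by under eq_fun do rewrite reD EFinD; exact: integrableD.
- by under eq_fun do rewrite imD EFinD; exact: integrableD.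
Qed.

Lemma rintegrableZ D (a : R) h : measurable D -> rintegrable D h ->
  rintegrable D (fun y => a * h y).
Proof.
move=> mD ih; rewrite /rintegrable; under eq_fun do rewrite EFinM.
exact: integrableZl.
Qed.

Lemma cintegrableZ D c f : measurable D -> cintegrable D f ->
  cintegrable D (fun y => c * f y).
Proof.
move=> mD [fr fi]; split.
- under eq_fun do rewrite reM EFinB; apply: integrableB => //; exact: rintegrableZ.
- under eq_fun do rewrite imM EFinD; apply: integrableD => //; exact: rintegrableZ.
Qed.

Lemma cintegralD D f g : measurable D -> cintegrable D f -> cintegrable D g ->
  cintegral D (fun y => f y + g y) = cintegral D f + cintegral D g.
Proof.
move=> mD [fr fi] [gr gi]; rewrite /cintegral.
under eq_Rintegral do rewrite reD.
rewrite RintegralD //; apply: complex_ext; rewrite /= ?reD ?imD //=.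
under eq_Rintegral do rewrite imD.
by rewrite RintegralD.
Qed.

Lemma cintegralZ D c f : measurable D -> cintegrable D f ->
  cintegral D (fun y => c * f y) = c * cintegral D f.
Proof.
move=> mD [fr fi]; rewrite /cintegral; apply: complex_ext; rewrite ?reM ?imM /=.
- under eq_Rintegral do rewrite reM.
  by rewrite RintegralB // ?RintegralZl //; apply: rintegrableZ.
- under eq_Rintegral do rewrite imM.
  by rewrite RintegralD // ?RintegralZl //; apply: rintegrableZ.
Qed.

Lemma eq_cintegral D f g : (forall y, D y -> f y = g y) ->
  cintegral D f = cintegral D g.
Proof.
move=> fg; rewrite /cintegral; congr (_ +i* _); apply: eq_Rintegral => y;
  by rewrite inE => /fg ->.
Qed.

Lemma eq_cintegrable D f g : measurable D -> (forall y, D y -> f y = g y) ->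
  cintegrable D f -> cintegrable D g.
Proof.
move=> mD fg [fr fi]; split.
- by apply: eq_integrable fr => // y; rewrite inE => /fg ->.
- by apply: eq_integrable fi => // y; rewrite inE => /fg ->.
Qed.

Lemma cintegral0 D : cintegral D (fun=> 0) = 0.
Proof. by rewrite /cintegral /= /Rintegral integral0_eq. Qed.

Lemma cintegrable0 D : cintegrable D (fun=> 0).
Proof. by split; exact: integrable0. Qed.

Lemma cintegrable_sum D I (s : seq I) (F : I -> R -> R[i]) : measurable D ->
  (forall i, cintegrable D (F i)) -> cintegrable D (fun y => \sum_(i <- s) F i y).
Proof.
move=> mD iF; elim: s => [|i s IH].
  by under eq_fun do rewrite big_nil; exact: cintegrable0.
by under eq_fun do rewrite big_cons; exact: cintegrableD.
Qed.

Lemma cintegral_sum D I (s : seq I) (F : I -> R -> R[i]) : measurable D ->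
  (forall i, cintegrable D (F i)) ->
  cintegral D (fun y => \sum_(i <- s) F i y) = \sum_(i <- s) cintegral D (F i).
Proof.
move=> mD iF; elim: s => [|i s IH].
  by under eq_fun do rewrite big_nil; rewrite big_nil cintegral0.
under eq_fun do rewrite big_cons; rewrite big_cons cintegralD ?IH //.
exact: cintegrable_sum.
Qed.

Lemma dominated_Rintegral D (u : nat -> R -> R) (h k : R -> R) : measurable D ->
  (forall n, measurable_fun D (u n)) ->
  (forall y, D y -> u n y @[n --> \oo] --> h y) ->
  (forall n y, D y -> `|u n y| <= k y) -> rintegrable D k ->
  rintegrable D h /\
  \int[mu]_(y in D) u n y @[n --> \oo] --> \int[mu]_(y in D) h y.
Proof.
move=> mD mu_ uh uk ik.
have mh : measurable_fun D h by apply: measurable_fun_cvg uh.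
have ih : rintegrable D h.
  apply: rintegrable_le ik => // y Dy.
  have H : `|u n y| @[n --> \oo] --> `|h y| by apply: cvg_norm; exact: uh.
  rewrite -(cvg_lim (@Rhausdorff R) H); apply: limr_le; first by apply: cvgP H.
  by apply: nearW => n; exact: uk.
split=> //.
have iu n : rintegrable D (u n) by apply: rintegrable_le ik => // y; exact: uk.
have [] := @dominated_convergence _ _ _ mu D mD (fun n y => (u n y)%:E)
  (fun y => (h y)%:E) (fun y => (k y)%:E).
- by move=> n; apply/measurable_EFinP; exact: mu_.
- exact/measurable_EFinP.
- by apply: aeW => y Dy; apply: cvg_EFin; [exact: nearW|exact: uh].
- exact: ik.
- by apply: aeW => y n Dy; rewrite lee_fin uk.
move=> _ _ H; apply: fine_cvg; rewrite fineK //.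
exact: integrable_fin_num.
Qed.

Lemma dominated_cintegral D (u : nat -> R -> R[i]) f h : measurable D ->
  (forall n, cmeas D (u n)) -> (forall y, D y -> ccvg \oo (u^~ y) (f y)) ->
  (forall n y, D y -> normc (u n y) <= h y) -> rintegrable D h ->
  cintegrable D f /\ ccvg \oo (fun n => cintegral D (u n)) (cintegral D f).
Proof.
move=> mD mu_ uf uh ih.
have [ir cr] := @dominated_Rintegral D (fun n y => Re (u n y)) (fun y => Re (f y)) h
  mD (fun n => (mu_ n).1) (fun y Dy => (uf y Dy).1)
  (fun n y Dy => le_trans (Re_le_normc _) (uh n y Dy)) ih.
have [ii ci] := @dominated_Rintegral D (fun n y => Im (u n y)) (fun y => Im (f y)) h
  mD (fun n => (mu_ n).2) (fun y Dy => (uf y Dy).2)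
  (fun n y Dy => le_trans (Im_le_normc _) (uh n y Dy)) ih.
by [].
Qed.

Lemma continuous_FTC2_R (F F' : R -> R) (a b : R) : a < b ->
  (forall y : R, is_derive y 1 F (F' y)) -> continuous F' ->
  \int[mu]_(y in `[a, b]) F' y = F b - F a.
Proof.
move=> ab dF cF'.
have cF : continuous F.
  by move=> y; apply/differentiable_continuous/derivable1_diffP; exact: ex_derive.
rewrite /Rintegral (@continuous_FTC2 _ F' F) //=.
- exact: continuous_subspaceT.
- split=> [y _||].
  + exact: ex_derive.
  + by apply: cvg_at_right_filter; exact: cF.
  + by apply: cvg_at_left_filter; exact: cF.
- by move=> y _; rewrite derive1E; exact: derive_val.
Qed.

Lemma cintegral_FTC f f' (a b : R) : a < b ->
  (forall y, cder f y (f' y)) -> (forall y, ccvg (nbhs y) f' (f' y)) ->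
  cintegral `[a, b] f' = f b - f a.
Proof.
move=> ab df cf; rewrite /cintegral.
rewrite (continuous_FTC2_R ab (fun y => (df y).1) (fun y => (cf y).1)).
rewrite (continuous_FTC2_R ab (fun y => (df y).2) (fun y => (cf y).2)).
by apply: complex_ext; rewrite ?reD ?imD ?reN ?imN.
Qed.

Let Rintegral_indic (D : set R) (S : set R) (h : R -> R) : measurable D -> measurable S ->
  \int[mu]_(y in D `&` S) h y = \int[mu]_(y in D) (h \_ S) y.
Proof. by move=> mD mS; rewrite Rintegral_mkcondr. Qed.

(** Cutting [F'] off outside the exhausting segments and dominating by its absolute value passes the
    fundamental theorem from segments to [D]. *)
Lemma improper_FTC_cvg_R D (F F' : R -> R) (a b : nat -> R) : measurable D ->
  (forall y : R, is_derive y 1 F (F' y)) -> continuous F' -> rintegrable D F' ->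
  (forall n, a n < b n) ->
  (forall n y, `[a n, b n]%classic y -> D y) ->
  (forall y, D y -> \forall n \near \oo, `[a n, b n]%classic y) ->
  F (b n) - F (a n) @[n --> \oo] --> \int[mu]_(y in D) F' y.
Proof.
move=> mD dF cF' iF' ab abD Dab.
have mab n : measurable (`[a n, b n]%classic : set R) by exact: measurable_itv.
have H : \int[mu]_(y in D) (F' \_ `[a n, b n]) y @[n --> \oo] -->
    \int[mu]_(y in D) F' y.
  apply: (proj2 (@dominated_Rintegral D (fun n y => (F' \_ `[a n, b n]) y) F'
    (fun y => `|F' y|) mD _ _ _ _)).
  - move=> n; apply/(measurable_restrict _ (mab n) mD).
    by apply: measurable_funTS; exact: continuous_measurable_fun.
  - move=> y Dy; apply/cvgrPdist_le => e e0.
    near=> n; rewrite /patch mem_set; last by near: n; exact: Dab.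
    by rewrite subrr normr0 ltW.
  - by move=> n y Dy; rewrite /patch; case: ifP => // _; rewrite normr0.
  - exact: (integrable_abse iF').
have E n : \int[mu]_(y in D) (F' \_ `[a n, b n]) y = F (b n) - F (a n).
  rewrite -Rintegral_indic // -(continuous_FTC2_R (ab n) dF cF').
  congr (Rintegral _ _ _); apply/seteqP; split=> y //= => [[]//|yab]; split=> //.
  exact: abD yab.
by move: H; under eq_fun do rewrite E.
Unshelve. all: by end_near. Qed.

Lemma improper_FTC_cvg D f f' (a b : nat -> R) : measurable D ->
  (forall y, cder f y (f' y)) -> (forall y, ccvg (nbhs y) f' (f' y)) ->
  cintegrable D f' ->
  (forall n, a n < b n) ->
  (forall n y, `[a n, b n]%classic y -> D y) ->
  (forall y, D y -> \forall n \near \oo, `[a n, b n]%classic y) ->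
  ccvg \oo (fun n => f (b n) - f (a n)) (cintegral D f').
Proof.
move=> mD df cf [ir ii] ab abD Dab; split; rewrite /cintegral /=.
- under eq_fun do rewrite reD reN.
  by apply: (improper_FTC_cvg_R mD (fun y => (df y).1) (fun y => (cf y).1)).
- under eq_fun do rewrite imD imN.
  by apply: (improper_FTC_cvg_R mD (fun y => (df y).2) (fun y => (cf y).2)).
Qed.

Lemma improper_FTC D f f' (a b : nat -> R) (l : R[i]) : measurable D ->
  (forall y, cder f y (f' y)) -> (forall y, ccvg (nbhs y) f' (f' y)) ->
  cintegrable D f' ->
  (forall n, a n < b n) ->
  (forall n y, `[a n, b n]%classic y -> D y) ->
  (forall y, D y -> \forall n \near \oo, `[a n, b n]%classic y) ->
  ccvg \oo (fun n => f (b n) - f (a n)) l -> cintegral D f' = l.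
Proof.
move=> mD df cf itf ab abD Dab; apply: ccvg_unique.
exact: improper_FTC_cvg.
Qed.
End ComplexIntegrals.

(** * The complex error function and its limit in a sector *)

Section Erf.
Context {R : realType}.
Implicit Types (z w : R[i]).
Local Notation mu := (@lebesgue_measure R).

Lemma cder_under_integral (f f' : R -> R -> R[i]) (a e M : R) : 0 < e ->
  (forall s t, cder (f^~ t) s (f' s t)) ->
  (forall s t, ccvg (nbhs t) (f s) (f s t)) ->
  (forall s t, `|s - a| < e -> `[0, 1]%classic t -> normc (f' s t) <= M) ->
  cder (fun s => cintegral `[0, 1] (f s)) a (cintegral `[0, 1] (f' a)).
Proof.
move=> e0 df cf fM.
have aI : `]a - e, a + e[%classic a by rewrite /= in_itv /= ltrBlDr ltrDl e0.
have IE s : `]a - e, a + e[%classic s -> `|s - a| < e.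
  by rewrite /= in_itv /= ltr_distl.
have M0 : 0 <= M.
  apply: le_trans (normc_ge0 _) (fM a 0 _ _); first by rewrite subrr normr0.
  by rewrite /= in_itv /= lexx ler01.
have iM : mu.-integrable `[0, 1] (EFin \o (cst M : R -> R)).
  apply: continuous_compact_integrable; first exact: segment_compact.
  by apply: continuous_subspaceT => ?; exact: cvg_cst.
have key (g g' : R -> R -> R) : (forall s t : R, is_derive s 1 (g^~ t) (g' s t)) ->
    (forall s, continuous (g s)) ->
    (forall s t, `|s - a| < e -> `[0, 1]%classic t -> `|g' s t| <= M) ->
    is_derive a 1 (fun s => \int[mu]_(t in `[0, 1]) g s t)
      (\int[mu]_(t in `[0, 1]) g' a t).
  move=> dg cg gM.
  have pE s t : partial1of2 g s t = g' s t.
    by rewrite partial1of2E; have := dg s t => ?; exact: derive_val.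
  have ig s : `]a - e, a + e[%classic s -> mu.-integrable `[0, 1] (EFin \o g s).
    move=> _; apply: continuous_compact_integrable; first exact: segment_compact.
    exact: continuous_subspaceT.
  have dgI s t : `]a - e, a + e[%classic s -> `[0, 1]%classic t -> derivable (g^~ t) s 1.
    by move=> _ _; have := dg s t => ?; exact: ex_derive.
  have bd s t : `]a - e, a + e[%classic s -> `[0, 1]%classic t ->
      `|partial1of2 g s t| <= cst M t.
    by move=> /IE sa t01; rewrite pE; exact: gM.
  have m01 : measurable (`[0, 1]%classic : set R) by exact: measurable_itv.
  apply: DeriveDef.
    exact: (@derivable_under_integral R _ _ mu g _ m01 a _ _ aI ig dgI (cst M) (fun=> M0) iM bd).
  rewrite -derive1E (@differentiation_under_integral R _ _ mu g _ m01 a _ _ aI ig dgI (cst M) (fun=> M0) iM bd).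
  by apply: eq_Rintegral => t _; rewrite pE.
split; rewrite /cintegral /=.
- apply: (key (fun s t => Re (f s t)) (fun s t => Re (f' s t))) => [s t|s t|s t sa t01].
  + by have [] := df s t.
  + by have [] := cf s t.
  + exact: le_trans (Re_le_normc _) (fM s t sa t01).
- apply: (key (fun s t => Im (f s t)) (fun s t => Im (f' s t))) => [s t|s t|s t sa t01].
  + by have [] := df s t.
  + by have [] := cf s t.
  + exact: le_trans (Im_le_normc _) (fM s t sa t01).
Qed.

Definition gker z (t : R) : R[i] := cexp (- (pi * t ^+ 2)%:C * z ^+ 2).

(** The entire function erf(sqrt(pi) z), written over the fixed segment [0, 1] so that z is a mere
    parameter of the integrand and no contour appears. *)
Definition cerf z : R[i] := 2 * z * cintegral `[0, 1] (gker z).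

Lemma cerfN z : cerf (- z) = - cerf z.
Proof. by rewrite /cerf /gker sqrrN mulrN mulNr. Qed.

Lemma cder_pow2 f (y : R) d : cder f y d -> cder (fun t => f t ^+ 2) y (2 * f y * d).
Proof.
move=> fd; rewrite (_ : (fun t => _) = (fun t => f t * f t)); last first.
  by apply/funext => t; rewrite expr2.
by apply: cder_eq (cderM fd fd) _; ring.
Qed.

Lemma cder_id (y : R) : cder (fun t => t%:C) y (1 : R[i]).
Proof. exact: (cder_real (is_derive_id _ _)). Qed.

Lemma cder_gker z (t : R) :
  cder (gker z) t (- (2 * pi)%:C * z ^+ 2 * t%:C * gker z t).
Proof.
have H : cder (fun t : R => - pi%:C * z ^+ 2 * (t%:C ^+ 2)) t
    (- pi%:C * z ^+ 2 * (2 * t%:C * 1)).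
  apply: cderZ; apply: cder_pow2; exact: cder_id.
rewrite /gker (_ : (fun t => _) = fun t : R => cexp (- pi%:C * z ^+ 2 * (t%:C ^+ 2))).
  apply: cder_eq (cder_exp H) _.
  rewrite !realcE.
  rewrite (_ : - pi%:C * z ^+ 2 * t%:C ^+ 2 = - (pi%:C * t%:C ^+ 2) * z ^+ 2); last by ring.
  by ring.
by apply/funext => u; congr cexp; rewrite !realcE; ring.
Qed.

Lemma gker_cvg z (t : R) : ccvg (nbhs t) (gker z) (gker z t).
Proof. exact: cder_cvg (cder_gker z t). Qed.

(** Differentiation under the integral gives [2 f'] times the integral of [g], plus [2 f] times that
    of [g']. The latter integrand is [2 f'] times t dg/dt, so an integration by parts leaves only
    the boundary value at t = 1. *)
Lemma cder_erf (f f' : R -> R[i]) (a : R) :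
  (forall s, cder f s (f' s)) -> (forall s, ccvg (nbhs s) f' (f' s)) ->
  cder (fun s => cerf (f s)) a (2 * cexp (- pi%:C * f a ^+ 2) * f' a).
Proof.
move=> df cf'.
pose g s t := gker (f s) t.
pose g' s t := - (pi * t ^+ 2)%:C * (2 * f s * f' s) * gker (f s) t.
have dg s t : cder (g^~ t) s (g' s t).
  by apply: cder_exp; apply: cderZ; exact: cder_pow2.
(* [W] bounds [g'] uniformly for t in [0, 1] and is continuous in s, hence at most [W a + 1] near
   [a]. *)
pose W s := (2 * pi) * (normc (f s) * normc (f' s)) * expR (pi * normc (f s) ^+ 2).
have Wa : W s @[s --> nbhs a] --> W a.
  have cf : normc (f s) @[s --> nbhs a] --> normc (f a).
    by apply: ccvg_normc; exact: cder_cvg (df a).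
  apply: cvgM.
    by apply: cvgM; [exact: cvg_cst|apply: cvgM => //; exact: ccvg_normc].
  apply: continuous_cvg; first exact: continuous_expR.
  apply: cvgM; first exact: cvg_cst.
  by rewrite expr2; under eq_fun do rewrite expr2; exact: cvgM.
have [e /= e0 He] : \forall s \near a, W s <= W a + 1.
  move/cvgrPdist_le: Wa => /(_ 1 ltr01); apply: filterS => s H.
  rewrite -lerBlDl; apply: le_trans H; rewrite distrC; exact: ler_norm.
have gW s t : `[0, 1]%classic t -> normc (g' s t) <= W s.
  rewrite /= in_itv /= => /andP[t0 t1].
  have t21 : t ^+ 2 <= 1 by rewrite expr_le1.
  rewrite /g' /gker !normcE ger0_norm ?mulr_ge0 ?pi_ge0 ?sqr_ge0 //.
  rewrite /W; apply: ler_pM => //; rewrite ?mulr_ge0 ?normc_ge0 ?pi_ge0 ?sqr_ge0 //.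
    rewrite !mulrA; do 2 (apply: ler_wpM2r; first exact: normc_ge0).
    by rewrite -mulrA -expr2 [leLHS]mulrC ler_wpM2l // ler_piMr ?pi_ge0.
  rewrite ler_expR; apply: le_trans (ler_norm _) _.
  apply: le_trans (Re_le_normc _) _.
  rewrite !normcE ger0_norm ?mulr_ge0 ?pi_ge0 ?sqr_ge0 //.
  by rewrite ler_wpM2r ?exprn_ge0 ?normc_ge0 // ler_piMr ?pi_ge0.
have dK : cder (fun s => cintegral `[0, 1] (g s)) a (cintegral `[0, 1] (g' a)).
  apply: (@cder_under_integral g g' a e (W a + 1)) => //.
  - by move=> s t; exact: gker_cvg.
  - move=> s t sa t01; apply: le_trans (gW s t t01) (He _ _).
    by rewrite /ball_ /= distrC.
have m01 : measurable (`[0, 1]%classic : set R) by exact: measurable_itv.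
have icont (h : R -> R[i]) : (forall t, ccvg (nbhs t) h (h t)) -> cintegrable `[0, 1] h.
  move=> ch; split; apply: continuous_compact_integrable; try exact: segment_compact;
    by apply: continuous_subspaceT => t; have [] := ch t.
have d2 : cder (fun s => 2 * f s) a (2 * f' a) by exact: cderZ.
apply: cder_eq (cderM d2 dK) _.
(* Integration by parts: [h'] is [g] plus t dg/dt, and [h] vanishes at 0. *)
pose h (t : R) := t%:C * g a t.
pose h' (t : R) := 1 * g a t + t%:C * (- (2 * pi)%:C * f a ^+ 2 * t%:C * g a t).
have dh t : cder h t (h' t) by apply: cderM; [exact: cder_id|exact: cder_gker].
have cg t : ccvg (nbhs t) (g a) (g a t) by exact: gker_cvg.
have cid (t : R) : ccvg (nbhs t) (fun t : R => t%:C) t%:C by apply: ccvg_real; exact: cvg_id.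
have cq (t : R) : ccvg (nbhs t)
    (fun t => t%:C * (- (2 * pi)%:C * f a ^+ 2 * t%:C * g a t))
    (t%:C * (- (2 * pi)%:C * f a ^+ 2 * t%:C * g a t)).
  by apply: ccvgM => //; apply: ccvgM => //; apply: ccvgM => //; exact: ccvg_cst.
have ch t : ccvg (nbhs t) h' (h' t).
  by apply: ccvgD => //; apply: ccvgM => //; exact: ccvg_cst.
have := cintegral_FTC ltr01 dh ch.
rewrite /h /h' mul0r subr0 mul1r.
rewrite cintegralD //; last 2 first.
- by apply: icont => t; apply: ccvgM => //; exact: ccvg_cst.
- exact: icont.
rewrite (@eq_cintegral _ _ (fun y : R => 1 * g a y) (g a)); last by move=> y _; rewrite mul1r.
move=> E.
have <- : cintegral `[0, 1] (fun t => 2 * f' a *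
    (t%:C * (- (2 * pi)%:C * f a ^+ 2 * t%:C * g a t))) = 2 * f a * cintegral `[0, 1] (g' a).
  rewrite -cintegralZ //.
    apply: eq_cintegral => t _; rewrite /g' /g !realcE; ring.
  apply: icont => t; rewrite /g'; apply: ccvgM; last exact: cg.
  apply: ccvgM; last exact: ccvg_cst.
  apply: ccvgN; apply: ccvg_real; apply: cvgM; first exact: cvg_cst.
  exact: exprn_continuous.
rewrite cintegralZ //; last exact: icont.
rewrite -mulrDr E /g /gker expr1n mulr1 mulrAC.
by [].
Qed.

(** Mean value theorem on the vertical segment from p to p + iq, where the derivative has modulus at
    most 2|q| exp(-pi (p^2 - q^2)). Real and imaginary parts are treated separately, which doubles
    the constant. *)
Lemma cerf_vertical (p q : R) :
  normc (cerf (p +i* q) - cerf p%:C) <= 4 * `|q| * expR (- pi * (p ^+ 2 - q ^+ 2)).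
Proof.
pose f (s : R) : R[i] := p%:C + s%:C * (q%:C * 'i).
have df s : cder f s (q%:C * 'i).
  apply: (cder_eq (cderD (cder_cst _ _) (cderM (cder_id _) (cder_cst _ _)))).
  by ring.
have cf' (s : R) : ccvg (nbhs s) (fun=> q%:C * 'i) (q%:C * 'i) by exact: ccvg_cst.
have dF s := cder_erf s df cf'.
pose F' s := 2 * cexp (- pi%:C * f s ^+ 2) * (q%:C * 'i).
pose B := 2 * `|q| * expR (- pi * (p ^+ 2 - q ^+ 2)).
have F'B s : s \in `]0, 1[%R -> normc (F' s) <= B.
  move=> s01; have /andP[s0 s1] : 0 < s < 1 by move: s01; rewrite in_itv.
  rewrite /F' !normcE mulr1 mulrAC /B.
  apply: ler_wpM2l; first by rewrite mulr_ge0.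
  rewrite ler_expR -realcN expr2 !complexRI.
  rewrite !(mulr0, mul0r, mulr1, subr0, addr0, add0r, sub0r).
  have H : s ^+ 2 * q ^+ 2 <= q ^+ 2.
    by apply: ler_piMl; [exact: sqr_ge0|rewrite expr_le1 // ltW].
  rewrite !mulNr lerN2 ler_wpM2l ?pi_ge0 //.
  rewrite -!expr2 exprMn; lra.
have key (h h' : R -> R) : (forall s : R, is_derive s 1 h (h' s)) ->
    (forall s, s \in `]0, 1[%R -> `|h' s| <= B) -> `|h 1 - h 0| <= B.
  move=> dh hB.
  have ch : {within `[0, 1], continuous h}.
    apply: continuous_subspaceT => s.
    by apply/differentiable_continuous/derivable1_diffP; exact: ex_derive.
  have [c c01 ->] := @MVT _ h h' 0 1 ltr01 (fun s _ => dh s) ch.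
  by rewrite subr0 mulr1; exact: hB.
have f0 : f 0 = p%:C by rewrite /f mul0r addr0.
have f1 : f 1 = p +i* q.
  by rewrite /f mul1r; apply: complex_ext; rewrite !complexRI /= ?mulr0 ?mulr1; ring.
have A1 := key _ _ (fun s => (dF s).1)
  (fun s s01 => le_trans (Re_le_normc (F' s)) (F'B s s01)).
have A2 := key _ _ (fun s => (dF s).2)
  (fun s s01 => le_trans (Im_le_normc (F' s)) (F'B s s01)).
apply: le_trans (normc_le _) _.
rewrite reD imD reN imN -f0 -f1; apply: le_trans (lerD A1 A2) _.
by rewrite /B; lra.
Qed.
Lemma cerf_realE (x : R) : cerf x%:C = (Re (cerf x%:C))%:C.
Proof.
apply: complex_ext => //; rewrite /cerf /cintegral.
have E t : gker x%:C t = (expR (- (pi * t ^+ 2) * x ^+ 2))%:C.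
  by rewrite -cexp_real /gker; congr cexp; rewrite !realcE.
have -> : \int[mu]_(y in `[0, 1]) Im (gker x%:C y) = 0.
  rewrite (@eq_Rintegral _ _ _ _ _ (cst 0)); last by move=> t _; rewrite E.
  by rewrite /Rintegral /= integral0_eq.
have E2 : Im (2 * x%:C : R[i]) = 0 by rewrite !complexRI mulr0 mul0r addr0.
by rewrite imM E2 mul0r addr0 [Im (_ +i* _)]/= mulr0.
Qed.

(** On the real axis the derivative is a multiple of the Gaussian, so the Gaussian integral and
    oddness give the limit. *)
Lemma cvg_cerf_pos (v : nat -> R) : (forall n, 0 < v n) -> v n @[n --> \oo] --> +oo ->
  Re (cerf (v n / Num.sqrt pi)%:C) @[n --> \oo] --> (1 : R).
Proof.
move=> v0 voo.
have spi : 0 < Num.sqrt pi :> R by rewrite sqrtr_gt0 pi_gt0.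
pose f (s : R) : R[i] := (s / Num.sqrt pi)%:C.
have df s : cder f s ((Num.sqrt pi)^-1)%:C.
  apply: cder_real; apply: (is_derive_eq (is_derive_mul (is_derive_id _ _) (is_derive_cst _ _ _))).
  by rewrite mulr0 addr0 mul1r.
have cf' (s : R) : ccvg (nbhs s) (fun=> ((Num.sqrt pi)^-1)%:C) ((Num.sqrt pi)^-1 : R)%:C.
  exact: ccvg_cst.
have dF s := (cder_erf s df cf').1.
have F'E s : Re (2 * cexp (- pi%:C * f s ^+ 2) * ((Num.sqrt pi)^-1)%:C) =
    2 / Num.sqrt pi * gauss_fun s.
  have -> : - pi%:C * f s ^+ 2 = (- s ^+ 2)%:C.
    rewrite /f -realcX -realcN -realcM exprMn exprVn sqr_sqrtr ?pi_ge0 //.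
    by congr (_%:C); move: pi (pi_neq0 R) => P P0; field.
  rewrite cexp_real -realc_nat -!realcM /gauss_fun /=; ring.
pose F (s : R) := Re (cerf (f s)).
have dF' (s : R) : is_derive s 1 F (2 / Num.sqrt pi * gauss_fun s).
  by rewrite -F'E; exact: dF.
have cF' : continuous (fun s => 2 / Num.sqrt pi * gauss_fun s : R).
  by move=> s; apply: cvgM; [exact: cvg_cst|exact: continuous_gauss_fun].
have iF' : rintegrable setT (fun s => 2 / Num.sqrt pi * gauss_fun s : R).
  by apply: rintegrableZ => //; exact: integrableT_gauss.
have H := @improper_FTC_cvg_R R setT F _ (fun n => - v n) v measurableT dF' cF' iF'.
have FN s : F (- s) = - F s.
  by rewrite /F /f mulNr realcN cerfN reN.
have I2 : \int[mu]_s (2 / Num.sqrt pi * gauss_fun s) = 2 :> R.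
  rewrite RintegralZl //; last exact: integrableT_gauss.
  by rewrite /Rintegral integralT_gauss /= divfK // gt_eqF.
have {}H : F (v n) @[n --> \oo] --> (1 : R).
  have : 2^-1 * (F (v n) - F (- v n)) @[n --> \oo] --> 2^-1 * (2 : R).
    apply: cvgM; first exact: cvg_cst.
    rewrite -[X in _ --> X]I2; apply: H => //.
    - by move=> n; rewrite gtrN // v0.
    - move=> y _; move/cvgryPge : voo => /(_ `|y|); apply: filterS => n.
      by rewrite /= in_itv /= -ler_norml.
  rewrite mulVf //; apply: cvg_trans; apply: near_eq_cvg; apply: nearW => n.
  by rewrite FN; field.
exact: H.
Qed.

Lemma cvg_cerf_real (u : nat -> R) : u n @[n --> \oo] --> +oo ->
  ccvg \oo (fun n => cerf (u n)%:C) 1.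
Proof.
move=> uoo.
have spi : 0 < Num.sqrt pi :> R by rewrite sqrtr_gt0 pi_gt0.
(* The maximum with 1 makes every term positive, as [cvg_cerf_pos] requires, and is eventually
   inactive. *)
pose v n := Num.sqrt pi * Num.max (u n) 1.
have v0 n : 0 < v n by rewrite mulr_gt0 // lt_max ltr01 orbT.
have voo : v n @[n --> \oo] --> +oo.
  apply/cvgryPge => A; move/cvgryPge : uoo => /(_ (`|A| / Num.sqrt pi)).
  apply: filterS => n; rewrite ler_pdivrMr // => H.
  apply: le_trans (ler_norm _) _; apply: le_trans H _.
  by rewrite /v mulrC ler_wpM2l ?(ltW spi) // le_max lexx.
suff H : Re (cerf (u n)%:C) @[n --> \oo] --> (1 : R).
  split; first exact: H.
  by under eq_fun do rewrite cerf_realE im_real; exact: cvg_cst.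
apply: cvg_trans (cvg_cerf_pos v0 voo); apply: near_eq_cvg.
move/cvgryPge : uoo => /(_ 1); apply: filterS => n u1.
rewrite /v (max_idPl _) //; congr (Re (cerf _%:C)).
by rewrite mulrC mulKf // gt_eqF.
Qed.

(** In the sector q^2 <= (1 - c) p^2, [cerf_vertical] and exp(-s) <= 1/s bound the distance to the
    value on the real axis by a multiple of 1/p. *)
Lemma cvg_cerf (p q : nat -> R) (c : R) : 0 < c -> p n @[n --> \oo] --> +oo ->
  (\forall n \near \oo, q n ^+ 2 <= (1 - c) * p n ^+ 2) ->
  ccvg \oo (fun n => cerf (p n +i* q n)) 1.
Proof.
move=> c0 poo qp.
have -> : (fun n => cerf (p n +i* q n)) = (fun n => (cerf (p n +i* q n) - cerf (p n)%:C) + cerf (p n)%:C).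
  by apply/funext => n; rewrite subrK.
rewrite -[X in ccvg _ _ X]add0r; apply: ccvgD; last exact: cvg_cerf_real.
pose h n := 4 / (pi * c) * (p n)^-1.
have h0 : h n @[n --> \oo] --> (0 : R).
  rewrite /h -[X in _ --> X](mulr0 (4 / (pi * c))); apply: cvgM; first exact: cvg_cst.
  by apply/gtr0_cvgV0; [move/cvgryPgt: poo => /(_ 0)|].
apply: (ccvg_norm _ h0).
have p0 : \forall n \near \oo, 0 < p n by move/cvgryPgt: poo => /(_ 0).
near=> n; rewrite subr0.
have P0 : 0 < p n by near: n.
have Q : q n ^+ 2 <= (1 - c) * p n ^+ 2 by near: n.
apply: le_trans (cerf_vertical _ _) _.
have qp1 : `|q n| <= p n.
  rewrite -(@ler_pXn2r _ 2) ?nnegrE ?(ltW P0) // real_normK ?num_real //.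
  by apply: le_trans Q _; rewrite mulrBl mul1r gerBl mulr_ge0 ?sqr_ge0 ?ltW.
have E1 : expR (- pi * (p n ^+ 2 - q n ^+ 2)) <= (pi * c * p n ^+ 2)^-1.
  have K0 : 0 < pi * c * p n ^+ 2 by rewrite !mulr_gt0 ?pi_gt0 ?exprn_gt0.
  rewrite -[leLHS]invrK lef_pV2 ?posrE ?invr_gt0 ?expR_gt0 //.
  rewrite -expRN; apply: le_trans (expR_ge1Dx _).
  apply: ler_wpDl => //; rewrite mulNr opprK -mulrA ler_wpM2l ?pi_ge0 //; lra.
apply: le_trans (ler_pM _ _ (ler_wpM2l _ qp1) E1) _; rewrite ?mulr_ge0 ?expR_ge0 //.
rewrite le_eqVlt; apply/orP; left; apply/eqP; rewrite /h.
by move: pi (pi_neq0 R) => pp pp0; field; rewrite (gt_eqF P0) (gt_eqF c0).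
Unshelve. all: by end_near. Qed.
End Erf.

(** * Sums over the integers with quadratic decay *)

Section IntegerSums.
Context {R : realType}.
Implicit Types (u v : int -> R[i]) (C : R).

(** [Negz j] is -(j + 1), so the window is -N <= t < N; the missing term at N reappears in later
    index corrections. *)
Definition bsum u (N : nat) : R[i] := \sum_(0 <= j < N) (u (Posz j) + u (Negz j)).

(** The summability criterion of the whole proof: it yields convergence and an explicit bound on the
    sum, and up to the constant it survives translation, reflection and restriction to a residue
    class. *)
Definition dec C u := forall t : int, normc (u t) <= C / (1 + t%:~R ^+ 2).

Lemma onepsqr_gt0 (x : R) : 0 < 1 + x ^+ 2.
Proof. by rewrite ltr_pwDl // sqr_ge0. Qed.

(** Induction against the telescoping bound 4 (1 - 1/(N + 1)). *)
Lemma sum_inv1sqr (N : nat) : \sum_(0 <= j < N) (1 + (j%:R : R) ^+ 2)^-1 <= 4.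
Proof.
suff : \sum_(0 <= j < N) (1 + (j%:R : R) ^+ 2)^-1 <= 4 * (1 - (N.+1%:R)^-1).
  by move/le_trans; apply; rewrite mulrBr mulr1 gerBl mulr_ge0 ?invr_ge0 ?ler0n.
elim: N => [|N IH]; first by rewrite big_geq // invr1 subrr mulr0.
rewrite big_nat_recr //=; apply: le_trans (lerD IH (lexx _)) _.
have N0 : 0 <= N%:R :> R by rewrite ler0n.
have -> : N.+2%:R = N%:R + 2 :> R by rewrite -addn2 natrD.
have -> : N.+1%:R = N%:R + 1 :> R by rewrite -addn1 natrD.
move: (N%:R : R) N0 => x x0.
rewrite -subr_ge0.
have -> : 4 * (1 - (x + 2)^-1) - (4 * (1 - (x + 1)^-1) + (1 + x ^+ 2)^-1) =
   (3 * x ^+ 2 - 3 * x + 2) / ((x + 1) * (x + 2) * (1 + x ^+ 2)).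
  field.
  by rewrite !gt_eqF ?onepsqr_gt0 //; lra.
apply: divr_ge0; first nra.
by rewrite !mulr_ge0 //; [lra|lra|rewrite ltW ?onepsqr_gt0].
Qed.

Lemma cvg_real_series (a : nat -> R) C :
  (forall j, `|a j| <= C / (1 + j%:R ^+ 2)) ->
  cvgn (fun N => \sum_(0 <= j < N) a j).
Proof.
move=> aC; apply: normed_cvg.
apply: nondecreasing_is_cvgn.
  apply: nondecreasing_series => n _ _; exact: normr_ge0.
exists (C * 4) => _ [N _ <-]; rewrite /series /=.
apply: le_trans (ler_sum_nat (fun j _ => aC j)) _.
rewrite -mulr_sumr; apply: ler_wpM2l (sum_inv1sqr N).
by have := le_trans (normr_ge0 _) (aC 0%N); rewrite expr0n addr0 divr1.
Qed.

Lemma csum_dec (u : nat -> R[i]) C : (forall j, normc (u j) <= C / (1 + j%:R ^+ 2)) ->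
  ccvg \oo (fun N => \sum_(0 <= j < N) u j) (csum u) /\ normc (csum u) <= 4 * C.
Proof.
move=> uC.
have cr := cvg_real_series (fun j => le_trans (Re_le_normc (u j)) (uC j)).
have ci := cvg_real_series (fun j => le_trans (Im_le_normc (u j)) (uC j)).
have H : ccvg \oo (fun N => \sum_(0 <= j < N) u j)
    (limn (fun N => \sum_(0 <= j < N) Re (u j)) +i*
     limn (fun N => \sum_(0 <= j < N) Im (u j))).
  split; [under eq_fun do rewrite re_sum; exact: cr|].
  under eq_fun do rewrite im_sum; exact: ci.
rewrite (csum_eq H); split=> //.
pose proof (ccvg_normc H) as Hn.
rewrite -(cvg_lim (@Rhausdorff R) Hn); apply: limr_le; first by apply: cvgP Hn.
apply: nearW => N; apply: le_trans (normc_sum _ _ _) _.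
apply: le_trans (ler_sum_nat (fun j _ => uC j)) _.
rewrite -mulr_sumr mulrC; apply: ler_wpM2r (sum_inv1sqr N).
by have := le_trans (normc_ge0 _) (uC 0%N); rewrite expr0n addr0 divr1.
Qed.

Lemma dec_ge0 C u : dec C u -> 0 <= C.
Proof.
move=> /(_ 0); rewrite expr0n addr0 divr1; apply: le_trans; exact: normc_ge0.
Qed.

Lemma zsum_dec C u : dec C u ->
  ccvg \oo (bsum u) (zsum u) /\ normc (zsum u) <= 8 * C.
Proof.
move=> uC; have C0 := dec_ge0 uC.
have [cp np] : ccvg \oo (fun N => \sum_(0 <= j < N) u (Posz j)) (csum (fun j => u (Posz j))) /\
    normc (csum (fun j => u (Posz j))) <= 4 * C.
  by apply: csum_dec => j; exact: uC.
have [cn nn] : ccvg \oo (fun N => \sum_(0 <= j < N) u (Negz j)) (csum (fun j => u (Negz j))) /\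
    normc (csum (fun j => u (Negz j))) <= 4 * C.
  apply: csum_dec => j; apply: le_trans (uC _) _.
  apply: ler_wpM2l C0 _ _ _; rewrite lef_pV2 ?posrE ?onepsqr_gt0 // lerD2l.
  rewrite NegzE mulrNz sqrrN ler_pXn2r ?nnegrE ?ler0n //.
  by rewrite -[_.+1%:~R]/(_.+1%:R) ler_nat.
split.
  rewrite /zsum /bsum; under eq_fun do rewrite big_split /=.
  exact: ccvgD.
rewrite /zsum; apply: le_trans (ler_normcD _ _) _; lra.
Qed.

Lemma zsum_unique C u l : dec C u -> ccvg \oo (bsum u) l -> zsum u = l.
Proof. by move=> /zsum_dec[H _]; exact: ccvg_unique. Qed.

Definition fast u := exists C, dec C u.

Lemma fast_cvg u : fast u -> ccvg \oo (bsum u) (zsum u).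
Proof. by move=> [C /zsum_dec[]]. Qed.

Lemma fastD u v : fast u -> fast v -> fast (fun t => u t + v t).
Proof.
move=> [C uC] [D vD]; exists (C + D) => t.
by apply: le_trans (ler_normcD _ _) _; rewrite mulrDl lerD.
Qed.

Lemma fastZ c u : fast u -> fast (fun t => c * u t).
Proof.
move=> [C uC]; exists (normc c * C) => t.
by rewrite normcM -mulrA ler_wpM2l ?normc_ge0.
Qed.

Lemma fast0 : fast (fun=> 0).
Proof. by exists 0 => t; rewrite normc0 mul0r. Qed.

Lemma fast_sum I (s : seq I) (F : I -> int -> R[i]) :
  (forall i, fast (F i)) -> fast (fun t => \sum_(i <- s) F i t).
Proof.
move=> fF; elim: s => [|i s IH].
  by under eq_fun do rewrite big_nil; exact: fast0.
by under eq_fun do rewrite big_cons; exact: fastD.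
Qed.

Lemma fast_le u v : fast v -> (forall t, normc (u t) <= normc (v t)) -> fast u.
Proof. by move=> [C vC] uv; exists C => t; exact: le_trans (uv t) (vC t). Qed.

Lemma zsumD u v : fast u -> fast v -> zsum (fun t => u t + v t) = zsum u + zsum v.
Proof.
move=> fu fv; have [C uvC] := fastD fu fv; apply: (zsum_unique uvC).
rewrite (_ : bsum _ = fun N => bsum u N + bsum v N).
  by apply: ccvgD; exact: fast_cvg.
apply/funext => N; rewrite /bsum -big_split /=; apply: eq_bigr => j _; ring.
Qed.

Lemma zsumZ c u : fast u -> zsum (fun t => c * u t) = c * zsum u.
Proof.
move=> fu; have [C cuC] := fastZ c fu; apply: (zsum_unique cuC).
rewrite (_ : bsum _ = fun N => c * bsum u N).
  by apply: ccvgM; [exact: ccvg_cst|exact: fast_cvg].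
apply/funext => N; rewrite /bsum mulr_sumr; apply: eq_bigr => j _; ring.
Qed.

Lemma zsum0 : zsum (fun=> 0 : R[i]) = 0.
Proof.
have [C d0] := fast0; apply: (zsum_unique d0).
rewrite (_ : bsum _ = fun=> 0); first exact: ccvg_cst.
by apply/funext => N; rewrite /bsum big1 // => j _; rewrite addr0.
Qed.

Lemma zsum_sum I (s : seq I) (F : I -> int -> R[i]) : (forall i, fast (F i)) ->
  zsum (fun t => \sum_(i <- s) F i t) = \sum_(i <- s) zsum (F i).
Proof.
move=> fF; elim: s => [|i s IH].
  by under eq_fun do rewrite big_nil; rewrite big_nil zsum0.
by under eq_fun do rewrite big_cons; rewrite big_cons zsumD ?IH //; exact: fast_sum.
Qed.

Lemma fast_cvg0 u : fast u -> ccvg \oo (fun N : nat => u N) 0 /\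
  ccvg \oo (fun N : nat => u (- N%:Z)) 0.
Proof.
move=> [C uC].
have H : C * (1 + (N%:R : R) ^+ 2)^-1 @[N --> \oo] --> (0 : R).
  rewrite -[X in _ --> X](mulr0 C); apply: cvgM; first exact: cvg_cst.
  apply/gtr0_cvgV0; first by apply: nearW => n; exact: onepsqr_gt0.
  apply/cvgryPge => A; have := @cvgr_idn R; move/cvgryPge => /(_ `|A|).
  apply: filterS => n nA; apply: le_trans (ler_norm _) _; apply: le_trans nA _.
  by move: (n%:R : R) => x; nra.
split; apply: (ccvg_norm _ H); apply: nearW => N; rewrite subr0.
- exact: uC.
- by apply: le_trans (uC _) _; rewrite mulrNz sqrrN.
Qed.

Lemma bsumS u N : bsum u N.+1 = bsum u N + (u (Posz N) + u (Negz N)).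
Proof. by rewrite /bsum big_nat_recr. Qed.

(** Moving the window by one changes only two boundary terms, which vanish in the limit. *)
Lemma bsum_succ u N :
  bsum (fun t => u (t + 1)) N = bsum u N + u N - u (- N%:Z).
Proof.
elim: N => [|N IH]; first by rewrite /bsum !big_geq // add0r oppr0 subrr.
rewrite !bsumS IH.
have -> : Posz N + 1 = N.+1%:Z by lia.
have -> : Negz N + 1 = - N%:Z by rewrite NegzE; lia.
have -> : - N.+1%:Z = Negz N by rewrite NegzE.
move: (bsum u N) (u N%:Z) (u (- N%:Z)) (u N.+1%:Z) (u (Negz N)) => a b c d e.
ring.
Qed.

Lemma fast_add (m : int) u : fast u -> fast (fun t => u (t + m)).
Proof.
move=> [C uC]; have C0 := dec_ge0 uC.
exists (2 * (1 + m%:~R ^+ 2) * C) => t; apply: le_trans (uC _) _.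
rewrite [_ * C]mulrC -[leRHS]mulrA ler_wpM2l //.
rewrite ler_pdivlMr ?onepsqr_gt0 // mulrC ler_pdivrMr ?onepsqr_gt0 //.
rewrite intrD; move: (m%:~R : R) (t%:~R : R) => x y.
rewrite -subr_ge0.
have -> : 2 * (1 + x ^+ 2) * (1 + (y + x) ^+ 2) - (1 + y ^+ 2) =
  1 + (y + 2 * x) ^+ 2 + 2 * (x * (y + x)) ^+ 2 by ring.
by apply: addr_ge0; [apply: addr_ge0|apply: mulr_ge0]; rewrite ?sqr_ge0.
Qed.

Lemma zsum_succ u : fast u -> zsum (fun t => u (t + 1)) = zsum u.
Proof.
move=> fu; have [C uC] := fast_add 1 fu; apply: (zsum_unique uC).
rewrite (_ : bsum _ = fun N : nat => bsum u N + u N - u (- N%:Z)).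
  have [H1 H2] := fast_cvg0 fu.
  rewrite (_ : zsum u = zsum u + 0 - 0); last by rewrite subr0 addr0.
  by apply: ccvgD; [apply: ccvgD => //; exact: fast_cvg|exact: ccvgN].
by apply/funext => N; exact: bsum_succ.
Qed.

Lemma zsum_add (m : int) u : fast u -> zsum (fun t => u (t + m)) = zsum u.
Proof.
have nat_case (k : nat) v : fast v -> zsum (fun t => v (t + k%:Z)) = zsum v.
  elim: k v => [|k IH] v fv.
    by congr zsum; apply/funext => t; rewrite addr0.
  rewrite -(IH _ fv) -[RHS]zsum_succ; last exact: fast_add.
  by congr zsum; apply/funext => t; congr v; lia.
move=> fu; case: m => k; first exact: nat_case.
rewrite -[LHS](nat_case k.+1); last exact: fast_add.
by congr zsum; apply/funext => t; congr u; rewrite NegzE; lia.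
Qed.

Lemma fast_opp u : fast u -> fast (fun t => u (- t)).
Proof.
by move=> [C uC]; exists C => t; apply: le_trans (uC _) _; rewrite mulrNz sqrrN.
Qed.

(** Composed with the translation by one, reflection exchanges the two half-sums over [Posz] and
    [Negz] exactly. *)
Lemma zsum_opp u : fast u -> zsum (fun t => u (- t)) = zsum u.
Proof.
move=> fu; rewrite -(zsum_add 1 (fast_opp fu)).
rewrite /zsum addrC; congr (csum _ + csum _); apply/funext => j; congr u.
- by rewrite NegzE; lia.
- by rewrite NegzE; lia.
Qed.

Lemma zsum_posz u : (forall j, u (Negz j) = 0) -> zsum u = csum (fun j => u (Posz j)).
Proof.
move=> u0; rewrite /zsum [X in _ + X](_ : _ = 0) ?addr0 //.
apply: csum_eq; under eq_fun do rewrite big1 //; exact: ccvg_cst.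
Qed.

Lemma fast_residue (q : nat) (nu : nat) u : (0 < q)%N -> fast u ->
  fast (fun t => u (nu%:Z + q%:Z * t)).
Proof.
move=> q0 /(fast_add nu)[C uC]; have C0 := dec_ge0 uC.
exists C => t; rewrite addrC; apply: le_trans (uC _) _.
apply: ler_wpM2l C0 _ _ _; rewrite lef_pV2 ?posrE ?onepsqr_gt0 // lerD2l.
rewrite intrM exprMn ler_peMl ?sqr_ge0 // expr_ge1 ?ler0n //.
by rewrite -[q%:~R]/(q%:R) ler1n.
Qed.

(** The N-th partial sums over the q classes together run over exactly the integers from -qN to qN -
    1. *)
Lemma zsum_residue (q : nat) u : (0 < q)%N -> fast u ->
  zsum u = \sum_(nu < q) zsum (fun t => u (nu%:Z + q%:Z * t)).
Proof.
move=> q0 fu; have [C uC] := fu; apply: (zsum_unique uC).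
have H : ccvg \oo (fun N => \sum_(nu < q) bsum (fun t => u (nu%:Z + q%:Z * t)) N)
    (\sum_(nu < q) zsum (fun t => u (nu%:Z + q%:Z * t))).
  by apply: ccvg_sum => nu _; apply: fast_cvg; exact: fast_residue.
have E N : \sum_(nu < q) bsum (fun t => u (nu%:Z + q%:Z * t)) N = bsum u (q * N).
  elim: N => [|N IH].
    by rewrite muln0 /bsum big_geq // big1 // => nu _; rewrite big_geq.
  have -> : bsum u (q * N.+1) = bsum u (q * N) +
      \sum_(q * N <= j < q * N + q) (u (Posz j) + u (Negz j)).
    by rewrite mulnS addnC /bsum (@big_cat_nat _ _ _ (q * N)) ?leq_addr.
  rewrite -IH.
  under eq_bigr do rewrite bsumS.
  rewrite big_split /=; congr (_ + _).
  rewrite -{1}[(q * N)%N]add0n big_addn addKn big_mkord !big_split /=.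
  (* On the negative side the residues occur in reverse order. *)
  congr (_ + _); rewrite [RHS](reindex_inj rev_ord_inj) /=; apply: eq_bigr => i _; congr u.
  have -> : q%:Z * Negz N = - (q%:Z + (q * N)%N%:Z).
    by rewrite NegzE mulrN -addn1 PoszD mulrDr mulr1 -PoszM addrC.
  by have := ltn_ord i; move: (q * N)%N => r; rewrite NegzE; lia.
have {}H : ccvg \oo (fun N => bsum u (q * N)) (\sum_(nu < q) zsum (fun t => u (nu%:Z + q%:Z * t))).
  by case: H => Hr Hi; split; [move: Hr|move: Hi]; under eq_fun do rewrite E.
rewrite (_ : \sum_(nu < q) _ = zsum u); first exact: fast_cvg.
apply: ccvg_unique H _.
have qN : (q * N)%N @[N --> \oo] --> \oo.
  move=> A [n _ nA]; exists n => // m /= nm; apply: nA => /=.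
  by apply: leq_trans nm _; rewrite leq_pmull.
by have [Hr Hi] := fast_cvg fu; split; [exact: (cvg_comp _ _ qN Hr)|exact: (cvg_comp _ _ qN Hi)].
Qed.
End IntegerSums.

(** * Dirichlet and Fejér kernels *)

Section Fejer.
Context {R : realType}.
Implicit Types x y u : R.
Local Notation mu := (@lebesgue_measure R).

Lemma rintegrable_inv1sqr : rintegrable setT (fun x : R => (1 + x ^+ 2)^-1).
Proof.
have pos x : 0 <= (1 + x ^+ 2)^-1 by rewrite invr_ge0 ltW // onepsqr_gt0.
have cf : continuous (fun x : R => (1 + x ^+ 2)^-1) by exact: continuous_oneDsqrV.
apply/integrableP; split.
  by apply/measurable_EFinP; exact: continuous_measurable_fun.
under eq_integral do rewrite gee0_abs ?lee_fin //.
rewrite ge0_symfun_integralT //; last by move=> x /=; rewrite sqrrN.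
rewrite (_ : [set x | _] = `[0, +oo[%classic); last first.
  by apply/seteqP; split=> x /=; rewrite in_itv /= andbT.
have -> := @integral0y_oneDsqr R.
by rewrite -EFinM ltry.
Qed.

(** With y = x/2, sin x = 2 sin y cos y and sin y = y cos c for some c < y; both cosines are at
    least 1/sqrt 2. *)
Lemma half_le_sin x : 0 <= x <= pi / 2 -> x / 2 <= sin x.
Proof.
move=> /andP[x0 xpi]; have p0 := pi_gt0 R.
have cos_half y : 0 <= y <= pi / 4 -> 1 <= 2 * cos y ^+ 2.
  move=> /andP[y0 ypi]; have : 0 <= cos (y *+ 2).
    by apply: cos_ge0_pihalf; rewrite (mulr2n y); apply/andP; split; lra.
  by rewrite cos_mulr2n (mulr2n (_ ^+ 2)); lra.
move: x0; rewrite le_eqVlt => /orP[/eqP <-|x0]; first by rewrite mul0r sin0.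
pose y := x / 2.
have y0 : 0 < y by rewrite divr_gt0.
have ypi : y <= pi / 4 by rewrite /y; lra.
have cs : {within `[0, y], continuous (@sin R)}.
  by apply: continuous_subspaceT => ?; exact: continuous_sin.
have [c c0y] := @MVT _ (@sin R) (@cos R) 0 y y0 (fun x _ => is_derive_sin x) cs.
have /andP[c0 cy] : 0 < c < y by move: c0y; rewrite in_itv.
rewrite sin0 !subr0 => siny.
have cc : 1 <= 2 * cos c ^+ 2 by apply: cos_half; apply/andP; split; lra.
have cY : 1 <= 2 * cos y ^+ 2 by apply: cos_half; apply/andP; split; lra.
have c1 : 0 <= cos c by apply: cos_ge0_pihalf; apply/andP; split; lra.
have c2 : 0 <= cos y by apply: cos_ge0_pihalf; apply/andP; split; lra.
have H : 1 <= 2 * (cos c * cos y).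
  by move: (cos c) (cos y) cc cY c1 c2 => C1 C2 cc cY c1 c2; case: (lerP C1 C2) => ?; nra.
have -> : x = y *+ 2 by rewrite (mulr2n y) /y; field.
rewrite sin_mulr2n siny (mulr2n (_ * _)).
rewrite (_ : y *+ 2 / 2 = y); last by rewrite (mulr2n y); field.
by move: (cos y) (cos c) H => C1 C2 H; nra.
Qed.

Lemma abs_le_sinpi u : `|u| <= 2^-1 -> `|u| <= `|sin (pi * u)|.
Proof.
have p2 := pi_ge2 R.
wlog u0 : u / 0 <= u => [hw|].
  case: (lerP 0 u) => [|u0]; first exact: hw.
  by rewrite -normrN => /hw; rewrite mulrN sinN !normrN; apply; rewrite oppr_ge0 ltW.
rewrite (ger0_norm u0) => u1; apply: le_trans (ler_norm _).
apply: le_trans (half_le_sin _ ); first by nra.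
by rewrite mulr_ge0 ?pi_ge0 //=; nra.
Qed.

Fixpoint dirichlet (j : nat) x : R :=
  if j is i.+1 then dirichlet i x + 2 * cos (2 * pi * i.+1%:R * x) else 1.

(** Unnormalised: the sum of the Dirichlet kernels of orders 0 to N. The usual Fejér kernel is this
    divided by N + 1. *)
Fixpoint fejer (N : nat) x : R :=
  dirichlet N x + (if N is M.+1 then fejer M x else 0).

Lemma dirichletS j x :
  dirichlet j.+1 x = dirichlet j x + 2 * cos (2 * pi * j.+1%:R * x).
Proof. by []. Qed.

Lemma fejer0 x : fejer 0 x = 1. Proof. by rewrite /= addr0. Qed.

Lemma fejerS N x : fejer N.+1 x = dirichlet N.+1 x + fejer N x.
Proof. by []. Qed.

Lemma cosD2pin x (n : nat) : cos (x + 2 * pi * n%:R) = cos x.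
Proof.
rewrite (_ : x + _ = x + (pi *+ 2) *+ n).
  by rewrite (periodicn (@cosD2pi R)).
by rewrite -[pi *+ 2 *+ n]mulr_natr -[pi *+ 2]mulr_natl.
Qed.

Lemma cosD2piz x (m : int) : cos (x + 2 * pi * m%:~R) = cos x.
Proof.
case: m => n; first exact: cosD2pin.
by rewrite -[LHS](cosD2pin _ n.+1) NegzE mulrNz mulrN; congr cos; ring.
Qed.

Lemma dirichlet_period j x (m : int) : dirichlet j (x + m%:~R) = dirichlet j x.
Proof.
elim: j => // j IH; rewrite !dirichletS IH; congr (_ + 2 * _).
rewrite mulrDr -[LHS](cosD2piz _ (j.+1%:Z * - m)) intrM mulrNz; congr cos.
rewrite -[j.+1%:~R]/(j.+1%:R); ring.
Qed.

Lemma fejer_period N x (m : int) : fejer N (x + m%:~R) = fejer N x.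
Proof.
by elim: N => [|N IH]; rewrite ?fejer0 // !fejerS IH dirichlet_period.
Qed.

Lemma sin_dirichlet j x :
  sin (pi * x) * dirichlet j x = sin ((2 * j%:R + 1) * (pi * x)).
Proof.
elim: j => [|j IH]; first by rewrite /= mulr1 mulr0 add0r mul1r.
rewrite dirichletS mulrDr IH.
set a := pi * x; set b := 2 * pi * j.+1%:R * x.
have -> : (2 * j%:R + 1) * a = b - a by rewrite /a /b -natr1; ring.
have -> : (2 * j.+1%:R + 1) * a = b + a by rewrite /a /b; ring.
by rewrite sinB sinD; ring.
Qed.

(** Each product sin(pi x) sin((2j + 1) pi x) is a difference of consecutive squares, so the sum
    telescopes. Both kernel estimates below follow from this closed form. *)
Lemma sin_fejer N x : sin (pi * x) ^+ 2 * fejer N x = sin (N.+1%:R * (pi * x)) ^+ 2.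
Proof.
have step j : sin (pi * x) * sin ((2 * j%:R + 1) * (pi * x)) =
    sin (j.+1%:R * (pi * x)) ^+ 2 - sin (j%:R * (pi * x)) ^+ 2.
  set a := pi * x; set b := j%:R * a.
  have -> : (2 * j%:R + 1) * a = (b + a) + b by rewrite /b; ring.
  have -> : j.+1%:R * a = b + a by rewrite /b -natr1; ring.
  have e1 := cos2Dsin2 a.
  rewrite [sin (b + a + b)]sinD cosD sinD.
  move: (sin a) (cos a) (sin b) (cos b) e1 => s c S C e1.
  apply/eqP; rewrite -subr_eq0; apply/eqP.
  transitivity (S ^+ 2 * (1 - (c ^+ 2 + s ^+ 2))); first by ring.
  by rewrite e1 subrr mulr0.
elim: N => [|N IH].
  by rewrite fejer0 mulr1 mul1r.
rewrite fejerS mulrDr IH expr2 -mulrA sin_dirichlet step; ring.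
Qed.

Lemma abs_sinMn (n : nat) y : `|sin (n%:R * y)| <= n%:R * `|sin y|.
Proof.
elim: n => [|n IH]; first by rewrite !mul0r sin0 normr0.
rewrite -natr1 mulrDl mul1r sinD mulrDl mul1r; apply: le_trans (ler_normD _ _) _.
apply: lerD; rewrite normrM.
- by apply: le_trans (ler_wpM2l _ (cos_max _)) _ => //; rewrite mulr1.
- by apply: le_trans (ler_wpM2r _ (cos_max _)) _ => //; rewrite mul1r.
Qed.

(** One factor sin of the closed form is bounded below by |u|, and one factor of the numerator by N
    + 1 times |sin(pi u)|. *)
Lemma fejer_near N u : `|u| <= 2^-1 -> `|u * fejer N u| <= N.+1%:R.
Proof.
move=> u2; have [->|u0] := eqVneq u 0; first by rewrite mul0r normr0 ler0n.
have su := abs_le_sinpi u2.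
have s0 : 0 < `|sin (pi * u)| by apply: lt_le_trans su; rewrite normr_gt0.
rewrite -(ler_pM2r s0) normrM mulrC mulrA.
apply: le_trans (ler_wpM2r (normr_ge0 _) (ler_wpM2l (normr_ge0 _) su)) _.
rewrite -expr2 -normrX -normrM sin_fejer expr2 normrM.
apply: le_trans (ler_wpM2l (normr_ge0 _) (abs_sinMn _ _)) _.
by rewrite ler_piMl ?mulr_ge0 ?ler0n // sin_max.
Qed.

(** The numerator of the closed form is at most 1, and the denominator is at least u^2. *)
Lemma fejer_away N u : `|u| <= 2^-1 -> u != 0 -> `|fejer N u| <= (u ^+ 2)^-1.
Proof.
move=> u2 u0; have su := abs_le_sinpi u2.
have s0 : 0 < u ^+ 2 by rewrite lt_def sqrf_eq0 u0 sqr_ge0.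
rewrite -[leRHS]mul1r ler_pdivlMr //.
apply: le_trans (ler_wpM2l (normr_ge0 _) (_ : u ^+ 2 <= sin (pi * u) ^+ 2)) _.
  by rewrite -(real_normK (num_real u)) -(real_normK (num_real (sin _))) ler_pXn2r.
rewrite -[X in _ * X]ger0_norm ?sqr_ge0 // -normrM mulrC sin_fejer normrX.
by rewrite expr_le1 // sin_max.
Qed.

Lemma continuous_cosM (k : R) : continuous (fun x : R => cos (k * x)).
Proof.
move=> x; apply: (@continuous_comp _ _ _ (fun x => k * x) (@cos R)).
  by apply: cvgM; [exact: cvg_cst|exact: cvg_id].
exact: continuous_cos.
Qed.

Lemma continuous_dirichlet j : continuous (dirichlet j).
Proof.
elim: j => [|j IH] x; first exact: cvg_cst.
apply: cvgD; first exact: IH.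
by apply: cvgM; [exact: cvg_cst|exact: continuous_cosM].
Qed.

Lemma continuous_fejer N : continuous (fejer N).
Proof.
elim: N => [|N IH] x; apply: cvgD.
- exact: cvg_cst.
- exact: cvg_cst.
- exact: (@continuous_dirichlet N.+1).
- exact: IH.
Qed.

Lemma dirichlet_le j x : `|dirichlet j x| <= 2 * j%:R + 1.
Proof.
elim: j => [|j IH]; first by rewrite normr1 mulr0 add0r.
rewrite dirichletS (_ : 2 * j.+1%:R + 1 = 2 * j%:R + 1 + 2); last first.
  by rewrite -[j.+1%:R]natr1; ring.
apply: le_trans (ler_normD _ _) _; apply: lerD IH _; rewrite normrM ger0_norm //.
by rewrite -[leRHS]mulr1 ler_wpM2l // cos_max.
Qed.

Lemma fejer_le N : exists K, forall x, `|fejer N x| <= K.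
Proof.
elim: N => [|N [K IH]].
  by exists 1 => x; rewrite fejer0 normr1.
exists (2 * N.+1%:R + 1 + K) => x; rewrite fejerS; apply: le_trans (ler_normD _ _) _.
by apply: lerD (IH x); exact: (@dirichlet_le N.+1).
Qed.

Lemma integral_cos_period (m : nat) (a : R) :
  \int[mu]_(x in `[a, a + 1]) cos (2 * pi * m.+1%:R * x) = 0.
Proof.
have p0 := pi_neq0 R.
have m0 : m.+1%:R != 0 :> R by rewrite pnatr_eq0.
pose k : R := 2 * pi * m.+1%:R.
have k0 : k != 0 by rewrite /k !mulf_neq0.
have dF x : is_derive x 1 (fun x => k^-1 * sin (k * x)) (cos (k * x)).
  have A := is_derive_mul (is_derive_cst k x 1) (is_derive_id x 1).
  have B := is_derive_mul (is_derive_cst k^-1 x 1) (is_derive1_comp (is_derive_sin _) A).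
  apply: (is_derive_eq B).
  by rewrite /= !mul0r !add0r mulr1 [cos _ * _]mulrC mulKf.
rewrite (continuous_FTC2_R _ dF) ?ltrDl //.
  rewrite mulrDr mulr1 {3}/k (_ : 2 * pi * m.+1%:R = (pi *+ 2) *+ m.+1); last first.
    by rewrite -[pi *+ 2 *+ m.+1]mulr_natr -[pi *+ 2]mulr_natl.
  by rewrite (periodicn (@sinD2pi R)) subrr.
exact: continuous_cosM.
Qed.

Lemma rintegrable_itv (a b : R) (h : R -> R) : continuous h -> rintegrable `[a, b] h.
Proof.
move=> ch; apply: continuous_compact_integrable; first exact: segment_compact.
exact: continuous_subspaceT.
Qed.

Lemma integral_dirichlet_period j (a : R) : \int[mu]_(x in `[a, a + 1]) dirichlet j x = 1.
Proof.
elim: j => [|j IH].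
  rewrite Rintegral_cst // mul1r /= lebesgue_measure_itv /= lte_fin ltrDl ltr01.
  by rewrite -EFinD addrAC subrr add0r.
have cc := @continuous_cosM (2 * pi * j.+1%:R).
rewrite RintegralD //; last 2 first.
- exact: rintegrable_itv (@continuous_dirichlet j).
- by apply: rintegrableZ => //; exact: rintegrable_itv.
rewrite IH RintegralZl //; last exact: rintegrable_itv.
by rewrite integral_cos_period mulr0 addr0.
Qed.

Lemma integral_fejer_period N (a : R) : \int[mu]_(x in `[a, a + 1]) fejer N x = N.+1%:R.
Proof.
elim: N => [|N IH].
  by under eq_Rintegral do rewrite fejer0; exact: (integral_dirichlet_period 0).
rewrite RintegralD //; last 2 first.
- exact: rintegrable_itv (@continuous_dirichlet N.+1).
- exact: rintegrable_itv (@continuous_fejer N).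
by rewrite IH (integral_dirichlet_period N.+1) [RHS]mulrS.
Qed.
End Fejer.

(** * Poisson summation for real functions *)

Section Poisson.
Context {R : realType}.
Local Notation mu := (@lebesgue_measure R).
Variables (g g' : R -> R) (C : R).
Hypothesis dg : forall x : R, is_derive x 1 g (g' x).
Hypothesis gC : forall x, `|g x| <= C / (1 + x ^+ 2).
Hypothesis g'C : forall x, `|g' x| <= C / (1 + x ^+ 2).

Definition rnd (x : R) : int := Num.floor (x + 2^-1).

Let C0 : 0 <= C.
Proof. by have := le_trans (normr_ge0 _) (gC 0); rewrite expr0n addr0 divr1. Qed.

Lemma rnd_itv x : (rnd x)%:~R - 2^-1 <= x < (rnd x)%:~R + 2^-1.
Proof.
have /andP[a b] := floor_itv (x + 2^-1); rewrite -/(rnd x) in a b.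
by move: b; rewrite intrD => b; apply/andP; split; lra.
Qed.

Lemma rnd_near x : `|x - (rnd x)%:~R| <= 2^-1.
Proof. by have /andP[a b] := rnd_itv x; rewrite ler_norml; apply/andP; split; lra. Qed.

Lemma rnd_eq x (t : int) : t%:~R - 2^-1 <= x < t%:~R + 2^-1 -> rnd x = t.
Proof.
by move=> /andP[a b]; apply: floor_def; rewrite intrD; apply/andP; split; lra.
Qed.

Let cg : continuous g.
Proof. by move=> x; apply/differentiable_continuous/derivable1_diffP; exact: ex_derive. Qed.

Let inv1sqr_near x y : `|x - y| <= 2^-1 -> (1 + y ^+ 2)^-1 <= 2 * (1 + x ^+ 2)^-1 :> R.
Proof.
rewrite ler_norml => /andP[a b].
rewrite ler_pdivlMr ?onepsqr_gt0 // mulrC ler_pdivrMr ?onepsqr_gt0 //.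
rewrite -subr_ge0.
have -> : 2 * (1 + y ^+ 2) - (1 + x ^+ 2) = (2 * y - x) ^+ 2 + (1 - 2 * (x - y) ^+ 2).
  by ring.
apply: addr_ge0; first exact: sqr_ge0.
by move: (x - y) a b => e a b; nra.
Qed.

(** Constant on each unit interval centred at an integer, so its integral against a 1-periodic
    kernel is a sum over the integers. *)
Let step x := g (rnd x)%:~R.

Let step_le x : `|step x| <= 2 * C / (1 + x ^+ 2).
Proof.
apply: le_trans (gC _) _; rewrite [2 * C]mulrC -mulrA ler_wpM2l //.
by apply: inv1sqr_near; exact: rnd_near.
Qed.

Let mrnd : measurable_fun setT (fun x => (rnd x)%:~R : R).
Proof.
apply: nondecreasing_measurable => // x y xy.
by rewrite ler_int; apply: le_floor; rewrite lerD2r.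
Qed.

Let mstep : measurable_fun setT step.
Proof.
by apply: (measurableT_comp _ mrnd); exact: continuous_measurable_fun.
Qed.

Let d x := g x - step x.

(** Mean value theorem between x and the nearest integer; the factor |x - [rnd x]| is what
    compensates the peak of the kernel. *)
Let d_le x : `|d x| <= 2 * C * `|x - (rnd x)%:~R| / (1 + x ^+ 2).
Proof.
rewrite /d /step; set k := (rnd x)%:~R.
have xk : `|x - k| <= 2^-1 := rnd_near x.
have key (a b : R) : a < b -> `|b - a| <= 2^-1 -> forall z, a <= z <= b ->
    `|g b - g a| <= 2 * C * `|b - a| / (1 + z ^+ 2).
  move=> ab ab2 z /andP[az zb].
  have cg' : {within `[a, b], continuous g} by exact: continuous_subspaceT.
  have [c cab ->] := @MVT _ g g' a b ab (fun x _ => dg x) cg'.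
  have /andP[ac cb] : a < c < b by move: cab; rewrite in_itv.
  rewrite normrM mulrAC ler_wpM2r //.
  apply: le_trans (g'C _) _; rewrite [2 * C]mulrC -mulrA ler_wpM2l //.
  apply: inv1sqr_near; move: ab2; rewrite !ler_norml => /andP[_ H].
  by apply/andP; split; lra.
case: (ltgtP k x) => kx.
- by apply: key => //; rewrite (ltW kx) lexx.
- by rewrite distrC [`|x - k|]distrC; apply: key; rewrite // ?(ltW kx) ?lexx // distrC.
- by rewrite -kx !subrr normr0 mulr0 mul0r.
Qed.

Let d_fejer_le N x : `|d x * (N.+1%:R^-1 * fejer N x)| <= 2 * C / (1 + x ^+ 2).
Proof.
have N0 : 0 < N.+1%:R :> R by rewrite ltr0n.
have F := fejer_near N (rnd_near x).
rewrite -(fejer_period N _ (rnd x)) subrK in F.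
rewrite !normrM [`|N.+1%:R^-1|]ger0_norm ?invr_ge0 ?ler0n // in F *.
apply: le_trans (ler_wpM2r _ (d_le x)) _; first by rewrite mulr_ge0 // invr_ge0 ler0n.
set U := `|x - _| in F *; set F0 := `|fejer N x| in F *.
have -> : 2 * C * U / (1 + x ^+ 2) * (N.+1%:R^-1 * F0) =
    2 * C / (1 + x ^+ 2) * (U * F0 / N.+1%:R).
  by field; rewrite !gt_eqF ?onepsqr_gt0.
apply: ler_piMr; first by rewrite divr_ge0 ?mulr_ge0 // ltW // onepsqr_gt0.
by rewrite ler_pdivrMr // mul1r.
Qed.

Let mfejer N : measurable_fun setT (@fejer R N).
Proof. by apply: continuous_measurable_fun; exact: continuous_fejer. Qed.

Let md : measurable_fun setT d.
Proof. by apply: measurable_funB => //; exact: continuous_measurable_fun. Qed.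

Let iC K : rintegrable setT (fun x : R => K / (1 + x ^+ 2)).
Proof. by apply: rintegrableZ => //; exact: rintegrable_inv1sqr. Qed.

(** Dominated convergence: [d_fejer_le] dominates, [fejer_away] makes the normalised kernel tend to
    0 off the integers, and [d] is 0 at the integers. *)
Let d_fejer_cvg0 :
  \int[mu]_x (d x * (N.+1%:R^-1 * fejer N x)) @[N --> \oo] --> (0 : R).
Proof.
have -> : 0 = \int[mu]_(x in setT) (cst 0 x : R) :> R.
  by rewrite /Rintegral integral0_eq.
apply: (proj2 (@dominated_Rintegral R setT
  (fun N x => d x * (N.+1%:R^-1 * fejer N x)) (cst 0)
  (fun x => 2 * C / (1 + x ^+ 2)) measurableT _ _ _ _)) => //.
- move=> N; apply: measurable_funM => //; apply: measurable_funM => //.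
- move=> x _; set u := x - (rnd x)%:~R.
  have [u0|u0] := eqVneq u 0.
    have d0 : d x = 0.
      by apply/eqP; rewrite -normr_le0; apply: le_trans (d_le x) _; rewrite -/u u0 normr0 mulr0 mul0r.
    by under eq_fun do rewrite d0 mul0r; exact: cvg_cst.
  rewrite -[X in _ --> X](mulr0 (d x)); apply: cvgM; first exact: cvg_cst.
  have H : harmonic N * (u ^+ 2)^-1 @[N --> \oo] --> (0 : R).
    by rewrite -[X in _ --> X](mul0r (u ^+ 2)^-1); apply: cvgM; [exact: cvg_harmonic|exact: cvg_cst].
  apply: norm_cvg0; apply: (squeeze_cvgr _ (cvg_cst 0) H).
  apply: nearW => N; rewrite normr_ge0 normrM ger0_norm ?invr_ge0 ?ler0n //=.
  apply: ler_wpM2l; first by rewrite invr_ge0 ler0n.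
  rewrite -[x](subrK (rnd x)%:~R) -/u fejer_period.
  by apply: fejer_away => //; exact: rnd_near.
Qed.

Let int_step_unit N (t : int) :
  \int[mu]_(x in `[t%:~R - 2^-1, t%:~R + 2^-1[) (step x * fejer N x) = g t%:~R * N.+1%:R.
Proof.
transitivity (\int[mu]_(x in `[t%:~R - 2^-1, t%:~R + 2^-1[) (g t%:~R * fejer N x)).
  apply: eq_Rintegral => x.
  by rewrite inE /= in_itv /= => xt; rewrite /step (rnd_eq xt).
have E : t%:~R + 2^-1 = t%:~R - 2^-1 + 1 :> R by field.
have i1 : @rintegrable R `[t%:~R - 2^-1, t%:~R + 2^-1]%classic (fejer N).
  exact/rintegrable_itv/continuous_fejer.
have i2 : @rintegrable R `[t%:~R - 2^-1, t%:~R + 2^-1[%classic (fejer N).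
  by apply: integrableS i1 => //; apply: subset_itvl; rewrite bnd_simp.
rewrite RintegralZl // Rintegral_itv_bndo_bndc // E integral_fejer_period //.
Qed.

(** Same window as [bsum], the integers from -n to n - 1; this is why the integrals run over [-n -
    1/2, n - 1/2). *)
Definition rbsum (h : R -> R) (N : nat) : R :=
  \sum_(0 <= j < N) (h j%:R + h (- j.+1%:R)).

Let istep N : rintegrable setT (fun x => step x * fejer N x).
Proof.
have [K FK] := @fejer_le R N; have K0 := le_trans (normr_ge0 _) (FK 0).
apply: (rintegrable_le measurableT _ _ (iC (2 * C * K))).
  by apply: measurable_funM.
move=> x _; rewrite normrM mulrAC; apply: ler_pM => //; exact: step_le.
Qed.

Let int_step_itv N n :
  \int[mu]_(x in `[- n%:R - 2^-1, n%:R - 2^-1[) (step x * fejer N x) =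
  N.+1%:R * rbsum g n.
Proof.
elim: n => [|n IH].
  rewrite oppr0 add0r set_itv_ge ?bnd_simp ?ltxx // Rintegral_set0.
  by rewrite /rbsum big_geq // mulr0.
have n0 : 0 <= n%:R :> R by rewrite ler0n.
have nS : n.+1%:R = n%:R + 1 :> R by rewrite -[n.+1%:R]natr1.
have iS (A : set R) : measurable A -> rintegrable A (fun x => step x * fejer N x).
  by move=> mA; apply: integrableS (istep N).
have -> : `[- n.+1%:R - 2^-1, n.+1%:R - 2^-1[%classic =
   (`[- n.+1%:R - 2^-1, - n%:R - 2^-1[ `|` `[- n%:R - 2^-1, n%:R - 2^-1[) `|`
     `[n%:R - 2^-1, n.+1%:R - 2^-1[ :> set R.
  rewrite -(@itv_bndbnd_setU _ _ _ (BLeft (- n%:R - 2^-1))) ?bnd_simp; [|lra|lra].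
  by rewrite -(@itv_bndbnd_setU _ _ _ (BLeft (n%:R - 2^-1))) ?bnd_simp //; lra.
rewrite Rintegral_setU //; last 3 first.
- exact: measurableU.
- by apply: iS; apply: measurableU => //; apply: measurableU.
- rewrite disj_set2E; apply/eqP/seteqP; split=> x //= [[|]];
    rewrite !in_itv /= => /andP[? ?] /andP[? ?]; lra.
rewrite Rintegral_setU //; last 2 first.
- by apply: iS; exact: measurableU.
- by rewrite disj_set2E; apply/eqP/seteqP; split=> x //= []; rewrite !in_itv /= => /andP[? ?] /andP[? ?]; lra.
rewrite IH.
have -> : `[- n.+1%:R - 2^-1, - n%:R - 2^-1[ = `[(- n.+1%:Z)%:~R - 2^-1, (- n.+1%:Z)%:~R + 2^-1[ :> interval R.
  by congr (`[ _, _ [); rewrite mulrNz -[n.+1%:~R]/(n.+1%:R) nS; field.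
have -> : `[n%:R - 2^-1, n.+1%:R - 2^-1[ = `[n%:Z%:~R - 2^-1, n%:Z%:~R + 2^-1[ :> interval R.
  by congr (`[ _, _ [); rewrite -[n%:~R]/(n%:R) nS; field.
rewrite !int_step_unit /rbsum big_nat_recr //= mulrNz -[n.+1%:~R]/(n.+1%:R) -[n%:~R]/(n%:R).
ring.
Qed.

(** The sequence does not involve [N], hence neither does its limit; [poisson_real] exploits
    this. *)
Let rbsum_cvg N : rbsum g n @[n --> \oo] --> N.+1%:R^-1 * \int[mu]_x (step x * fejer N x).
Proof.
have N0 : N.+1%:R != 0 :> R by rewrite pnatr_eq0.
pose J n : set R := `[- n%:R - 2^-1, n%:R - 2^-1[%classic.
have mJ n : measurable (J n) by exact: measurable_itv.
have E n : rbsum g n = N.+1%:R^-1 * \int[mu]_x (((fun x => step x * fejer N x) \_ (J n)) x).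
  by rewrite -Rintegral_mkcond int_step_itv mulKf.
under eq_fun do rewrite E.
apply: cvgM; first exact: cvg_cst.
apply: (proj2 (@dominated_Rintegral R setT
  (fun n x => ((fun x => step x * fejer N x) \_ (J n)) x) (fun x => step x * fejer N x)
  (fun x => `|step x * fejer N x|) measurableT _ _ _ _)).
- move=> n; apply/(measurable_restrict _ (mJ n) measurableT).
  by apply: measurable_funTS; exact: measurable_funM.
- move=> x _; apply/cvgrPdist_le => e e0.
  have := @cvgr_idn R; move/cvgryPge => /(_ (`|x| + 1)); apply: filterS => n nx.
  rewrite /patch mem_set; first by rewrite subrr normr0 ltW.
  have x1 := ler_norm x; have x2 := ler_norm (- x); rewrite normrN in x2.
  by rewrite /J /= in_itv /=; apply/andP; split; lra.
- by move=> n x _; rewrite /patch; case: ifP => // _; rewrite normr0.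
- exact: (integrable_abse (istep N)).
Qed.

Let ig j : rintegrable setT (fun x => g x * dirichlet j x).
Proof.
apply: (rintegrable_le measurableT _ _ (iC (C * (2 * j%:R + 1)))).
  by apply: measurable_funM; apply: continuous_measurable_fun => //; exact: continuous_dirichlet.
move=> x _; rewrite normrM mulrAC; apply: ler_pM => //; exact: dirichlet_le.
Qed.

Let igF N : rintegrable setT (fun x => g x * fejer N x).
Proof.
have [K FK] := @fejer_le R N; have K0 := le_trans (normr_ge0 _) (FK 0).
apply: (rintegrable_le measurableT _ _ (iC (C * K))).
  by apply: measurable_funM => //; exact: continuous_measurable_fun.
by move=> x _; rewrite normrM mulrAC; apply: ler_pM.
Qed.

Let int_g_fejer N : \int[mu]_x (g x * fejer N x) =
  series (fun j => \int[mu]_x (g x * dirichlet j x)) N.+1.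
Proof.
rewrite /series /=; elim: N => [|N IH].
  by rewrite big_nat1; apply: eq_Rintegral => x _; rewrite fejer0.
rewrite big_nat_recr //= -IH -RintegralD //; [|exact: igF|exact: (ig N.+1)].
by apply: eq_Rintegral => x _; rewrite [RHS]addrC -mulrDr.
Qed.

(** The integrals of g against the normalised Fejér kernel are Cesàro means of the Dirichlet
    integrals, so they tend to [S]. With g = [step] + [d], the [step] part equals the sum over the
    integers for every N and the [d] part tends to 0. *)
Theorem poisson_real (S : R) :
  (\int[mu]_x (g x * dirichlet j x)) @[j --> \oo] --> S ->
  rbsum g n @[n --> \oo] --> S.
Proof.
move=> /cesaro HS.
have {}HS : N.+1%:R^-1 * \int[mu]_x (g x * fejer N x) @[N --> \oo] --> S.
  by move: HS; rewrite /arithmetic_mean; under eq_fun do rewrite -int_g_fejer.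
have E N : N.+1%:R^-1 * \int[mu]_x (g x * fejer N x) =
    N.+1%:R^-1 * \int[mu]_x (step x * fejer N x) +
    \int[mu]_x (d x * (N.+1%:R^-1 * fejer N x)).
  have id_ : rintegrable setT (fun x => d x * fejer N x).
    rewrite /d; apply: eq_integrable (integrableB _ (igF N) (istep N)) => // x _.
    by rewrite mulrBl EFinB.
  have -> : \int[mu]_x (d x * (N.+1%:R^-1 * fejer N x)) =
      \int[mu]_x (N.+1%:R^-1 * (d x * fejer N x)).
    by apply: eq_Rintegral => x _; rewrite mulrCA.
  rewrite RintegralZl // -mulrDr -RintegralD //; last exact: istep.
  congr (_ * _).
  by apply: eq_Rintegral => x _; rewrite /d; ring.
have G N : N.+1%:R^-1 * \int[mu]_x (step x * fejer N x) =
    1%:R^-1 * \int[mu]_x (step x * fejer 0 x).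
  have A := @rbsum_cvg N; have B := @rbsum_cvg 0%N.
  exact: (cvg_unique (@Rhausdorff R) A B).
set L := 1%:R^-1 * _ in G.
have HL : N.+1%:R^-1 * \int[mu]_x (g x * fejer N x) @[N --> \oo] --> L.
  have H : L + \int[mu]_x (d x * (N.+1%:R^-1 * fejer N x)) @[N --> \oo] --> L + 0.
    by apply: cvgD; [exact: cvg_cst|exact: d_fejer_cvg0].
  by rewrite addr0 in H; under eq_fun do rewrite E G.
rewrite (cvg_unique (@Rhausdorff R) HS HL); exact: rbsum_cvg.
Qed.
End Poisson.

(** * Gaussian decay estimates *)

Section GaussBounds.
Context {R : realType}.
Implicit Types (x y k : R).

Lemma pow_le_expR (n : nat) k y : 0 < k -> 0 <= y ->
  y ^+ n <= n`!%:R / k ^+ n * expR (k * y).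
Proof.
move=> k0 y0; have ky : 0 <= k * y by rewrite mulr_ge0 // ltW.
have H : (k * y) ^+ n <= n`!%:R * expR (k * y).
  case: n => [|n]; first by rewrite expr0 fact0 mul1r -expR0 ler_expR.
  rewrite [leRHS]mulrC -ler_pdivrMr ?ltr0n ?fact_gt0 //.
  by apply: le_trans (expR_ge1Dxn n ky); rewrite ler_wpDl.
rewrite mulrAC ler_pdivlMr ?exprn_gt0 //.
by rewrite mulrC -exprMn.
Qed.

(** Everything is measured by y = 1 + x^2, and y^(j+1) is absorbed by exp(k y). *)
Lemma poly_gauss_le (j : nat) k : 0 < k -> exists C, forall x,
  (1 + `|x|) ^+ j * expR (- k * x ^+ 2) <= C / (1 + x ^+ 2).
Proof.
move=> k0; exists (2 ^+ j * (j.+1`!%:R / k ^+ j.+1 * expR k)) => x.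
have x1 := onepsqr_gt0 x.
rewrite ler_pdivlMr //.
have A : 1 + `|x| <= 2 * (1 + x ^+ 2).
  rewrite -(real_normK (num_real x)); have := normr_ge0 x; move: `|x| => u u0; nra.
have B : (1 + `|x|) ^+ j <= 2 ^+ j * (1 + x ^+ 2) ^+ j.
  by rewrite -exprMn; apply: lerXn2r A; rewrite nnegrE ?addr_ge0 // mulr_ge0 // ltW.
have D := @pow_le_expR j.+1 k (1 + x ^+ 2) k0 (ltW x1).
have E : expR (- k * x ^+ 2) = expR k * (expR (k * (1 + x ^+ 2)))^-1.
  by rewrite -expRN -expRD; congr expR; ring.
have e0 := expR_gt0 (k * (1 + x ^+ 2)).
have G : (1 + `|x|) ^+ j * (1 + x ^+ 2) <=
    2 ^+ j * (j.+1`!%:R / k ^+ j.+1 * expR (k * (1 + x ^+ 2))).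
  apply: le_trans (ler_wpM2r (ltW x1) B) _.
  by rewrite -[leLHS]mulrA -exprSr ler_wpM2l ?exprn_ge0.
have Q0 : 0 <= expR k / expR (k * (1 + x ^+ 2)) by rewrite divr_ge0 ?expR_ge0.
rewrite E mulrAC; apply: le_trans (ler_wpM2r Q0 G) _.
rewrite le_eqVlt; apply/orP; left; apply/eqP.
by rewrite -!mulrA [expR (k * _) * _]mulrC divfK // gt_eqF.
Qed.

(** Converts decay in the lattice point x into decay in its index t. *)
Lemma onepsqr_affine (M m : R) : 0 < M -> exists2 K, 0 <= K & forall t x,
  x = M * t + m -> (1 + x ^+ 2)^-1 <= K / (1 + t ^+ 2).
Proof.
move=> M0; exists (1 + 2 * (1 + m ^+ 2) / M ^+ 2).
  by rewrite addr_ge0 // divr_ge0 ?sqr_ge0 // mulr_ge0 // ltW ?onepsqr_gt0.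
move=> t x E; rewrite ler_pdivlMr ?onepsqr_gt0 // mulrC ler_pdivrMr ?onepsqr_gt0 //.
have -> : t ^+ 2 = (x - m) ^+ 2 / M ^+ 2 by rewrite E addrK; field; rewrite gt_eqF.
have A : (x - m) ^+ 2 <= 2 * (1 + m ^+ 2) * (1 + x ^+ 2).
  rewrite -subr_ge0.
  have -> : 2 * (1 + m ^+ 2) * (1 + x ^+ 2) - (x - m) ^+ 2 =
    2 + (x + m) ^+ 2 + 2 * (x * m) ^+ 2 by ring.
  by apply: addr_ge0; [apply: addr_ge0|apply: mulr_ge0]; rewrite ?sqr_ge0.
rewrite mulrDl mul1r; apply: lerD; first by rewrite lerDl sqr_ge0.
by rewrite [leRHS]mulrAC ler_wpM2r // invr_ge0 sqr_ge0.
Qed.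
End GaussBounds.

(** * The principal square root *)

Section SqrtC.
Context {R : realType}.
Implicit Types (z w : R[i]).

Lemma Re_sqrtc_ge0 z : 0 <= Re (sqrtc z).
Proof. by case: z => a b; rewrite /= sqrtr_ge0. Qed.

Lemma Re_sqr z : Re (z ^+ 2) = Re z ^+ 2 - Im z ^+ 2.
Proof. by rewrite !expr2 reM. Qed.

Lemma sqrtc_pos z : 0 < Re z -> `|Im (sqrtc z)| < Re (sqrtc z).
Proof.
move=> z0; have := z0; rewrite -{1}(sqr_sqrtc z) Re_sqr subr_gt0 => H.
rewrite -(@ltr_pXn2r _ 2) ?nnegrE ?Re_sqrtc_ge0 ?normr_ge0 //.
by rewrite real_normK ?num_real.
Qed.

(* A square root with positive real part is the principal one. *)
Lemma sqrtc_unique z w : w ^+ 2 = z -> 0 < Re w -> sqrtc z = w.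
Proof.
move=> wz w0; have : (sqrtc z) ^+ 2 == w ^+ 2 by rewrite sqr_sqrtc wz.
rewrite eqf_sqr => /orP[/eqP //|/eqP E].
by have := Re_sqrtc_ge0 z; rewrite E reN oppr_ge0 leNgt w0.
Qed.

Lemma normc_sqrtc z : normc (sqrtc z) ^+ 2 = normc z.
Proof. by rewrite -normcX sqr_sqrtc. Qed.
End SqrtC.

(** * Theta terms and their Fourier transforms *)

Section ThetaInversion.
Context {R : realType}.
Variables (M mu : R).
Hypothesis M0 : 0 < M.
Implicit Types (c : R[i]) (t m : R).
Local Notation aff t := (M * t + mu).

(** With c = -i tau the exponential is q^(x^2/2), and Re c > 0 says that tau is in the upper
    half-plane. *)
Definition gterm (j : nat) c (x : R) : R[i] :=
  (x ^+ j)%:C * cexp (- pi%:C * c * (x ^+ 2)%:C).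

Lemma normc_gterm j c (x : R) :
  normc (gterm j c x) = `|x| ^+ j * expR (- (pi * Re c) * x ^+ 2).
Proof.
rewrite /gterm !normcE normrX; congr (_ * expR _).
by rewrite !complexRI; ring.
Qed.

Lemma gterm_le j (k : R) : 0 < k -> exists C, forall c (x : R), k <= Re c ->
  normc (gterm j c x) <= C / (1 + x ^+ 2).
Proof.
move=> k0; have pk : 0 < pi * k by rewrite mulr_gt0 ?pi_gt0.
have [C HC] := poly_gauss_le j pk; exists C => c x kc.
apply: le_trans (HC x); rewrite normc_gterm; apply: ler_pM; rewrite ?exprn_ge0 ?expR_ge0 //.
  by apply: lerXn2r; rewrite ?nnegrE ?addr_ge0 // lerDr.
by rewrite ler_expR ler_wpM2r ?sqr_ge0 // lerN2 ler_wpM2l ?pi_ge0.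
Qed.

(** Integrand of the Fourier transform with respect to the lattice index t, at frequency m. *)
Definition gwave (j : nat) c m t : R[i] := gterm j c (aff t) * cexp (- (2 * pi * m * t)%:C * 'i).

Lemma normc_gwave j c m t : normc (gwave j c m t) = normc (gterm j c (aff t)).
Proof.
rewrite /gwave normcM normc_cexp (_ : Re _ = 0) ?expR0 ?mulr1 //.
by rewrite !complexRI ?mulr0 ?oppr0 ?mul0r ?subr0.
Qed.

Lemma gwave_le j c : 0 < Re c -> exists C, forall m t, normc (gwave j c m t) <= C / (1 + t ^+ 2).
Proof.
move=> c0; have [C HC] := gterm_le j c0; have [K K0 HK] := onepsqr_affine mu M0.
have C0 : 0 <= C.
  by have := le_trans (normc_ge0 _) (HC c 0 (lexx _)); rewrite expr0n addr0 divr1.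
exists (C * K) => m t; rewrite normc_gwave; apply: le_trans (HC c _ (lexx _)) _.
by rewrite -mulrA ler_wpM2l //; exact: HK.
Qed.

Lemma cder_affine t : cder (fun t => (aff t)%:C) t M%:C.
Proof.
apply: cder_real.
have A := is_derive_mul (is_derive_cst M t 1) (is_derive_id t 1).
apply: (is_derive_eq (is_deriveD A (is_derive_cst mu t 1))).
by rewrite /= mul0r add0r mulr1 addr0.
Qed.

Lemma cderX f (y : R) d n : cder f y d ->
  cder (fun t => f t ^+ n : R[i]) y (n%:R * f y ^+ n.-1 * d).
Proof.
move=> fd; elim: n => [|n IH].
  by apply: cder_eq (cder_cst 1 y) _; rewrite !mul0r.
rewrite (_ : (fun t => _) = fun t => f t * f t ^+ n); last by apply/funext => t; rewrite exprS.
apply: cder_eq (cderM fd IH) _ => /=.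
case: n IH => [|n] _; first by rewrite /= expr0 mul1r !mul0r mulr0 addr0 mulr1 mul1r.
rewrite /= -[n.+2%:R]natr1 [f y ^+ n.+1]exprS; ring.
Qed.

Lemma cder_gwave j c m t : cder (gwave j c m) t
  (j%:R * M%:C * gwave j.-1 c m t - 2 * pi%:C * c * M%:C * gwave j.+1 c m t
   - 2 * pi%:C * 'i * m%:C * gwave j c m t).
Proof.
have dX := cder_affine t.
have A := cderX j dX.
have B := cder_exp (cderZ (- pi%:C * c) (cderX 2 dX)).
have D := cder_exp (cderZ (- (2 * pi * m)%:C * 'i) (cder_id t)).
have := cderM (cderM A B) D.
rewrite (_ : (fun t0 => _) = gwave j c m); last first.
  apply/funext => u; rewrite /gwave /gterm !realcX; congr (_ * _ * cexp _).
  by rewrite !realcE; ring.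
move/cder_eq; apply.
rewrite /gwave /gterm !realcX.
rewrite (_ : - (2 * pi * m)%:C * 'i * t%:C = - (2 * pi * m * t)%:C * 'i); last first.
  by rewrite !realcE; ring.
rewrite [_ ^+ j.+1]exprS !realcE [2.-1]/= expr1.
move: (_ ^+ j) (_ ^+ j.-1) (cexp _) (cexp _) => A1 A2 A3 A4; ring.
Qed.

Lemma gwave_integrable j c m : 0 < Re c -> cintegrable setT (gwave j c m).
Proof.
move=> c0; have [C HC] := gwave_le j c0.
apply: (@cintegrable_le _ _ _ (fun t => C / (1 + t ^+ 2))) => //.
- by apply: cmeas_continuous => // y; exact: cder_cvg (cder_gwave j c m y).
- by apply: rintegrableZ => //; exact: rintegrable_inv1sqr.
Qed.

Lemma cvg_inv1sqr (C : R) (u : nat -> R) : (forall n, `|u n| = n%:R) ->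
  C / (1 + u n ^+ 2) @[n --> \oo] --> (0 : R).
Proof.
move=> un; rewrite -[X in _ --> X](mulr0 C); apply: cvgM; first exact: cvg_cst.
apply/gtr0_cvgV0; first by apply: nearW => n; exact: onepsqr_gt0.
apply/cvgryPge => A; have := @cvgr_idn R; move/cvgryPge => /(_ `|A|).
apply: filterS => n nA; apply: le_trans (ler_norm _) _; apply: le_trans nA _.
by rewrite -un -(real_normK (num_real (u n))); move: `|u n| => x; nra.
Qed.

Lemma setT_exhaust (y : R) : [set: R] y -> \forall n \near \oo,
  `[- n.+1%:R, n.+1%:R]%classic y.
Proof.
move=> _; have := @cvgr_idn R; move/cvgryPge => /(_ `|y|); apply: filterS => n yn.
rewrite /= in_itv /= -ler_norml; apply: le_trans yn _; by rewrite ler_nat.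
Qed.

Lemma gwave_FTC f f' (l : R[i]) : (forall y : R, cder f y (f' y)) ->
  (forall y, ccvg (nbhs y) f' (f' y)) -> cintegrable setT f' ->
  ccvg \oo (fun n => f n.+1%:R - f (- n.+1%:R)) l -> cintegral setT f' = l.
Proof.
move=> df cf fi fl.
apply: (@improper_FTC R setT f f' (fun n => - n.+1%:R) (fun n => n.+1%:R)) => //.
- by move=> n; rewrite gtrN // ltr0n.
- exact: setT_exhaust.
Qed.

Definition gfourier j c m : R[i] := cintegral setT (gwave j c m).

(** The derivative of [gwave j] integrates to zero over the line, and its three terms are waves of
    degrees j - 1, j + 1 and j. For j = 0 the truncated predecessor has coefficient 0. *)
Lemma gfourier_rec j c m : 0 < Re c ->
  c * gfourier j.+1 c m =
  j%:R / (2 * pi%:C) * gfourier j.-1 c m - 'i * (m / M)%:C * gfourier j c m.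
Proof.
move=> c0.
have cw i y : ccvg (nbhs y) (gwave i c m) (gwave i c m y) by exact: cder_cvg (cder_gwave i c m y).
have iw i := gwave_integrable i m c0.
have pc : pi%:C != 0 :> R[i] by rewrite realc_neq0 pi_neq0.
have Mc : M%:C != 0 :> R[i] by rewrite realc_neq0 gt_eqF.
have [C HC] := gwave_le j c0.
have H : cintegral setT (fun t => j%:R * M%:C * gwave j.-1 c m t +
   (- (2 * pi%:C * c * M%:C) * gwave j.+1 c m t +
   (- (2 * pi%:C * 'i * m%:C)) * gwave j c m t)) = 0.
  apply: (@gwave_FTC (gwave j c m)).
  - by move=> y; apply: cder_eq (cder_gwave j c m y) _; ring.
  - by move=> y; apply: ccvgD; [|apply: ccvgD]; apply: ccvgM => //; exact: ccvg_cst.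
  - by apply: cintegrableD => //; [|apply: cintegrableD => //]; exact: cintegrableZ.
  - have Z (u : nat -> R) : (forall n, `|u n| = n%:R) -> ccvg \oo (fun n => gwave j c m (u n.+1)) 0.
      move=> un; apply: (@ccvg_norm _ _ _ _ _ _ (fun n => C / (1 + u n.+1 ^+ 2))).
        by apply: nearW => n; rewrite subr0; exact: HC.
      by have := cvg_inv1sqr C un; rewrite -(cvg_shiftS (fun n => C / (1 + u n ^+ 2))).
    rewrite -(subr0 0); apply: ccvgD.
      by apply: (Z (fun n => n%:R)) => n; rewrite normr_nat.
    by apply: ccvgN; apply: (Z (fun n => - n%:R)) => n; rewrite normrN normr_nat.
move: H; rewrite cintegralD //; last 2 first.
- exact: cintegrableZ.
- by apply: cintegrableD => //; exact: cintegrableZ.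
rewrite cintegralD //; [|exact: cintegrableZ|exact: cintegrableZ].
rewrite !cintegralZ // -!/(gfourier _ c m).
move: (gfourier _ c m) (gfourier _ c m) (gfourier _ c m) => g1 g2 g3 H.
have P2 : 2 * pi%:C * M%:C != 0 :> R[i] by rewrite !mulf_neq0 // pnatr_eq0.
apply: (mulfI P2); apply/eqP; rewrite -subr_eq0 -oppr_eq0; apply/eqP; rewrite -[RHS]H.
rewrite realcM realcV.
by move: (pi%:C : R[i]) (M%:C : R[i]) pc Mc {P2 H} => pp MM pc Mc; field; rewrite Mc pc.
Qed.
End ThetaInversion.

(** * The error function along complex lines *)

Section GaussFourier.
Context {R : realType}.
Local Notation mu_L := (@lebesgue_measure R).

Lemma quadratic_eventually_ge0 (A B D : R) (x : nat -> R) : 0 < A ->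
  x n @[n --> \oo] --> +oo -> \forall n \near \oo, 0 <= A * x n ^+ 2 + B * x n + D.
Proof.
move=> A0 xoo; move/cvgryPge : xoo => /(_ (1 + (`|B| + `|D|) / A)); apply: filterS => n.
move: (x n) => y yA.
have B1 := ler_norm (- B); have D1 := ler_norm (- D); rewrite !normrN in B1 D1.
have b0 := normr_ge0 B; have d0 := normr_ge0 D.
have y1 : 1 <= y by apply: le_trans yA; rewrite lerDl divr_ge0 ?addr_ge0 // ltW.
have H : `|B| + `|D| <= A * y.
  by rewrite mulrC -ler_pdivrMr //; apply: le_trans yA; rewrite lerDr.
have H2 : (`|B| + `|D|) * y <= A * y ^+ 2 by nra.
nra.
Qed.

Lemma cvg_natS : (n.+1%:R : R) @[n --> \oo] --> +oo.
Proof.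
apply/cvgryPge => A; have := @cvgr_idn R; move/cvgryPge => /(_ A).
by apply: filterS => n nA; apply: le_trans nA _; rewrite ler_nat.
Qed.

Lemma cvg_affine_pinfty (a e : R) (x : nat -> R) : 0 < a ->
  x n @[n --> \oo] --> +oo -> a * x n + e @[n --> \oo] --> +oo.
Proof.
move=> a0 xoo; apply/cvgryPge => A; move/cvgryPge : xoo => /(_ ((A - e) / a)).
by apply: filterS => n; rewrite ler_pdivrMr // mulrC -lerBlDr.
Qed.

(** A line of direction s with |Im s| < Re s eventually lies in a sector admissible for [cvg_cerf]:
    membership is a quadratic inequality with positive leading coefficient. *)
Lemma cvg_cerf_line (s w : R[i]) (x : nat -> R) : `|Im s| < Re s ->
  x n @[n --> \oo] --> +oo -> ccvg \oo (fun n => cerf (s * (x n)%:C + w)) 1.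
Proof.
move=> sI xoo; have s0 : 0 < Re s by apply: le_lt_trans sI.
have s2 : Im s ^+ 2 < Re s ^+ 2.
  by rewrite -(real_normK (num_real (Im s))) ltr_pXn2r ?nnegrE ?normr_ge0 // ltW.
pose p n := Re s * x n + Re w; pose q n := Im s * x n + Im w.
rewrite (_ : (fun n => _) = fun n => cerf (p n +i* q n)); last first.
  apply/funext => n; congr cerf; by apply: complex_ext; rewrite ?reD ?imD ?reM ?imM re_real im_real mulr0 ?subr0 ?add0r.
(* Half of the relative gap between (Re s)^2 and (Im s)^2; the other half absorbs the terms coming
   from [w]. *)
pose c := (Re s ^+ 2 - Im s ^+ 2) / (2 * Re s ^+ 2).
have d0 : 0 < Re s ^+ 2 - Im s ^+ 2 by rewrite subr_gt0.
have c0 : 0 < c by rewrite divr_gt0 // mulr_gt0 // exprn_gt0.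
apply: (@cvg_cerf _ p q c c0); first exact: cvg_affine_pinfty.
have cE : c * Re s ^+ 2 = (Re s ^+ 2 - Im s ^+ 2) / 2.
  by rewrite /c; field; rewrite gt_eqF.
have A0 : 0 < (Re s ^+ 2 - Im s ^+ 2) / 2 by rewrite divr_gt0.
apply: filterS (quadratic_eventually_ge0 (2 * (1 - c) * Re s * Re w - 2 * Im s * Im w)
  ((1 - c) * Re w ^+ 2 - Im w ^+ 2) A0 xoo) => n.
rewrite /p /q => H; rewrite -subr_ge0; apply: le_trans H _.
rewrite le_eqVlt; apply/orP; left; apply/eqP.
transitivity ((Re s ^+ 2 - Im s ^+ 2 - c * Re s ^+ 2) * x n ^+ 2 +
  (2 * (1 - c) * Re s * Re w - 2 * Im s * Im w) * x n + ((1 - c) * Re w ^+ 2 - Im w ^+ 2)).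
  by rewrite cE; congr (_ * _ + _ + _); field.
ring.
Qed.
End GaussFourier.

(** * The dual Gaussians and Hermite polynomials *)

Section Dual.
Context {R : realType}.
Variables (M mu : R).
Hypothesis M0 : 0 < M.
Local Notation aff t := (M * t + mu).

Definition gdual0 (c : R[i]) (m : R) : R[i] :=
  cexp ((2 * pi * mu * (m / M))%:C * 'i) / (M%:C * sqrtc c) * cexp (- pi%:C * ((m / M) ^+ 2)%:C / c).

(** Completing the square, the integrand is a constant times the derivative of [cerf] along z = s (M
    t + mu) + i xi / s, so no contour is shifted. Each end contributes 1, because s = sqrt c
    satisfies |Im s| < Re s. *)
Lemma gfourier0 c m : 0 < Re c -> gfourier M mu 0 c m = gdual0 c m.
Proof.
move=> c0; set s := sqrtc c; set xi := m / M.
have sI : `|Im s| < Re s := sqrtc_pos c0.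
have s2 : s ^+ 2 = c := sqr_sqrtc c.
have cn0 : c != 0 by apply/eqP => c00; rewrite c00 /= ltxx in c0.
have s0 : s != 0 by rewrite -sqrf_eq0 s2.
have Mc : M%:C != 0 :> R[i] by rewrite realc_neq0 gt_eqF.
pose K : R[i] := cexp ((2 * pi * mu * xi)%:C * 'i) * cexp (- pi%:C * (xi ^+ 2)%:C / c).
pose z (t : R) := s * (aff t)%:C + 'i * xi%:C / s.
have dz t : cder z t (s * M%:C).
  by apply: cder_eq (cderD (cderZ s (cder_affine M mu t)) (cder_cst _ t)) _; rewrite addr0.
have cz (t : R) : ccvg (nbhs t) (fun=> s * M%:C) (s * M%:C) by exact: ccvg_cst.
pose f (t : R) := K / (2 * s * M%:C) * cerf (z t).
have Mxi : M%:C * xi%:C = m%:C :> R[i].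
  by rewrite -realcM /xi mulrC divfK // gt_eqF.
rewrite /gdual0 -/xi -/s.
have df t : cder f t (gwave M mu 0 c m t).
  apply: cder_eq (cderZ _ (cder_erf t dz cz)) _.
  rewrite (_ : K / (2 * s * M%:C) * (2 * cexp (- pi%:C * z t ^+ 2) * (s * M%:C)) =
    K * cexp (- pi%:C * z t ^+ 2)); last by field; rewrite s0 Mc.
  rewrite /K /gwave /gterm expr0 mul1r -!cexpD; congr cexp.
  have -> : z t ^+ 2 = c * (aff t)%:C ^+ 2 + 2 * 'i * ((aff t)%:C * xi%:C) - xi%:C ^+ 2 / c.
    transitivity (s ^+ 2 * (aff t)%:C ^+ 2 + 2 * 'i * ((aff t)%:C * xi%:C) + 'i ^+ 2 * xi%:C ^+ 2 / s ^+ 2).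
      by rewrite /z; field.
    by rewrite s2 sqr_i; ring.
  clearbody xi.
  by rewrite !realcX realcD !realcE -Mxi; field.
rewrite /gfourier (@gwave_FTC _ f _ (K / (s * M%:C)) df).
- by rewrite /K; field; rewrite Mc s0.
- by move=> y; exact: cder_cvg (cder_gwave M mu 0 c m y).
- exact: gwave_integrable.
- have oo (e : R) : M * n.+1%:R + e @[n --> \oo] --> +oo.
    by apply: cvg_affine_pinfty => //; exact: cvg_natS.
  have A : ccvg \oo (fun n => cerf (z n.+1%:R)) 1 by exact: cvg_cerf_line.
  have B : ccvg \oo (fun n => cerf (- z (- n.+1%:R))) 1.
    have := cvg_cerf_line (- ('i * xi%:C / s)) sI (oo (- mu)).
    rewrite (_ : (fun n => _) = (fun n => cerf (- z (- n.+1%:R)))) //.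
    apply/funext => n; congr cerf; rewrite /z (_ : M * - n.+1%:R + mu = - (M * n.+1%:R - mu)); last by ring.
    by rewrite realcN; ring.
  rewrite (_ : K / (s * M%:C) = K / (2 * s * M%:C) * (1 + 1)); last by field; rewrite Mc s0.
  rewrite (_ : (fun n => _) = fun n => K / (2 * s * M%:C) * (cerf (z n.+1%:R) + cerf (- z (- n.+1%:R)))).
    by apply: ccvgM; [exact: ccvg_cst|exact: ccvgD].
  by apply/funext => n; rewrite cerfN /f; ring.
Qed.

(** Hermite polynomials: [hermq xi (1/c) j] is the factor that x^j introduces into the Fourier
    transform of exp(-pi c x^2) at xi. The recurrence is [gfourier_rec] divided by c, with v =
    1/c. *)
Fixpoint hermq (x v : R[i]) (j : nat) {struct j} : R[i] :=
  match j with
  | 0 => 1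
  | j1.+1 => match j1 with
    | 0 => - 'i * x * v
    | j2.+1 => v * (j1%:R / (2 * pi%:C) * hermq x v j2 - 'i * x * hermq x v j1)
    end
  end.

Lemma hermqS x v j : hermq x v j.+1 =
  v * (j%:R / (2 * pi%:C) * hermq x v j.-1 - 'i * x * hermq x v j).
Proof. by case: j => [|j] //=; ring. Qed.

Definition gdual (j : nat) c m : R[i] := gdual0 c m * hermq (m / M)%:C c^-1 j.

Lemma gfourierE j c m : 0 < Re c -> gfourier M mu j c m = gdual j c m.
Proof.
move=> c0; have cn0 : c != 0 by apply/eqP => c00; rewrite c00 /= ltxx in c0.
suff : gfourier M mu j c m = gdual j c m /\ gfourier M mu j.+1 c m = gdual j.+1 c m by case.
elim: j => [|j [IH1 IH2]].
  rewrite /gdual -gfourier0 // mulr1; split=> //.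
  apply: (mulfI cn0); rewrite gfourier_rec // mul0r mul0r add0r hermqS.
  rewrite [hermq _ _ 0]/= !mulr1 mulr0n mul0r add0r.
  by rewrite [RHS]mulrCA mulVKf // mulrN [X in - X]mulrC.
split=> //; apply: (mulfI cn0); rewrite gfourier_rec // IH1 IH2 /gdual [hermq _ _ j.+2]hermqS [j.+1.-1]/=.
rewrite [RHS]mulrCA mulVKf //; ring.
Qed.

Lemma hermq_le j : exists2 B, 0 <= B & forall (x v : R[i]),
  normc (hermq x v j) <= B * ((1 + normc x) ^+ j * (1 + normc v) ^+ j).
Proof.
pose P i := exists2 B, 0 <= B & forall (x v : R[i]),
  normc (hermq x v i) <= B * ((1 + normc x) ^+ i * (1 + normc v) ^+ i).
suff : P j /\ P j.+1 by case.
elim: j => [|j [[B1 B10 H1] [B2 B20 H2]]].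
  split; exists 1 => // x v; first by rewrite normc1 !expr0 !mul1r.
  rewrite !normcE !expr1 !mul1r; have := normc_ge0 x; have := normc_ge0 v.
  move: (normc x) (normc v) => a b a0 b0; nra.
split; first by exists B2.
pose K := normc (j.+1%:R / (2 * pi%:C) : R[i]).
exists (K * B1 + B2) => [|x v]; first by rewrite addr_ge0 // mulr_ge0 ?normc_ge0.
rewrite hermqS normcM [j.+1.-1]/=.
have := H1 x v; have := H2 x v; have x0 := normc_ge0 x; have v0 := normc_ge0 v.
have T : normc (j.+1%:R / (2 * pi%:C) * hermq x v j - 'i * x * hermq x v j.+1) <=
    K * normc (hermq x v j) + normc x * normc (hermq x v j.+1).
  by apply: le_trans (ler_normcD _ _) _; rewrite normc_opp !normcM normc_i mul1r -!normcM.
move=> h2B h1B; apply: le_trans (ler_wpM2l v0 T) _.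
move: (normc (hermq x v j)) (normc (hermq x v j.+1)) h1B h2B => h1 h2 h1B h2B {T}.
move: (normc x) (normc v) x0 v0 h1B h2B => a b a0 b0 h1B h2B.
have K0 : 0 <= K := normc_ge0 _.
pose W := (1 + a) ^+ j * (1 + b) ^+ j.
have W0 : 0 <= W by rewrite mulr_ge0 // exprn_ge0 // addr_ge0.
have E : (1 + a) ^+ j.+2 * (1 + b) ^+ j.+2 = (1 + a) ^+ 2 * (1 + b) ^+ 2 * W.
  by rewrite /W !exprS; ring.
have E1 : (1 + a) ^+ j.+1 * (1 + b) ^+ j.+1 = (1 + a) * (1 + b) * W.
  by rewrite /W !exprS; ring.
rewrite -/W in h1B; rewrite E1 in h2B; rewrite E mulrDr mulrDl; apply: lerD.
- rewrite mulrCA -mulrA ler_wpM2l //.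
  apply: le_trans (ler_wpM2l b0 h1B) _; rewrite mulrCA ler_wpM2l // ler_wpM2r //.
  have A1 : 1 <= (1 + a) ^+ 2 by nra.
  have A2 : b <= (1 + b) ^+ 2 by nra.
  by apply: le_trans A2 _; rewrite ler_peMl ?sqr_ge0.
- rewrite [leLHS]mulrA; apply: le_trans (ler_wpM2l (mulr_ge0 b0 a0) h2B) _.
  rewrite [leLHS]mulrCA ler_wpM2l // [leLHS]mulrA ler_wpM2r //.
  have -> : (1 + a) ^+ 2 * (1 + b) ^+ 2 = ((1 + a) * (1 + b)) * ((1 + a) * (1 + b)) by ring.
  rewrite ler_wpM2r ?mulr_ge0 ?addr_ge0 //.
  by have ab := mulr_ge0 a0 b0; nra.
Qed.

Lemma Re_inv (z : R[i]) : Re z^-1 = Re z / normc z ^+ 2.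
Proof. by case: z => a b; rewrite /= sqr_sqrtr // addr_ge0 ?sqr_ge0. Qed.

(* On a sector [k |c| <= Re c] the nonzero frequencies are uniformly summable. *)
Lemma gdual_le j (k B : R) : 0 < k -> 0 < B -> exists C, forall c (m : int),
  c != 0 -> k * normc c <= Re c -> normc c <= B -> m != 0 ->
  normc (gdual j c m%:~R) <= C / (1 + m%:~R ^+ 2).
Proof.
move=> k0 B0; have [H H0 HH] := hermq_le j; have p0 := pi_gt0 R.
have M2 : 0 < M ^+ 2 by rewrite exprn_gt0.
(* The exponent pi (m/M)^2 Re(1/c) is split in halves. One half, with 1/|c| >= 1/B, is a Gaussian in
   m; the other, with m^2 >= 1, absorbs all powers of 1/|c|. *)
have k1 : 0 < pi * k / (2 * B * M ^+ 2) by rewrite divr_gt0 ?mulr_gt0.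
have k2 : 0 < pi * k / (2 * M ^+ 2) by rewrite divr_gt0 ?mulr_gt0.
have [C1 HC1] := poly_gauss_le j k1.
pose C2 := j.+1`!%:R / (pi * k / (2 * M ^+ 2)) ^+ j.+1 * expR (pi * k / (2 * M ^+ 2)).
have HC2 y : 0 <= y -> (1 + y) ^+ j.+1 * expR (- (pi * k / (2 * M ^+ 2)) * y) <= C2.
  move=> y0; have := @pow_le_expR R j.+1 _ (1 + y) k2 (addr_ge0 ler01 y0).
  rewrite [_ * (1 + y)]mulrDr mulr1 expRD mulrA -/C2 mulNr expRN => Y.
  by rewrite ler_pdivrMr ?expR_gt0.
exists (M^-1 * H * (1 + M^-1) ^+ j * C2 * C1) => c m c0 kc cB m0.
have nc : 0 < normc c by rewrite normc_gt0.
set v := normc c^-1; have vE : v = (normc c)^-1 by rewrite /v normcV.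
have v0 : 0 < v by rewrite vE invr_gt0.
have vB : B^-1 <= v by rewrite vE lef_pV2 ?posrE.
have Rv : k * v <= Re c^-1.
  rewrite Re_inv vE ler_pdivlMr ?exprn_gt0 //.
  by rewrite expr2 mulrA divfK // gt_eqF.
set x := m%:~R : R.
have x1 : 1 <= x ^+ 2.
  rewrite -(real_normK (num_real x)) expr_ge1 // /x -intr_norm -[1]/(1%:~R) ler_int.
  by rewrite -gtz0_ge1 normr_gt0.
have S : normc (sqrtc c)^-1 <= 1 + v.
  have <- : normc (sqrtc c)^-1 ^+ 2 = v by rewrite -normcX exprVn sqr_sqrtc.
  by have := normc_ge0 (sqrtc c)^-1; move: (normc (sqrtc c)^-1) => a a0; nra.
have E : expR (Re (- pi%:C * ((x / M) ^+ 2)%:C / c)) <=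
    expR (- (pi * k / (2 * B * M ^+ 2)) * x ^+ 2) * expR (- (pi * k / (2 * M ^+ 2)) * v).
  rewrite -expRD ler_expR.
  have -> : Re (- pi%:C * ((x / M) ^+ 2)%:C / c) = - (pi / M ^+ 2 * x ^+ 2 * Re c^-1).
    by rewrite !complexRI expr_div_n; ring.
  have P1 : pi / M ^+ 2 * x ^+ 2 * (k * v) <= pi / M ^+ 2 * x ^+ 2 * Re c^-1.
    by rewrite ler_wpM2l // mulr_ge0 ?sqr_ge0 // divr_ge0 ?ltW.
  have pM : 0 < pi * k / (2 * M ^+ 2) := k2.
  have P2 : pi * k / (2 * B * M ^+ 2) * x ^+ 2 <= pi * k / (2 * M ^+ 2) * x ^+ 2 * v.
    have -> : pi * k / (2 * B * M ^+ 2) * x ^+ 2 = pi * k / (2 * M ^+ 2) * x ^+ 2 * B^-1.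
      by field; rewrite !gt_eqF.
    by rewrite ler_wpM2l // mulr_ge0 ?sqr_ge0 // ltW.
  have P3 : pi * k / (2 * M ^+ 2) * v <= pi * k / (2 * M ^+ 2) * x ^+ 2 * v.
    by rewrite ler_wpM2r ?(ltW v0) // ler_peMr // ltW.
  have P4 : pi / M ^+ 2 * x ^+ 2 * (k * v) = 2 * (pi * k / (2 * M ^+ 2) * x ^+ 2 * v).
    by field; rewrite gt_eqF.
  lra.
have F : normc (hermq (x / M)%:C c^-1 j) <= H * ((1 + M^-1) ^+ j * (1 + `|x|) ^+ j * (1 + v) ^+ j).
  apply: le_trans (HH _ _) _; rewrite ler_wpM2l // ler_wpM2r ?exprn_ge0 ?addr_ge0 ?(ltW v0) //.
  rewrite -exprMn; apply: lerXn2r; rewrite ?nnegrE ?mulr_ge0 ?addr_ge0 ?normc_ge0 ?invr_ge0 ?(ltW M0) //.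
  rewrite normc_real normrM normfV (gtr0_norm M0).
  have := normr_ge0 x; have : 0 < M^-1 by rewrite invr_gt0.
  by move: (M^-1) `|x| => a b a0 b0; nra.
have -> : normc (gdual j c x) = M^-1 * normc (sqrtc c)^-1 *
    expR (Re (- pi%:C * ((x / M) ^+ 2)%:C / c)) * normc (hermq (x / M)%:C c^-1 j).
  rewrite /gdual /gdual0 !normcE (_ : Re (_ * 'i) = 0) ?expR0; last first.
    by rewrite !complexRI mulr0 mul0r subr0.
  by rewrite mul1r invfM gtr0_norm.
apply: le_trans (ler_pM _ (normc_ge0 _) (ler_pM _ (expR_ge0 _) (ler_wpM2l _ S) E) F) _;
  rewrite ?mulr_ge0 ?invr_ge0 ?normc_ge0 ?expR_ge0 ?(ltW M0) //.
have G1 := HC1 x; have G2 := HC2 v (ltW v0); rewrite exprSr in G2.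
set e1 := expR _ in G1 *; set e2 := expR _ in G2 *.
have -> : M^-1 * (1 + v) * (e1 * e2) * (H * ((1 + M^-1) ^+ j * (1 + `|x|) ^+ j * (1 + v) ^+ j)) =
  M^-1 * H * (1 + M^-1) ^+ j * (((1 + v) ^+ j * (1 + v) * e2) * ((1 + `|x|) ^+ j * e1)) by ring.
have K0 : 0 <= M^-1 * H * (1 + M^-1) ^+ j.
  by rewrite !mulr_ge0 ?exprn_ge0 ?addr_ge0 ?invr_ge0 ?(ltW M0).
have -> : M^-1 * H * (1 + M^-1) ^+ j * C2 * C1 / (1 + x ^+ 2) =
  M^-1 * H * (1 + M^-1) ^+ j * (C2 * (C1 / (1 + x ^+ 2))) by rewrite !mulrA.
rewrite ler_wpM2l //; apply: ler_pM => //.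
- by rewrite !mulr_ge0 ?exprn_ge0 ?expR_ge0 ?addr_ge0 ?(ltW v0).
- by rewrite mulr_ge0 ?exprn_ge0 ?expR_ge0 ?addr_ge0.
Qed.

Lemma gdual_fast j c : 0 < Re c -> fast (fun m => gdual j c m%:~R).
Proof.
move=> c0; have cn0 : c != 0 by apply/eqP => c00; rewrite c00 /= ltxx in c0.
have nc : 0 < normc c by rewrite normc_gt0.
have k0 : 0 < Re c / normc c by rewrite divr_gt0.
have [C HC] := gdual_le j k0 nc.
exists (`|C| + normc (gdual j c 0%:~R)) => m.
have [->|m0] := eqVneq m 0; first by rewrite expr0n addr0 divr1 lerDr.
apply: le_trans (HC c m cn0 _ (lexx _) m0) _; first by rewrite divfK // gt_eqF.
rewrite ler_wpM2r ?invr_ge0 ?(ltW (onepsqr_gt0 _)) //.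
by apply: le_trans (ler_norm C) _; rewrite lerDl normc_ge0.
Qed.
End Dual.

(** * Inversion of theta series *)

Section ThetaInv.
Context {R : realType}.
Variables (M mu : R).
Hypothesis M0 : 0 < M.
Local Notation aff t := (M * t + mu).
Local Notation lmu := (@lebesgue_measure R).

Lemma gterm_fast (c : R[i]) j : 0 < Re c -> fast (fun t => gterm j c (aff t%:~R)).
Proof.
move=> c0; have [C HC] := gwave_le mu M0 j c0; exists C => t.
by rewrite -(normc_gwave M mu j c 0); exact: HC.
Qed.

Lemma gwave0 j (c : R[i]) (t : R) : gwave M mu j c 0 t = gterm j c (aff t).
Proof. by rewrite /gwave mulr0 mul0r oppr0 mul0r cexp0 mulr1. Qed.

(** The Dirichlet kernel collects the frequencies -J to J, while [bsum] stops at J - 1; hence the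
    extra term. *)
Lemma int_gwave_dirichlet j (c : R[i]) (J : nat) : 0 < Re c ->
  cintegrable setT (fun t => (dirichlet J t)%:C * gwave M mu j c 0 t) /\
  cintegral setT (fun t => (dirichlet J t)%:C * gwave M mu j c 0 t) =
    bsum (fun m => gfourier M mu j c m%:~R) J + gfourier M mu j c J%:R.
Proof.
move=> c0; have iw m := gwave_integrable mu M0 j m c0.
elim: J => [|J [iJ IH]].
  rewrite /bsum big_geq // add0r /gfourier; split.
    by apply: eq_cintegrable (iw 0) => // t _; rewrite /= mul1r.
  by apply: eq_cintegral => t _; rewrite /= mul1r.
have E t : (dirichlet J.+1 t)%:C * gwave M mu j c 0 t =
    (dirichlet J t)%:C * gwave M mu j c 0 t +
    (gwave M mu j c J.+1%:R t + gwave M mu j c (- J.+1%:R) t).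
  rewrite dirichletS realcD mulrDl gwave0; congr (_ + _).
  rewrite /gwave -mulrDr mulrC; congr (_ * _).
  set y := 2 * pi * J.+1%:R * t.
  have -> : 2 * pi * - J.+1%:R * t = - y by rewrite /y; ring.
  rewrite -!realcN !cexp_i opprK cosN sinN.
  by apply: complex_ext; rewrite ?reD ?imD ?re_real ?im_real /= ?addNr // mulr_natl mulr2n.
have i2 : cintegrable setT (fun t => gwave M mu j c J.+1%:R t + gwave M mu j c (- J.+1%:R) t).
  exact: cintegrableD.
split.
  by apply: eq_cintegrable (cintegrableD _ iJ i2) => // t _; rewrite E.
under eq_fun do rewrite E; rewrite cintegralD // cintegralD // IH bsumS.
rewrite NegzE mulrNz -[J.+1%:~R]/(J.+1%:R) -[J%:~R]/(J%:R) -!/(gfourier _ _ _ _ _).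
ring.
Qed.

(** Poisson summation for real and imaginary parts at frequency 0; the Dirichlet integrals converge
    because the dual series does. *)
Theorem theta_inversion j (c : R[i]) : 0 < Re c ->
  zsum (fun t => gterm j c (aff t%:~R)) = zsum (fun m => gdual M mu j c m%:~R).
Proof.
move=> c0; have fG := gdual_fast mu M0 j c0.
have [C HC] := gterm_fast j c0; apply: (zsum_unique HC).
have GE m : gdual M mu j c m = gfourier M mu j c m by rewrite gfourierE.
have D : ccvg \oo (fun J => cintegral setT (fun t => (dirichlet J t)%:C * gwave M mu j c 0 t))
    (zsum (fun m => gdual M mu j c m%:~R)).
  rewrite (_ : (fun J => _) = fun J => bsum (fun m => gdual M mu j c m%:~R) J + gdual M mu j c J%:~R).
    by rewrite -[X in ccvg _ _ X]addr0; apply: ccvgD; [exact: fast_cvg|have [] := fast_cvg0 fG].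
  apply/funext => J; rewrite (int_gwave_dirichlet _ _ c0).2 GE.
  by congr (_ + _); rewrite /bsum; apply: eq_bigr => i _; rewrite !GE.
have [A0 HA0] := gwave_le mu M0 j c0.
have [A1 HA1] := gwave_le mu M0 j.-1 c0.
have [A2 HA2] := gwave_le mu M0 j.+1 c0.
pose g' t := j%:R * M%:C * gwave M mu j.-1 c 0 t - 2 * pi%:C * c * M%:C * gwave M mu j.+1 c 0 t
   - 2 * pi%:C * 'i * 0%:C * gwave M mu j c 0 t.
have dg t : cder (gwave M mu j c 0) t (g' t) by exact: cder_gwave.
pose K1 := normc (j%:R * M%:C : R[i]); pose K2 := normc (2 * pi%:C * c * M%:C).
pose B := A0 + (K1 * A1 + K2 * A2).
have pos (A : R) i : (forall m t, normc (gwave M mu i c m t) <= A / (1 + t ^+ 2)) -> 0 <= A.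
  by move=> /(_ 0 0); rewrite expr0n addr0 divr1; apply: le_trans; exact: normc_ge0.
have A00 := pos _ _ HA0; have A10 := pos _ _ HA1; have A20 := pos _ _ HA2.
have K10 : 0 <= K1 := normc_ge0 _; have K20 : 0 <= K2 := normc_ge0 _.
have i0 t : 0 <= (1 + t ^+ 2)^-1 :> R by rewrite invr_ge0 ltW // onepsqr_gt0.
have gB t : normc (gwave M mu j c 0 t) <= B / (1 + t ^+ 2).
  apply: le_trans (HA0 0 t) _; rewrite ler_wpM2r // lerDl addr_ge0 // mulr_ge0 //.
have g'B t : normc (g' t) <= B / (1 + t ^+ 2).
  rewrite /g' mulr0 mul0r subr0; apply: le_trans (ler_normcD _ _) _.
  rewrite normc_opp normcM [normc (_ * gwave _ _ _ _ _ _)]normcM -/K1 -/K2 /B mulrDl.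
  rewrite -[leLHS]add0r; apply: lerD; first by rewrite mulr_ge0.
  by rewrite mulrDl -!mulrA; apply: lerD; rewrite ler_wpM2l.
have dirI (J : nat) : cintegral setT (fun t => (dirichlet J t)%:C * gwave M mu j c 0 t) =
    (\int[lmu]_t (Re (gwave M mu j c 0 t) * dirichlet J t)) +i*
    (\int[lmu]_t (Im (gwave M mu j c 0 t) * dirichlet J t)).
  rewrite /cintegral; congr (_ +i* _); apply: eq_Rintegral => t _.
  - by rewrite reM re_real im_real mul0r subr0 mulrC.
  - by rewrite imM re_real im_real mul0r addr0 mulrC.
have [Dr Di] : \int[lmu]_t (Re (gwave M mu j c 0 t) * dirichlet J t) @[J --> \oo] -->
      Re (zsum (fun m => gdual M mu j c m%:~R)) /\
    \int[lmu]_t (Im (gwave M mu j c 0 t) * dirichlet J t) @[J --> \oo] -->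
      Im (zsum (fun m => gdual M mu j c m%:~R)).
  by move: D; under eq_fun do rewrite dirI; case.
have bR N : Re (bsum (fun t => gterm j c (aff t%:~R)) N) = rbsum (fun t => Re (gwave M mu j c 0 t)) N.
  by rewrite /bsum re_sum; apply: eq_bigr => i _; rewrite reD -!gwave0 NegzE mulrNz.
have bI N : Im (bsum (fun t => gterm j c (aff t%:~R)) N) = rbsum (fun t => Im (gwave M mu j c 0 t)) N.
  by rewrite /bsum im_sum; apply: eq_bigr => i _; rewrite imD -!gwave0 NegzE mulrNz.
split.
- under eq_fun do rewrite bR.
  apply: (@poisson_real R (fun t => Re (gwave M mu j c 0 t)) (fun t => Re (g' t)) B).
  + by move=> t; have [] := dg t.
  + by move=> t; apply: le_trans (Re_le_normc _) _.
  + by move=> t; apply: le_trans (Re_le_normc _) _.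
  + exact: Dr.
- under eq_fun do rewrite bI.
  apply: (@poisson_real R (fun t => Im (gwave M mu j c 0 t)) (fun t => Im (g' t)) B).
  + by move=> t; have [] := dg t.
  + by move=> t; apply: le_trans (Im_le_normc _) _.
  + by move=> t; apply: le_trans (Im_le_normc _) _.
  + exact: Di.
Qed.
End ThetaInv.

(** * The integral with kernel 1 / sqrt(y + b) *)

Section SqrtCurve.
Context {R : realType}.
Variable b : R[i].
Hypothesis b0 : Im b != 0.
Implicit Type y : R.

(** As Im b is nonzero, y + b avoids the branch cut for every real y, so this root is smooth also at
    and below y = 0. *)
Definition rsqrt y : R[i] := sqrtc (y%:C + b).

Lemma rsqrt_sqr y : rsqrt y ^+ 2 = y%:C + b.
Proof. exact: sqr_sqrtc. Qed.

Lemma Re_rsqrt_gt0 y : 0 < Re (rsqrt y).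
Proof.
rewrite lt_def Re_sqrtc_ge0 andbT; apply/eqP => r0.
have : Im (rsqrt y ^+ 2) = Im b by rewrite rsqrt_sqr imD im_real add0r.
rewrite expr2 imM [Re _]r0 mul0r mulr0 addr0 => /esym/eqP.
by rewrite (negPf b0).
Qed.

Lemma rsqrt_neq0 y : rsqrt y != 0.
Proof. by apply/eqP => r0; have := Re_rsqrt_gt0 y; rewrite r0 ltxx. Qed.

Lemma normc_rsqrt_ge y : Num.sqrt `|Im b| <= normc (rsqrt y).
Proof.
rewrite -(@ler_pXn2r _ 2) ?nnegrE ?sqrtr_ge0 ?normc_ge0 // sqr_sqrtr //.
rewrite normc_sqrtc; apply: le_trans (Im_le_normc _).
by rewrite imD im_real add0r.
Qed.

Lemma sqrt_Im_gt0 : 0 < Num.sqrt `|Im b|.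
Proof. by rewrite sqrtr_gt0 normr_gt0. Qed.

Lemma is_derive_sqrt_comp (f : R -> R) y d : is_derive y 1 f d -> 0 < f y ->
  is_derive y 1 (fun t => Num.sqrt (f t)) (d / (2 * Num.sqrt (f y))).
Proof.
move=> fd f0; have sd := is_derive1_sqrt f0.
by apply: (is_derive_eq (is_derive1_comp sd fd)); rewrite mulrC.
Qed.

(** Computed from the explicit real and imaginary parts sqrt((rho + u)/2) and sqrt((rho - u)/2) of
    the principal root. *)
Lemma cder_rsqrt y : cder rsqrt y (2 * rsqrt y)^-1.
Proof.
pose be := Im b; have be0 : be != 0 := b0.
pose u t := t + Re b; pose rho t := Num.sqrt (u t ^+ 2 + be ^+ 2).
have be2 : 0 < be ^+ 2 by rewrite lt_def sqrf_eq0 be0 sqr_ge0.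
have q0 t : 0 < u t ^+ 2 + be ^+ 2 by rewrite ltr_wpDl ?sqr_ge0.
have rho0 t : 0 < rho t by rewrite sqrtr_gt0.
have rhou t : `|u t| < rho t.
  rewrite -(@ltr_pXn2r _ 2) ?nnegrE ?(ltW (rho0 t)) // sqr_sqrtr ?(ltW (q0 t)) //.
  by rewrite real_normK ?num_real // ltrDl.
have A0 t : 0 < (rho t + u t) / 2.
  by have := rhou t; rewrite ltr_norml => /andP[? _]; rewrite divr_gt0 //; lra.
have B0 t : 0 < (rho t - u t) / 2.
  by have := rhou t; rewrite ltr_norml => /andP[_ ?]; rewrite divr_gt0 //; lra.
have rE t : rsqrt t = Num.sqrt ((rho t + u t) / 2) +i* (Num.sg be * Num.sqrt ((rho t - u t) / 2)).
  rewrite /rsqrt /rho /u; move: be0; rewrite /be; case: (b) => b1 b2 /= b20.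
  by rewrite !add0r (negPf b20).
have du : is_derive y 1 u 1.
  by apply: (is_derive_eq (is_derive_add (is_derive_id y 1) (is_derive_const (Re b) y))); rewrite addr0.
have drho : is_derive y 1 rho (u y / rho y).
  have := is_derive_mul du du; move/(fun h => is_derive_add h (is_derive_const (be ^+ 2) y)) => h.
  have := @is_derive_sqrt_comp (fun t => u t * u t + be ^+ 2) y _ h.
  rewrite -expr2 => /(_ (q0 y)) H.
  by apply: (is_derive_eq H); rewrite /= -/(rho y) addr0 mul1r mulr1; field; rewrite gt_eqF.
have dA : is_derive y 1 (fun t => (rho t + u t) / 2) ((u y / rho y + 1) / 2).
  apply: (is_derive_eq (is_derive_mul (is_derive_add drho du) (is_derive_const 2^-1 y))).
  by rewrite mulr0 addr0.
have dB : is_derive y 1 (fun t => (rho t - u t) / 2) ((u y / rho y - 1) / 2).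
  apply: (is_derive_eq (is_derive_mul (is_derive_sub drho du) (is_derive_const 2^-1 y))).
  by rewrite mulr0 addr0.
set p := Num.sqrt ((rho y + u y) / 2); set q := Num.sqrt ((rho y - u y) / 2).
have p0 : 0 < p by rewrite sqrtr_gt0.
have q1 : 0 < q by rewrite sqrtr_gt0.
have p2 : p ^+ 2 = (rho y + u y) / 2 by rewrite sqr_sqrtr // ltW.
have q2 : q ^+ 2 = (rho y - u y) / 2 by rewrite sqr_sqrtr // ltW.
have sg2 : Num.sg be ^+ 2 = 1 by rewrite sqr_sg be0.
have -> : (2 * rsqrt y)^-1 = (p / (2 * rho y)) +i* (- (Num.sg be * q / (2 * rho y))).
  apply: (mulfI (_ : 2 * rsqrt y != 0)); first by rewrite mulf_neq0 ?rsqrt_neq0 // pnatr_eq0.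
  rewrite divff ?mulf_neq0 ?rsqrt_neq0 ?pnatr_eq0 // rE -/p -/q.
  have r0 : rho y != 0 by rewrite gt_eqF.
  apply: complex_ext; rewrite !(reM, imM, re_nat, im_nat) /=.
    transitivity ((p ^+ 2 + Num.sg be ^+ 2 * q ^+ 2) / rho y).
      by rewrite sg2 mul1r p2 q2; field.
    by field.
  by rewrite !mul0r !(subr0, addr0); field.
split.
- under eq_fun do rewrite rE /=.
  apply: (is_derive_eq (is_derive_sqrt_comp dA (A0 y))); rewrite /= -/p.
  have -> : (u y / rho y + 1) / 2 = p ^+ 2 / rho y by rewrite p2; field; rewrite gt_eqF.
  by field; rewrite !gt_eqF.
- under eq_fun do rewrite rE /=.
  apply: (is_derive_eq (is_derive_mul (is_derive_const (Num.sg be) y) (is_derive_sqrt_comp dB (B0 y)))).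
  rewrite /= -/q mul0r add0r.
  have -> : (u y / rho y - 1) / 2 = - q ^+ 2 / rho y by rewrite q2; field; rewrite gt_eqF.
  by field; rewrite !gt_eqF.
Qed.

Lemma rsqrt_cvg y : ccvg (nbhs y) rsqrt (rsqrt y).
Proof. exact: cder_cvg (cder_rsqrt y). Qed.

Lemma ccvg_inv T (F : set_system T) {FF : Filter F} (f : T -> R[i]) l : l != 0 ->
  ccvg F f l -> ccvg F (fun x => (f x)^-1) l^-1.
Proof.
move=> l0 fl; have [fr fi] := fl.
have nE (z : R[i]) : z^-1 = (Re z / normc z ^+ 2) +i* (- (Im z / normc z ^+ 2)).
  by case: z => x y; rewrite /= sqr_sqrtr // addr_ge0 ?sqr_ge0.
have nl : normc l ^+ 2 != 0 by rewrite sqrf_eq0 normc_eq0.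
have n2 : (normc (f x) ^+ 2)^-1 @[x --> F] --> (normc l ^+ 2)^-1.
  apply: cvgV => //; rewrite !expr2; under eq_fun do rewrite expr2.
  by apply: cvgM; exact: ccvg_normc.
rewrite nE; split; under eq_fun do rewrite nE /=.
- exact: cvgM.
- by apply: cvgN; exact: cvgM.
Qed.

Lemma expR_le_inv1sqr (k : R) : 0 < k -> exists C, forall y, 0 <= y ->
  expR (- (k * y)) <= C / (1 + y ^+ 2).
Proof.
move=> k0; exists (2`!%:R / k ^+ 2 * expR k) => y y0.
have := @pow_le_expR R 2 k (1 + y) k0 (addr_ge0 ler01 y0).
rewrite [k * (1 + y)]mulrDr mulr1 expRD mulrA => H.
rewrite ler_pdivlMr ?onepsqr_gt0 // expRN mulrC ler_pdivrMr ?expR_gt0 //.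
by apply: le_trans H; nra.
Qed.

Lemma rintegrable_expR (k : R) : 0 < k ->
  rintegrable `]0, +oo[ (fun y : R => expR (- (k * y))).
Proof.
move=> k0; have [C HC] := expR_le_inv1sqr k0.
apply: (@rintegrable_le _ _ _ (fun y => C / (1 + y ^+ 2))) => //.
- apply: measurable_funTS; apply: measurableT_comp => //.
  by apply: measurableT_comp => //; exact: measurable_funM.
- move=> y; rewrite /= in_itv /= andbT => /ltW y0; rewrite ger0_norm ?expR_ge0 //.
  exact: HC.
- apply: (@integrableS _ _ _ _ setT) => //.
  by apply: rintegrableZ => //; exact: rintegrable_inv1sqr.
Qed.

(** Up to the factor x^k, one lattice term of the Eichler integrand, with z = i y. *)
Definition yker (x : R) y : R[i] := x%:C * cexp (- (pi * x ^+ 2 * y)%:C) / rsqrt y.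

Lemma yker_cvg x y : ccvg (nbhs y) (yker x) (yker x y).
Proof.
apply: ccvgM; last by apply: ccvg_inv; [exact: rsqrt_neq0|exact: rsqrt_cvg].
apply: ccvgM; first exact: ccvg_cst.
apply: ccvg_cexp; apply: ccvgN; apply: ccvg_real.
by apply: cvgM; [exact: cvg_cst|exact: cvg_id].
Qed.

Lemma normc_yker_le x y : normc (yker x y) <=
  `|x| / Num.sqrt `|Im b| * expR (- (pi * x ^+ 2 * y)).
Proof.
rewrite /yker !normcE mulrAC; rewrite !complexRI ler_wpM2r ?expR_ge0 //.
rewrite ler_wpM2l // lef_pV2 ?posrE ?sqrt_Im_gt0 ?normc_rsqrt_ge //.
by rewrite normc_gt0 rsqrt_neq0.
Qed.

Lemma yker_integrable x : x != 0 -> cintegrable `]0, +oo[ (yker x).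
Proof.
move=> x0; have k0 : 0 < pi * x ^+ 2 by rewrite mulr_gt0 ?pi_gt0 // lt_def sqrf_eq0 x0 sqr_ge0.
apply: (@cintegrable_le _ _ _ (fun y => `|x| / Num.sqrt `|Im b| * expR (- (pi * x ^+ 2 * y)))) => //.
- by apply: cmeas_continuous => // y; exact: yker_cvg.
- by move=> y _; exact: normc_yker_le.
- by apply: rintegrableZ => //; exact: rintegrable_expR.
Qed.

(** A primitive is exp(pi b x^2) [cerf] (x sqrt(y + b)); the error function tends to 1 at infinity
    and is continuous at y = 0. *)
Lemma yker_integral_pos x : 0 < x -> cintegral `]0, +oo[ (yker x) =
  cexp (pi%:C * b * x%:C ^+ 2) * (1 - cerf (x%:C * sqrtc b)).
Proof.
move=> x0.
have df y : cder (fun y => cexp (pi%:C * b * x%:C ^+ 2) * cerf (x%:C * rsqrt y)) y (yker x y).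
  have dr s : cder (fun s => x%:C * rsqrt s) s (x%:C * (2 * rsqrt s)^-1).
    exact: cderZ (cder_rsqrt s).
  have cr (s : R) : ccvg (nbhs s) (fun s => x%:C * (2 * rsqrt s)^-1) (x%:C * (2 * rsqrt s)^-1).
    apply: ccvgM; first exact: ccvg_cst.
    apply: ccvg_inv; first by rewrite mulf_neq0 ?rsqrt_neq0 // pnatr_eq0.
    by apply: ccvgM; [exact: ccvg_cst|exact: rsqrt_cvg].
  apply: cder_eq (cderZ _ (cder_erf y dr cr)) _.
  rewrite /yker exprMn rsqrt_sqr.
  have -> : cexp (- (pi * x ^+ 2 * y)%:C) = cexp (pi%:C * b * x%:C ^+ 2) *
      cexp (- pi%:C * (x%:C ^+ 2 * (y%:C + b))).
    by rewrite -cexpD; congr cexp; rewrite !realcE; ring.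
  by field; rewrite rsqrt_neq0.
apply: (@improper_FTC R `]0, +oo[%classic _ _ (fun n => n.+1%:R^-1) (fun n => n.+2%:R) _ _ df).
- exact: measurable_itv.
- by move=> y; exact: yker_cvg.
- by apply: yker_integrable; rewrite gt_eqF.
- move=> n; apply: (@le_lt_trans _ _ 1); first by rewrite invf_le1 ?ler1n ?ltr0n.
  by rewrite ltr1n.
- move=> n y; rewrite /= !in_itv /= andbT => /andP[H _]; apply: lt_le_trans H.
  by rewrite invr_gt0 ltr0n.
- move=> y; rewrite /= in_itv /= andbT => y0.
  have H1 : \forall n \near \oo, y <= n%:R.
    by have := @cvgr_idn R; move/cvgryPge => /(_ y).
  have H2 : \forall n \near \oo, y^-1 <= n%:R.
    by have := @cvgr_idn R; move/cvgryPge => /(_ y^-1).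
  near=> n; rewrite /= in_itv /=; apply/andP; split.
    rewrite -[leRHS]invrK lef_pV2 ?posrE ?ltr0n ?invr_gt0 //.
    by apply: le_trans (_ : _ <= n%:R) _; [near: n|rewrite ler_nat].
  by apply: le_trans (_ : _ <= n%:R) _; [near: n|rewrite ler_nat -addn2 leq_addr].
- rewrite mulrBr mulr1; apply: ccvgD.
  + rewrite -[X in ccvg _ _ X]mulr1; apply: ccvgM; first exact: ccvg_cst.
    have pE n : x%:C * rsqrt n = (x * Re (rsqrt n)) +i* (x * Im (rsqrt n)).
      by apply: complex_ext; rewrite ?reM ?imM /= mul0r ?subr0 ?addr0.
    under eq_fun do rewrite pE.
    (* Read off from the imaginary part of the square: Im decreases as Re grows, so the curve enters
       the sector required by [cvg_cerf]. *)
    have imE y : Im (rsqrt y) = Im b / (2 * Re (rsqrt y)).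
      have : Im (rsqrt y ^+ 2) = Im b by rewrite rsqrt_sqr imD im_real add0r.
      rewrite expr2 imM => <-; have := Re_rsqrt_gt0 y.
      by move: (Re _) (Im _) => p q p0; field; rewrite gt_eqF.
    have reE y : y + Re b <= Re (rsqrt y) ^+ 2.
      have : Re (rsqrt y ^+ 2) = y + Re b by rewrite rsqrt_sqr reD.
      by rewrite Re_sqr => <-; rewrite gerBl sqr_ge0.
    have reoo : Re (rsqrt n.+2%:R) @[n --> \oo] --> +oo.
      apply/cvgryPge => A; have := @cvgr_idn R; move/cvgryPge => /(_ (A ^+ 2 - Re b)).
      apply: filterS => n nA; rewrite leNgt; apply/negP => H.
      have := reE n.+2%:R; apply/negP; rewrite -ltNge.
      have r0 := Re_rsqrt_gt0 n.+2%:R.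
      have H2 : Re (rsqrt n.+2%:R) ^+ 2 < A ^+ 2.
        by rewrite ltr_pXn2r ?nnegrE ?ltW //; exact: lt_trans H.
      apply: lt_le_trans H2 _; rewrite -lerBlDr; apply: le_trans nA _.
      by rewrite ler_nat -addn2 leq_addr.
    apply: (@cvg_cerf R _ _ 2^-1) => //.
      by have := cvg_affine_pinfty 0 x0 reoo; under eq_fun do rewrite addr0.
    move/cvgryPge : reoo => /(_ (1 + `|Im b|)); apply: filterS => n H.
    rewrite imE !exprMn; set r := Re _ in H *.
    have r0 : 0 < r := Re_rsqrt_gt0 _.
    have i1 := normr_ge0 (Im b).
    rewrite [leRHS]mulrCA ler_wpM2l ?sqr_ge0 // exprVn exprMn.
    rewrite ler_pdivrMr ?mulr_gt0 ?exprn_gt0 // -(real_normK (num_real (Im b))).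
    move: `|Im b| H i1 => B H i1.
    have rB : B <= r by lra.
    have r1 : 1 <= r by lra.
    have B2 : B ^+ 2 <= r ^+ 2 by rewrite ler_pXn2r ?nnegrE // ltW.
    have r2 : 1 <= r ^+ 2 by rewrite expr_ge1 // ltW.
    by move: (r ^+ 2) (B ^+ 2) B2 r2 => u v uv u1; nra.
  + apply: ccvgN; apply: ccvgM; first exact: ccvg_cst.
    have -> : sqrtc b = rsqrt 0 by rewrite /rsqrt -[0%:C]/(0 : R[i]) add0r.
    have [Hr Hi] := cder_cvg (df 0).
    pose f y := cerf (x%:C * rsqrt y).
    have dr s : cder (fun s => x%:C * rsqrt s) s (x%:C * (2 * rsqrt s)^-1).
      exact: cderZ (cder_rsqrt s).
    have cr (s : R) : ccvg (nbhs s) (fun s => x%:C * (2 * rsqrt s)^-1) (x%:C * (2 * rsqrt s)^-1).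
      apply: ccvgM; first exact: ccvg_cst.
      apply: ccvg_inv; first by rewrite mulf_neq0 ?rsqrt_neq0 // pnatr_eq0.
      by apply: ccvgM; [exact: ccvg_cst|exact: rsqrt_cvg].
    have [fr fi] := cder_cvg (cder_erf 0 dr cr).
    by split; [exact: (cvg_comp _ _ (@cvg_harmonic R) fr)|exact: (cvg_comp _ _ (@cvg_harmonic R) fi)].
Unshelve. all: by end_near. Qed.

Lemma yker_integral x : x != 0 -> cintegral `]0, +oo[ (yker x) =
  cexp (pi%:C * b * x%:C ^+ 2) * ((Num.sg x)%:C - cerf (x%:C * sqrtc b)).
Proof.
case: (ltrgtP x 0) => // x0 _; last by rewrite yker_integral_pos // gtr0_sg.
have xN : 0 < - x by rewrite oppr_gt0.
have := yker_integral_pos xN; rewrite realcN sqrrN mulNr cerfN opprK ltr0_sg // realcN.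
have -> : cintegral `]0, +oo[ (yker (- x)) = - cintegral `]0, +oo[ (yker x).
  rewrite -[RHS]mulN1r -cintegralZ //; last by apply: yker_integrable; rewrite lt_eqF.
  apply: eq_cintegral => y _; rewrite /yker sqrrN realcN; ring.
move/(congr1 (fun z => - z)); rewrite opprK => ->; rewrite -[1%:C]/(1 : R[i]); ring.
Qed.
End SqrtCurve.

(** * An integral over the line for the error function, and the key identity *)

Section WIntegral.
Context {R : realType}.
Implicit Types (w x : R) (b : R[i]).

(** The derivative of [tauw], which maps the line onto (-1, 1). *)
Definition omega w : R := (Num.sqrt (1 + w ^+ 2))^-1 ^+ 3.
Definition tauw w : R := w / Num.sqrt (1 + w ^+ 2).

Lemma sqrt_onepsqr_ge1 w : 1 <= Num.sqrt (1 + w ^+ 2).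
Proof. by rewrite -[leLHS]sqrtr1 ler_wsqrtr // lerDl sqr_ge0. Qed.

Lemma sqrt_onepsqr_gt0 w : 0 < Num.sqrt (1 + w ^+ 2).
Proof. exact: lt_le_trans ltr01 (sqrt_onepsqr_ge1 w). Qed.

Lemma sqr_sqrt_onepsqr w : Num.sqrt (1 + w ^+ 2) ^+ 2 = 1 + w ^+ 2.
Proof. by rewrite sqr_sqrtr // ltW // onepsqr_gt0. Qed.

Lemma omega_ge0 w : 0 <= omega w.
Proof. by rewrite exprn_ge0 // invr_ge0 sqrtr_ge0. Qed.

Lemma omega_le w : omega w <= (1 + w ^+ 2)^-1.
Proof.
rewrite /omega exprS exprVn sqr_sqrt_onepsqr ler_piMl ?invr_ge0 ?(ltW (onepsqr_gt0 _)) //.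
by rewrite invf_le1 ?sqrt_onepsqr_gt0 // sqrt_onepsqr_ge1.
Qed.

Lemma continuous_omega : continuous omega.
Proof.
move=> w; rewrite /omega; apply: (@continuous_comp _ _ _ (fun w => (Num.sqrt (1 + w ^+ 2))^-1) (fun y => y ^+ 3)).
  apply: cvgV; first by rewrite gt_eqF // sqrt_onepsqr_gt0.
  apply: continuous_cvg; first exact: sqrt_continuous.
  by apply: cvgD; [exact: cvg_cst|exact: exprn_continuous].
exact: exprn_continuous.
Qed.

Lemma rintegrable_omega : rintegrable setT omega.
Proof.
apply: rintegrable_le rintegrable_inv1sqr => //.
- by apply: continuous_measurable_fun; exact: continuous_omega.
- by move=> w _; rewrite ger0_norm ?omega_ge0 // omega_le.
Qed.

Lemma is_derive_tauw w : is_derive w 1 tauw (omega w).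
Proof.
have dq : is_derive w 1 (fun t : R => 1 + t ^+ 2) (2 * w).
  apply: (is_derive_eq (is_derive_add (is_derive_const 1 w) (is_deriveX 2 (is_derive_id w 1)))).
  by rewrite add0r /= expr1 /GRing.scale /= mulr1.
have ds := is_derive_sqrt_comp dq (onepsqr_gt0 w).
have s0 := sqrt_onepsqr_gt0 w.
have dv := @is_deriveV R (fun t => Num.sqrt (1 + t ^+ 2)) w _ 1 (lt0r_neq0 s0) ds.
apply: (is_derive_eq (is_derive_mul (is_derive_id w 1) dv)).
have s2 := sqr_sqrt_onepsqr w.
rewrite /omega /GRing.scale /=; move: (Num.sqrt _) s0 s2 => s s0 s2.
transitivity ((s ^+ 2 - w ^+ 2) / s ^+ 3); first by field; rewrite gt_eqF.
by rewrite s2 addrK exprVn mul1r.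
Qed.

(** The integrand of the error function after the substitution by [tauw]. The parameter b / (1 +
    w^2) has an inverse that is quadratic in w, so that theta inversion produces Gaussians in w. *)
Definition wker b x w : R[i] := (omega w)%:C * cexp (pi%:C * b * (x ^+ 2 / (1 + w ^+ 2))%:C).

Lemma wker_cvg b x w : ccvg (nbhs w) (wker b x) (wker b x w).
Proof.
apply: ccvgM; first by apply: ccvg_real; exact: continuous_omega.
apply: ccvg_cexp; apply: ccvgM; first exact: ccvg_cst.
by apply: ccvg_real; apply: cvgM; [exact: cvg_cst|exact: continuous_oneDsqrV].
Qed.

Lemma normc_wker_le b x w : Re b <= 0 -> normc (wker b x w) <= omega w.
Proof.
move=> b0; rewrite /wker !normcE ger0_norm ?omega_ge0 // ler_piMr ?omega_ge0 //.
rewrite -[leRHS]expR0 ler_expR !complexRI !(mul0r, mulr0, subr0).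
apply: mulr_le0_ge0; first by rewrite mulr_ge0_le0 ?pi_ge0.
apply: divr_ge0; first exact: sqr_ge0.
by apply: ltW; exact: onepsqr_gt0.
Qed.

Lemma wker_integrable b x : Re b <= 0 -> cintegrable setT (wker b x).
Proof.
move=> b0; apply: cintegrable_le rintegrable_omega => //.
- by apply: cmeas_continuous => // w; exact: wker_cvg.
- by move=> w _; exact: normc_wker_le.
Qed.

Lemma cvg_tauw : tauw n.+1%:R @[n --> \oo] --> (1 : R).
Proof.
have E n : tauw n.+1%:R = (Num.sqrt (1 + (n.+1%:R)^-1 ^+ 2))^-1.
  have n0 : 0 < n.+1%:R :> R by rewrite ltr0n.
  rewrite /tauw; have -> : 1 + n.+1%:R ^+ 2 = n.+1%:R ^+ 2 * (1 + (n.+1%:R)^-1 ^+ 2) :> R.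
    by field; rewrite gt_eqF.
  rewrite sqrtrM ?sqr_ge0 // sqrtr_sqr gtr0_norm // invfM mulrA divff ?mul1r //.
rewrite (_ : (fun n => _) = fun n => (Num.sqrt (1 + (n.+1%:R)^-1 ^+ 2))^-1); last exact/funext.
suff H : Num.sqrt (1 + (n.+1%:R)^-1 ^+ 2) @[n --> \oo] --> (1 : R).
  by rewrite -[X in _ --> X]invr1; apply: cvgV H; exact: oner_neq0.
rewrite -[X in _ --> X]sqrtr1; apply: continuous_cvg; first exact: sqrt_continuous.
rewrite -[X in _ --> X]addr0; apply: cvgD; first exact: cvg_cst.
rewrite -[X in _ --> X](mulr0 (0 : R)).
by under eq_fun do rewrite expr2; apply: cvgM; exact: cvg_harmonic.
Qed.

(** Since 1/(1 + w^2) = 1 - [tauw w]^2, the integrand is the derivative of a multiple of [cerf] at x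
    sqrt(b) [tauw w], and [tauw] tends to 1 and -1 at the two ends. *)
Lemma wker_integral b x : Re b <= 0 ->
  sqrtc b * x%:C * cintegral setT (wker b x) =
  cexp (pi%:C * b * x%:C ^+ 2) * cerf (x%:C * sqrtc b).
Proof.
move=> b0; rewrite -cintegralZ //; last exact: wker_integrable.
pose k := x%:C * sqrtc b; pose K := cexp (pi%:C * b * x%:C ^+ 2).
have dk t : cder (fun t : R => k * t%:C) t (k * 1) by apply: cderZ; exact: cder_id.
have ck (t : R) : ccvg (nbhs t) (fun=> k * 1) (k * 1) by exact: ccvg_cst.
have dt w : cder (fun w => k * (tauw w)%:C) w (k * (omega w)%:C).
  by apply: cderZ; apply: cder_real; exact: is_derive_tauw.
have ct (w : R) : ccvg (nbhs w) (fun w => k * (omega w)%:C) (k * (omega w)%:C).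
  by apply: ccvgM; [exact: ccvg_cst|apply: ccvg_real; exact: continuous_omega].
have df w : cder (fun w => 2^-1 * K * cerf (k * (tauw w)%:C)) w (sqrtc b * x%:C * wker b x w).
  apply: cder_eq (cderZ _ (cder_erf w dt ct)) _.
  rewrite /wker /K.
  have -> : cexp (pi%:C * b * (x ^+ 2 / (1 + w ^+ 2))%:C) = cexp (pi%:C * b * x%:C ^+ 2) *
      cexp (- pi%:C * (k * (tauw w)%:C) ^+ 2).
    rewrite -cexpD; congr cexp.
    have -> : x ^+ 2 / (1 + w ^+ 2) = x ^+ 2 - x ^+ 2 * tauw w ^+ 2.
      by rewrite /tauw expr_div_n sqr_sqrt_onepsqr; field; rewrite gt_eqF // onepsqr_gt0.
    rewrite /k; move: (tauw w) (pi : R) => T pp; rewrite !exprMn sqr_sqrtc realcD !realcE; ring.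
  by rewrite /k; field.
apply: (gwave_FTC df).
- move=> w; apply: ccvgM; [exact: ccvg_cst|exact: wker_cvg].
- by apply: cintegrableZ => //; exact: wker_integrable.
- have tN w : tauw (- w) = - tauw w by rewrite /tauw sqrrN mulNr.
  have E n : 2^-1 * K * cerf (k * (tauw n.+1%:R)%:C) - 2^-1 * K * cerf (k * (tauw (- n.+1%:R))%:C)
     = K * cerf (k * (tauw n.+1%:R)%:C).
    by rewrite tN realcN mulrN cerfN; field.
  under eq_fun do rewrite E.
  apply: ccvgM; first exact: ccvg_cst.
  have [fr fi] := cder_cvg (cder_erf 1 dk ck).
  rewrite -[X in ccvg _ _ (cerf X)]mulr1.
  by split; [exact: (cvg_comp _ _ cvg_tauw fr)|exact: (cvg_comp _ _ cvg_tauw fi)].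
Qed.

(** The error functions of the two integrals cancel: a Gaussian with a sign becomes a superposition
    of Gaussians times the smooth factor x. *)
Lemma key_identity b x : Im b != 0 -> Re b <= 0 -> x != 0 ->
  (Num.sg x)%:C * cexp (pi%:C * b * x%:C ^+ 2) =
  cintegral `]0, +oo[ (yker b x) + sqrtc b * x%:C * cintegral setT (wker b x).
Proof. by move=> b0 b1 x0; rewrite yker_integral // wker_integral //; ring. Qed.
End WIntegral.

(** * Exchange of lattice sums and integrals *)

Section SumIntegral.
Context {R : realType}.
Local Notation mu := (@lebesgue_measure R).

Lemma normc_bsum_le C (u : int -> R[i]) N : dec C u -> normc (bsum u N) <= 8 * C.
Proof.
move=> uC; have C0 := dec_ge0 uC; apply: le_trans (normc_sum _ _ _) _.
have H (j : nat) : normc (u j%:Z + u (Negz j)) <= 2 * C * (1 + (j%:R : R) ^+ 2)^-1.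
  apply: le_trans (ler_normcD _ _) _; rewrite -mulrA mulr2n mulrDl mul1r.
  apply: lerD; first exact: uC.
  apply: le_trans (uC _) _; rewrite ler_wpM2l // lef_pV2 ?posrE ?onepsqr_gt0 // lerD2l.
  rewrite NegzE mulrNz sqrrN ler_pXn2r ?nnegrE ?ler0n //.
  by rewrite -[_.+1%:~R]/(_.+1%:R) ler_nat.
apply: le_trans (ler_sum_nat (fun j _ => H j)) _; rewrite -mulr_sumr.
have -> : 8 * C = 2 * C * 4 by ring.
by apply: ler_wpM2l; [rewrite mulr_ge0|exact: sum_inv1sqr].
Qed.

Lemma normc_cintegral_le (D : set R) (f : R -> R[i]) (h : R -> R) : measurable D -> cmeas D f ->
  (forall y, D y -> normc (f y) <= h y) -> rintegrable D h ->
  normc (cintegral D f) <= 2 * \int[mu]_(y in D) h y.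
Proof.
move=> mD [mr mi] fh ih.
have H (g : R -> R) : measurable_fun D g -> (forall y, D y -> `|g y| <= h y) ->
    `|\int[mu]_(y in D) g y| <= \int[mu]_(y in D) h y.
  move=> mg gh; have ig := rintegrable_le mD mg gh ih.
  pose proof (@le_normr_Rintegral _ _ _ mu D g mD ig) as Hg.
  apply: (le_trans Hg); apply: le_Rintegral => //.
  exact: integrable_norm.
have zE (z : R[i]) : z = (Re z)%:C + 'i * (Im z)%:C.
  apply: complex_ext; rewrite !(reD, imD, reM, imM, re_real, im_real, re_i, im_i).
    by rewrite mul0r mulr0 subrr addr0.
  by rewrite mulr0 !add0r mul1r.
rewrite [cintegral D f]zE.
apply: le_trans (ler_normcD _ _) _; rewrite normcM !normc_real.
rewrite (_ : normc 'i = 1); last by rewrite /= expr0n expr1n add0r sqrtr1.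
rewrite mul1r mulr2n mulrDl mul1r; apply: lerD; apply: H => // y Dy.
- exact: le_trans (Re_le_normc _) (fh y Dy).
- exact: le_trans (Im_le_normc _) (fh y Dy).
Qed.

(** Dominated convergence for the partial sums, which stay below 8 [h]. *)
Lemma zsum_cintegral (D : set R) (f : int -> R -> R[i]) (h : R -> R) : measurable D ->
  (forall t, cmeas D (f t)) -> (forall y, D y -> dec (h y) (f^~ y)) -> rintegrable D h ->
  fast (fun t => cintegral D (f t)) /\
  cintegrable D (fun y => zsum (f^~ y)) /\
  zsum (fun t => cintegral D (f t)) = cintegral D (fun y => zsum (f^~ y)).
Proof.
move=> mD mf fh ih.
have fK : dec (2 * \int[mu]_(y in D) h y) (fun t => cintegral D (f t)).
  move=> t; have H := normc_cintegral_le mD (mf t) (fun y Dy => fh y Dy t).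
  have ih' := rintegrableZ (1 + t%:~R ^+ 2)^-1 mD ih.
  have {}H : normc (cintegral D (f t)) <= 2 * \int[mu]_(y in D) ((1 + t%:~R ^+ 2)^-1 * h y).
    apply: (normc_cintegral_le mD (mf t)) => // y Dy; rewrite mulrC; exact: fh.
  by apply: le_trans H _; rewrite RintegralZl // mulrA mulrAC.
have fi t : cintegrable D (f t).
  apply: (cintegrable_le mD (mf t) _ ih) => y Dy; apply: le_trans (fh y Dy t) _.
  rewrite ler_pdivrMr ?onepsqr_gt0 // ler_peMr ?(dec_ge0 (fh y Dy)) //.
  by rewrite lerDl sqr_ge0.
have mb N : cmeas D (fun y => bsum (f^~ y) N).
  by apply: cmeas_sum => j; apply: cmeasD; exact: mf.
have [I1 I2] := dominated_cintegral mD mb (fun y Dy => (zsum_dec (fh y Dy)).1)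
  (fun N y Dy => normc_bsum_le N (fh y Dy)) (rintegrableZ 8 mD ih).
split; first by exists (2 * \int[mu]_(y in D) h y).
split=> //; apply: (zsum_unique fK).
rewrite (_ : bsum _ = fun N => cintegral D (fun y => bsum (f^~ y) N)) //.
apply/funext => N; rewrite /bsum cintegral_sum //; last by move=> j; exact: cintegrableD.
by apply: eq_bigr => j _; rewrite cintegralD.
Qed.

Lemma cmeas_zsum (D : set R) (f : int -> R -> R[i]) : measurable D ->
  (forall t, cmeas D (f t)) -> (forall y, D y -> fast (f^~ y)) ->
  cmeas D (fun y => zsum (f^~ y)).
Proof.
move=> mD mf ff; apply: (@cmeas_lim _ _ (fun N y => bsum (f^~ y) N)) => //.
  by move=> N; apply: cmeas_sum => j; apply: cmeasD; exact: mf.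
by move=> y Dy; apply: fast_cvg; exact: ff.
Qed.
End SumIntegral.

(** * Weighted theta series with vanishing total weight *)

Section WeightedTheta.
Context {R : realType}.
Variables (M x0 : R) (E : finType) (w : E -> R[i]) (mu : E -> R) (k : nat).
Hypothesis M0 : 0 < M.
Hypothesis x00 : 0 < x0.
Hypothesis latx0 : forall e (t : int), x0 <= `|M * t%:~R + mu e|.
Hypothesis w0 : \sum_e w e = 0.
Implicit Types (c : R[i]) (x y : R).

(** The finite combination over [e] is formed inside each index t, so that one decay bound covers
    it. *)
Definition wavg (g : R -> R[i]) (t : int) : R[i] := \sum_e w e * g (M * t%:~R + mu e).

Lemma wavgB g1 g2 t : wavg g1 t - wavg g2 t = wavg (fun x => g1 x - g2 x) t.
Proof. by rewrite /wavg -sumrB; apply: eq_bigr => e _; rewrite mulrBr. Qed.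

Lemma wavgZ g d t : wavg (fun x => d * g x) t = d * wavg g t.
Proof. by rewrite /wavg mulr_sumr; apply: eq_bigr => e _; ring. Qed.

Lemma wavg_dec : exists2 A, 0 <= A & forall g K,
  (forall x, x0 <= `|x| -> normc (g x) <= K / (1 + x ^+ 2)) -> dec (A * K) (wavg g).
Proof.
have H e : exists2 A : R, 0 <= A & forall t x, x = M * t + mu e -> (1 + x ^+ 2)^-1 <= A / (1 + t ^+ 2).
  exact: onepsqr_affine.
pose A e := sval (cid2 (H e)).
have A0 e : 0 <= A e by rewrite /A; case: cid2.
have HA e t : (1 + (M * t + mu e) ^+ 2)^-1 <= A e / (1 + t ^+ 2).
  by rewrite /A; case: cid2 => z _ /= /(_ t); apply.
exists (\sum_e normc (w e) * A e); first by rewrite sumr_ge0 // => e _; rewrite mulr_ge0 ?normc_ge0.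
move=> g K gK t; apply: le_trans (normc_sum _ _ _) _; rewrite !mulr_suml.
apply: ler_sum => e _; rewrite normcM -!mulrA ler_wpM2l ?normc_ge0 //.
have H1 := gK _ (latx0 e t).
have K0 : 0 <= K.
  have := le_trans (normc_ge0 _) H1; rewrite pmulr_lge0 // invr_gt0; exact: onepsqr_gt0.
apply: le_trans H1 _; rewrite mulrCA ler_wpM2l //; exact: HA.
Qed.

Lemma wavg_gterm_fast j c : 0 < Re c -> fast (wavg (gterm j c)).
Proof.
move=> c0; have [A _ HA] := wavg_dec; have [C HC] := gterm_le j c0.
by exists (A * C); apply: HA => x _; exact: HC.
Qed.

Definition Th c : R[i] := zsum (wavg (gterm k.+1 c)).

Definition wdual c (m : int) : R[i] := \sum_e w e * gdual M (mu e) k.+1 c m%:~R.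

Lemma Th_dual c : 0 < Re c -> Th c = zsum (wdual c).
Proof.
move=> c0; rewrite /Th /wavg /wdual !zsum_sum; first last.
- by move=> e; apply: fastZ; exact: gterm_fast.
- by move=> e; apply: fastZ; exact: gdual_fast.
have H e : zsum (fun t => w e * gterm k.+1 c (M * t%:~R + mu e)) =
    zsum (fun m => w e * gdual M (mu e) k.+1 c m%:~R).
  rewrite !zsumZ ?theta_inversion //; first exact: gdual_fast.
  exact: gterm_fast.
by under eq_bigr do rewrite H.
Qed.

(* The zero frequency does not see the translations [mu e]. *)
Lemma wdual0 c : wdual c 0 = 0.
Proof.
transitivity ((\sum_e w e) * gdual M 0 k.+1 c 0); last by rewrite w0 mul0r.
by rewrite mulr_suml; apply: eq_bigr => e _; rewrite /gdual /gdual0 !(mulr0, mul0r).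
Qed.

(** The frequency 0 drops out by [wdual0], and [gdual_le] covers all others uniformly as c tends to
    0 in a sector. *)
Lemma wdual_le (q B : R) : 0 < q -> 0 < B -> exists2 C, 0 <= C & forall c,
  c != 0 -> q * normc c <= Re c -> normc c <= B -> dec C (wdual c).
Proof.
move=> q0 B0; have H e : exists C : R, forall c (m : int), c != 0 -> q * normc c <= Re c ->
    normc c <= B -> m != 0 -> normc (gdual M (mu e) k.+1 c m%:~R) <= C / (1 + m%:~R ^+ 2).
  exact: gdual_le.
pose A e := sval (cid (H e)); pose C := \sum_e normc (w e) * `|A e|.
have C0 : 0 <= C by rewrite sumr_ge0 // => e _; rewrite mulr_ge0 ?normc_ge0.
exists C => // c c0 qc cB m; have [->|m0] := eqVneq m 0.
  by rewrite wdual0 normc0 expr0n addr0 divr1.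
apply: le_trans (normc_sum _ _ _) _; rewrite mulr_suml.
apply: ler_sum => e _; rewrite normcM -mulrA ler_wpM2l ?normc_ge0 //.
have : normc (gdual M (mu e) k.+1 c m%:~R) <= A e / (1 + m%:~R ^+ 2).
  by rewrite /A; case: cid => z Hz /=; exact: Hz.
move=> H1; apply: le_trans H1 _; rewrite ler_wpM2r ?ler_norm //.
by rewrite invr_ge0 ltW // onepsqr_gt0.
Qed.

Lemma Re_gt0_sector (q : R) c : 0 < q -> c != 0 -> q * normc c <= Re c -> 0 < Re c.
Proof. by move=> q0 c0; apply: lt_le_trans; rewrite mulr_gt0 // normc_gt0. Qed.

Lemma Th_sector (q B : R) : 0 < q -> 0 < B -> exists C, forall c,
  c != 0 -> q * normc c <= Re c -> normc c <= B -> normc (Th c) <= C.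
Proof.
move=> q0 B0; have [C _ HC] := wdual_le q0 B0; exists (8 * C) => c c0 qc cB.
by rewrite Th_dual ?(Re_gt0_sector q0 c0) //; exact: (zsum_dec (HC _ c0 qc cB)).2.
Qed.

(** The exponential rate forced by the distance [x0] of the lattice points from the origin. *)
Definition kap := pi * x0 ^+ 2.

Lemma kap_gt0 : 0 < kap.
Proof. by rewrite mulr_gt0 ?pi_gt0 ?exprn_gt0. Qed.

(** The part q of the parameter pays for the quadratic decay in x; the part y is left to give the
    exponential. *)
Lemma gterm_shift_le j (q : R) : 0 < q -> exists C, forall y x, 0 <= y -> x0 <= `|x| ->
  normc (gterm j (y + q)%:C x) <= C * expR (- (kap * y)) / (1 + x ^+ 2).
Proof.
move=> q0; have [C HC] := gterm_le j q0.
exists C => y x y0 xx; have H := HC q%:C x (lexx _).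
rewrite mulrAC; apply: le_trans (_ : _ <= normc (gterm j q%:C x) * expR (- (kap * y))) _.
  rewrite !normc_gterm -mulrA -expRD ler_wpM2l ?exprn_ge0 // ler_expR !re_real.
  have x2 : x0 ^+ 2 <= x ^+ 2.
    by rewrite -(real_normK (num_real x)) lerXn2r ?nnegrE ?normr_ge0 // ltW.
  rewrite /kap -subr_ge0.
  have -> : - (pi * q) * x ^+ 2 - pi * x0 ^+ 2 * y - - (pi * (y + q)) * x ^+ 2 =
    pi * y * (x ^+ 2 - x0 ^+ 2) by ring.
  by rewrite mulr_ge0 ?subr_ge0 // mulr_ge0 // pi_ge0.
by rewrite ler_wpM2r ?expR_ge0.
Qed.

(** For y <= 1 the bound comes from the dual series, for y > 1 from the lattice series with y = (y -
    1) + 1. *)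
Lemma Th_decay : exists2 C, 0 <= C & forall y, 0 < y -> normc (Th y%:C) <= C * expR (- (kap * y)).
Proof.
have [C HC] := @Th_sector 1 1 ltr01 ltr01.
have [D HD] := gterm_shift_le k.+1 (@ltr01 R).
have [A A0 HA] := wavg_dec.
pose B := `|8 * (A * (D * expR kap))| + `|C * expR kap|.
exists B => [|y y0]; first by rewrite addr_ge0.
have [y1|y1] := leP y 1.
  apply: le_trans (_ : _ <= C) _.
    apply: HC; first by rewrite realc_neq0 gt_eqF.
      by rewrite mul1r normc_real gtr0_norm.
    by rewrite normc_real gtr0_norm.
  rewrite expRN ler_pdivlMr ?expR_gt0 //.
  apply: le_trans (_ : _ <= `|C| * expR kap) _.
    apply: le_trans (ler_wpM2r (expR_ge0 _) (ler_norm C)) _.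
    by rewrite ler_wpM2l // ler_expR ger_pMr ?kap_gt0.
  by rewrite /B [`|C * _|]normrM [`|expR _|]ger0_norm ?expR_ge0 // lerDr.
have yE : y = (y - 1) + 1 by rewrite subrK.
have d : dec (A * (D * expR (- (kap * (y - 1))))) (wavg (gterm k.+1 y%:C)).
  apply: HA => x xx; rewrite {1}yE; apply: HD => //; lra.
apply: le_trans (zsum_dec d).2 _.
have -> : - (kap * (y - 1)) = kap + - (kap * y) by ring.
rewrite expRD !mulrA ler_wpM2r ?expR_ge0 //.
by rewrite /B -!mulrA; apply: le_trans (ler_norm _) _; rewrite lerDl.
Qed.

Lemma Re_lt0_neq0 c : 0 < Re c -> c != 0.
Proof. by move=> H; apply/eqP => c0; rewrite c0 ltxx in H. Qed.

(** 1 - exp(-s) <= s with s = pi d x^2, which raises the degree by two. *)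
Lemma gterm_lip j c (d x : R) : 0 <= d ->
  normc (gterm j (c + d%:C) x - gterm j c x) <= pi * d * normc (gterm j.+2 c x).
Proof.
move=> d0.
have -> : gterm j (c + d%:C) x - gterm j c x = gterm j c x * (expR (- (pi * d * x ^+ 2)) - 1)%:C.
  rewrite realcD mulrDr {1}/gterm; rewrite -cexp_real.
  have -> : cexp (- pi%:C * (c + d%:C) * (x ^+ 2)%:C) = cexp (- pi%:C * c * (x ^+ 2)%:C) * cexp (- (pi * d * x ^+ 2))%:C.
    by rewrite -cexpD; congr cexp; move: (pi : R) => pp; rewrite !realcE; ring.
  by rewrite [(- 1)%:C]realcN -[1%:C]/(1 : R[i]) /gterm; ring.
rewrite normcM normc_real !normc_gterm.
rewrite [`|expR _ - 1|]ler0_norm; last by rewrite subr_le0 -[leRHS]expR0 ler_expR oppr_le0 mulr_ge0 ?sqr_ge0 // mulr_ge0 ?pi_ge0.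
rewrite opprB -[j.+2]addn2 exprD real_normK ?num_real //.
have e0 := expR_ge0 (- (pi * Re c) * x ^+ 2).
have n0 : 0 <= `|x| ^+ j by rewrite exprn_ge0.
have H : 1 - expR (- (pi * d * x ^+ 2)) <= pi * d * x ^+ 2.
  by have := expR_ge1Dx (- (pi * d * x ^+ 2)); lra.
have := ler_wpM2l (mulr_ge0 n0 e0) H; move/le_trans; apply.
by rewrite le_eqVlt; apply/orP; left; apply/eqP; ring.
Qed.

Lemma zsumB (u v : int -> R[i]) : fast u -> fast v -> zsum (fun t => u t - v t) = zsum u - zsum v.
Proof.
move=> fu fv; have <- : zsum (fun t => -1 * v t) = - zsum v by rewrite zsumZ // mulN1r.
rewrite -zsumD //; last exact: fastZ.
by congr zsum; apply/funext => t; rewrite mulN1r.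
Qed.

(* [h] is 1 or the sign function. *)
Lemma zsum_gterm_lip (h : R -> R[i]) j c : 0 < Re c -> (forall x, normc (h x) <= 1) ->
  exists C, forall d, 0 <= d ->
  normc (zsum (wavg (fun x => h x * gterm j (c + d%:C) x)) -
         zsum (wavg (fun x => h x * gterm j c x))) <= d * C.
Proof.
move=> c0 h1; have [C HC] := gterm_le j.+2 c0; have [C0 HC0] := gterm_le j c0.
have [A A0 HA] := wavg_dec; exists (8 * (A * (pi * C))) => d d0.
have hle (z : R[i]) x : normc (h x * z) <= normc z by rewrite normcM ler_piMl ?normc_ge0.
have fj (c' : R[i]) : Re c <= Re c' -> fast (wavg (fun x => h x * gterm j c' x)).
  by move=> cc; exists (A * C0); apply: HA => x _; apply: le_trans (hle _ _) _; exact: HC0.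
rewrite -zsumB; [|apply: fj; rewrite reD re_real; lra|exact: fj].
under eq_fun do rewrite wavgB.
have d' : dec (A * (pi * d * C)) (wavg (fun x => h x * gterm j (c + d%:C) x - h x * gterm j c x)).
  apply: HA => x _; rewrite -mulrBr; apply: le_trans (hle _ _) _; apply: le_trans (gterm_lip _ _ _ d0) _.
  by rewrite -!mulrA ler_wpM2l ?pi_ge0 // ler_wpM2l //; exact: HC.
apply: le_trans (zsum_dec d').2 _.
by rewrite le_eqVlt; apply/orP; left; apply/eqP; ring.
Qed.

Lemma cvg_lip_harmonic (F : R -> R[i]) l C : (forall d, 0 <= d -> normc (F d - l) <= d * C) ->
  ccvg \oo (fun n => F n.+1%:R^-1) l.
Proof.
move=> H; apply: (@ccvg_norm _ _ _ _ _ _ (fun n => n.+1%:R^-1 * C)).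
  by apply: nearW => n; apply: H; rewrite invr_ge0.
by rewrite -[X in _ --> X](mul0r C); apply: cvgM; [exact: cvg_harmonic|exact: cvg_cst].
Qed.

Lemma Th_cvg c : 0 < Re c -> ccvg \oo (fun n => Th (c + (n.+1%:R^-1)%:C)) (Th c).
Proof.
move=> c0; have h1 (x : R) : normc (1 : R[i]) <= 1 by rewrite normc1.
have [C HC] := @zsum_gterm_lip (fun=> 1) k.+1 c c0 h1.
apply: (@cvg_lip_harmonic (fun d => Th (c + d%:C)) _ C) => d d0.
have E1 c' : (fun x => 1 * gterm k.+1 c' x) = gterm k.+1 c' by apply/funext => x; rewrite mul1r.
by have := HC d d0; rewrite !E1.
Qed.

(** The key identity multiplied by x^k exp(-pi d x^2); one power of x moves into the theta term,
    whence the degree k + 1. *)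
Lemma sgn_gtermE b (d x : R) : Im b != 0 -> Re b <= 0 -> x != 0 ->
  (Num.sg x)%:C * gterm k (- b + d%:C) x =
  cintegral `]0, +oo[ (fun y => gterm k.+1 (y + d)%:C x / rsqrt b y) +
  sqrtc b * cintegral setT (fun v => (omega v)%:C * gterm k.+1 (- b * ((1 + v ^+ 2)^-1)%:C + d%:C) x).
Proof.
move=> b0 b1 x1; pose e := (x ^+ k)%:C * cexp (- (pi * d * x ^+ 2)%:C).
have gE c : gterm k (c + d%:C) x = e * cexp (- pi%:C * c * x%:C ^+ 2).
  have E1 : cexp (- pi%:C * (c + d%:C) * (x ^+ 2)%:C) =
      cexp (- (pi * d * x ^+ 2)%:C) * cexp (- pi%:C * c * x%:C ^+ 2).
    by rewrite -cexpD; congr cexp; move: (pi : R) => pp; rewrite !realcE; ring.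
  by rewrite /gterm /e E1 mulrA.
rewrite (_ : (Num.sg x)%:C * _ = e * ((Num.sg x)%:C * cexp (pi%:C * b * x%:C ^+ 2))); last first.
  by rewrite gE mulrCA; congr (_ * (_ * cexp _)); ring.
rewrite key_identity // mulrDr; congr (_ + _).
  rewrite -cintegralZ //; last exact: yker_integrable.
  apply: eq_cintegral => y _; rewrite /yker /gterm /e mulrA; congr (_ / _).
  have -> : cexp (- pi%:C * (y + d)%:C * (x ^+ 2)%:C) =
      cexp (- (pi * x ^+ 2 * y)%:C) * cexp (- (pi * d * x ^+ 2)%:C).
    by rewrite -cexpD; congr cexp; move: (pi : R) => pp; rewrite realcD !realcE; ring.
  rewrite [x ^+ k.+1]exprSr [(x ^+ k * x)%:C]realcM.
  move: (cexp _) (cexp _) (x ^+ k)%:C => u v z; ring.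
transitivity (sqrtc b * ((e * x%:C) * cintegral setT (wker b x))); first by ring.
congr (_ * _); rewrite -cintegralZ //; last exact: wker_integrable.
apply: eq_cintegral => v _; rewrite /wker /gterm /e.
have -> : cexp (- pi%:C * (- b * ((1 + v ^+ 2)^-1)%:C + d%:C) * (x ^+ 2)%:C) =
    cexp (- (pi * d * x ^+ 2)%:C) * cexp (pi%:C * b * (x ^+ 2 / (1 + v ^+ 2))%:C).
  by rewrite -cexpD; congr cexp; move: (pi : R) => pp; rewrite !realcE; ring.
rewrite [x ^+ k.+1]exprSr [(x ^+ k * x)%:C]realcM.
move: (cexp _) (cexp _) (x ^+ k)%:C (omega v)%:C => u v' z o; ring.
Qed.

Lemma cmeas_gterm D j (F : R -> R[i]) x : cmeas D F -> cmeas D (fun y => gterm j (F y) x).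
Proof.
move=> mF; apply: cmeasM; first exact: cmeas_cst.
by apply: cmeas_cexp; apply: cmeasM; [apply: cmeasM => //|]; exact: cmeas_cst.
Qed.

Lemma cmeas_wavg D (F : R -> R -> R[i]) t : (forall x, cmeas D (fun y => F y x)) ->
  cmeas D (fun y => wavg (F y) t).
Proof. by move=> mF; apply: cmeas_sum => e; apply: cmeasM; [exact: cmeas_cst|exact: mF]. Qed.
End WeightedTheta.

(** * False theta series as integrals of theta series *)

Section ThetaSplit.
Context {R : realType}.
Variables (M x0 : R) (E : finType) (w : E -> R[i]) (mu : E -> R) (k : nat).
Hypothesis M0 : 0 < M.
Hypothesis x00 : 0 < x0.
Hypothesis latx0 : forall e (t : int), x0 <= `|M * t%:~R + mu e|.
Hypothesis w0 : \sum_e w e = 0.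
Variable b : R[i].
Hypothesis b0 : Im b != 0.
Hypothesis b1 : Re b < 0.
Implicit Types (c : R[i]) (x y d v : R).
Local Notation Th := (Th M w mu k).
Local Notation wavg := (wavg M w mu).

(** As |v| grows, this runs from -b to 0 along a ray, hence inside one sector. *)
Definition cw v : R[i] := - b * ((1 + v ^+ 2)^-1)%:C.

Lemma Re_cw v : Re (cw v) = - Re b * (1 + v ^+ 2)^-1.
Proof. by rewrite /cw !complexRI mulr0 subr0. Qed.

Lemma Re_cw_gt0 v : 0 < Re (cw v).
Proof. by rewrite Re_cw mulr_gt0 ?oppr_gt0 // invr_gt0 onepsqr_gt0. Qed.

Lemma b_neq0 : b != 0.
Proof. by apply: contraTneq b1 => ->; rewrite ltxx. Qed.

Lemma normc_b_gt0 : 0 < normc b.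
Proof. by rewrite normc_gt0 b_neq0. Qed.

(** The cosine of the argument of -b, which measures that sector. *)
Definition qb := - Re b / normc b.

Lemma qb_gt0 : 0 < qb.
Proof. by rewrite divr_gt0 ?oppr_gt0 ?normc_b_gt0. Qed.

Lemma qb_le1 : qb <= 1.
Proof.
rewrite ler_pdivrMr ?normc_b_gt0 // mul1r -ltr0_norm //; exact: Re_le_normc.
Qed.

Lemma normc_cw v : normc (cw v) = normc b * (1 + v ^+ 2)^-1.
Proof. by rewrite /cw normcM normc_opp normc_real gtr0_norm // invr_gt0 onepsqr_gt0. Qed.

Lemma inv1sqr_le1 v : (1 + v ^+ 2)^-1 <= 1.
Proof. by rewrite invf_le1 ?onepsqr_gt0 // lerDl sqr_ge0. Qed.

Lemma cw_sector v d : 0 <= d -> [/\ cw v + d%:C != 0, qb * normc (cw v + d%:C) <= Re (cw v + d%:C)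
  & normc (cw v + d%:C) <= normc b + d].
Proof.
move=> d0; have i0 : 0 < (1 + v ^+ 2)^-1 by rewrite invr_gt0 onepsqr_gt0.
have n1 : normc (cw v + d%:C) <= normc (cw v) + d.
  by apply: le_trans (ler_normcD _ _) _; rewrite normc_real ger0_norm.
split.
- by apply: Re_lt0_neq0; rewrite reD re_real ltr_pwDl // Re_cw_gt0.
- apply: le_trans (ler_wpM2l (ltW qb_gt0) n1) _; rewrite mulrDr reD re_real Re_cw normc_cw.
  apply: lerD; last by rewrite ler_piMl // qb_le1.
  by rewrite /qb mulrA divfK // gt_eqF // normc_b_gt0.
- apply: le_trans n1 _; rewrite lerD2r normc_cw ler_piMr ?normc_ge0 //; exact: inv1sqr_le1.
Qed.

Lemma cmeas_cw D d : measurable D -> cmeas D (fun v => cw v + d%:C).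
Proof.
move=> mD; apply: cmeasD; last exact: cmeas_cst.
apply: cmeasM; first exact: cmeas_cst.
apply: cmeas_real; apply: measurable_funTS; apply: continuous_measurable_fun.
exact: continuous_oneDsqrV.
Qed.

Lemma cmeas_omega D : measurable D -> cmeas D (fun v : R => (omega v)%:C).
Proof.
move=> mD; apply: cmeas_real; apply: measurable_funTS; apply: continuous_measurable_fun.
exact: continuous_omega.
Qed.

Lemma cmeas_realc (D : set R) d : cmeas D (fun y : R => (y + d)%:C).
Proof. by apply: cmeas_real; exact: measurable_funD. Qed.

Lemma cmeas_rsqrtV D : measurable D -> cmeas D (fun y => (rsqrt b y)^-1).
Proof.
move=> mD; apply: cmeas_continuous => // y.
by apply: ccvg_inv; [exact: rsqrt_neq0|exact: rsqrt_cvg].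
Qed.

Lemma normc_div_rsqrt z y : normc (z / rsqrt b y) <= normc z / Num.sqrt `|Im b|.
Proof.
rewrite !normcE ler_wpM2l ?normc_ge0 // lef_pV2 ?posrE ?sqrt_Im_gt0 ?normc_rsqrt_ge //.
by rewrite normc_gt0 rsqrt_neq0.
Qed.

Lemma sgn_normc_le x : normc (Num.sg x)%:C <= 1.
Proof. by rewrite normc_real normr_sg; case: (_ != 0). Qed.

(** With d > 0 all parameters have real part at least d, so the lattice terms are dominated,
    uniformly in their quadratic decay, by integrable functions of y and v; sum and integral
    commute. *)
Lemma theta_split_pos d : 0 < d ->
  [/\ cintegrable `]0, +oo[ (fun y => Th (y + d)%:C / rsqrt b y),
      cintegrable setT (fun v => (omega v)%:C * Th (cw v + d%:C)) &
  zsum (wavg (fun x => (Num.sg x)%:C * gterm k (- b + d%:C) x)) =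
  cintegral `]0, +oo[ (fun y => Th (y + d)%:C / rsqrt b y) +
  sqrtc b * cintegral setT (fun v => (omega v)%:C * Th (cw v + d%:C))].
Proof.
move=> d0; have [A A0 HA] := wavg_dec w M0 latx0.
have [C1 HC1] := gterm_shift_le x00 k.+1 d0; have [C2 HC2] := gterm_le k.+1 d0.
pose s := Num.sqrt `|Im b|; have s0 : 0 < s by exact: sqrt_Im_gt0.
have k0 := kap_gt0 x00.
pose D : set R := `]0, +oo[%classic.
have mD : measurable D by exact: measurable_itv.
pose F1 t y := wavg (fun x => gterm k.+1 (y + d)%:C x / rsqrt b y) t.
pose F2 t v := wavg (fun x => (omega v)%:C * gterm k.+1 (cw v + d%:C) x) t.
have m1 x : cmeas D (fun y => gterm k.+1 (y + d)%:C x / rsqrt b y).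
  by apply: cmeasM; [apply: cmeas_gterm; exact: cmeas_realc|exact: cmeas_rsqrtV].
have m2 x : cmeas setT (fun v => (omega v)%:C * gterm k.+1 (cw v + d%:C) x).
  by apply: cmeasM; [exact: cmeas_omega|apply: cmeas_gterm; exact: cmeas_cw].
have B1 y x : D y -> x0 <= `|x| -> normc (gterm k.+1 (y + d)%:C x / rsqrt b y) <=
    C1 * expR (- (kap x0 * y)) / s / (1 + x ^+ 2).
  rewrite /D /= in_itv /= andbT => /ltW y0 xx.
  apply: le_trans (normc_div_rsqrt _ _) _; rewrite -/s mulrAC ler_wpM2r ?invr_ge0 ?(ltW s0) //.
  exact: HC1.
have B2 v x : normc ((omega v)%:C * gterm k.+1 (cw v + d%:C) x) <= C2 * omega v / (1 + x ^+ 2).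
  rewrite normcM normc_real (ger0_norm (omega_ge0 _)) mulrC mulrAC ler_wpM2r ?omega_ge0 //.
  by apply: HC2; rewrite reD re_real lerDr ltW // Re_cw_gt0.
have I1 : rintegrable D (fun y => C1 * expR (- (kap x0 * y)) / s).
  have -> : (fun y => C1 * expR (- (kap x0 * y)) / s) = fun y => C1 / s * expR (- (kap x0 * y)).
    by apply/funext => y; rewrite mulrAC.
  by apply: rintegrableZ; [exact: measurable_itv|exact: rintegrable_expR].
have I2 : rintegrable setT (fun v : R => C2 * omega v).
  by apply: rintegrableZ => //; exact: rintegrable_omega.
have d1 y : D y -> dec (A * (C1 * expR (- (kap x0 * y)) / s)) (F1^~ y).
  by move=> Dy; apply: HA => x xx; exact: B1.
have d2 v : setT v -> dec (A * (C2 * omega v)) (F2^~ v).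
  by move=> _; apply: HA => x xx; exact: B2.
have [f1 [i1 E1]] := zsum_cintegral mD (fun t => cmeas_wavg M w mu t m1) d1 (rintegrableZ A mD I1).
have [f2 [i2 E2]] := zsum_cintegral measurableT (fun t => cmeas_wavg M w mu t m2) d2
  (rintegrableZ A measurableT I2).
have T1 y : D y -> zsum (F1^~ y) = Th (y + d)%:C / rsqrt b y.
  rewrite /D /= in_itv /= andbT => y0.
  rewrite mulrC -zsumZ; last by apply: (wavg_gterm_fast w M0 latx0); rewrite re_real addr_gt0.
  by congr zsum; apply/funext => t; rewrite -wavgZ /F1; under eq_fun do rewrite mulrC.
have T2 v : zsum (F2^~ v) = (omega v)%:C * Th (cw v + d%:C).
  rewrite -zsumZ; last by apply: (wavg_gterm_fast w M0 latx0); rewrite reD re_real addr_gt0 // Re_cw_gt0.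
  by congr zsum; apply/funext => t; rewrite -wavgZ.
have G1 x : x0 <= `|x| -> cintegrable D (fun y => gterm k.+1 (y + d)%:C x / rsqrt b y).
  move=> xx; apply: (cintegrable_le mD (m1 x) _ I1) => y Dy; apply: le_trans (B1 _ _ Dy xx) _.
  rewrite ler_pdivrMr ?onepsqr_gt0 // ler_peMr ?lerDl ?sqr_ge0 //.
  by have := le_trans (normc_ge0 _) (B1 _ _ Dy xx); rewrite pmulr_lge0 // invr_gt0 onepsqr_gt0.
have G2 x : cintegrable setT (fun v => (omega v)%:C * gterm k.+1 (cw v + d%:C) x).
  apply: (cintegrable_le measurableT (m2 x) _ I2) => v _; apply: le_trans (B2 _ _) _.
  rewrite ler_pdivrMr ?onepsqr_gt0 // ler_peMr ?lerDl ?sqr_ge0 //.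
  by have := le_trans (normc_ge0 _) (B2 v x); rewrite pmulr_lge0 // invr_gt0 onepsqr_gt0.
split; first exact: eq_cintegrable i1.
  by apply: eq_cintegrable i2 => // v _; exact: T2.
rewrite -(eq_cintegral T1) -(eq_cintegral (fun v _ => T2 v)) -E1 -E2 -zsumZ // -zsumD //; last exact: fastZ.
congr zsum; apply/funext => t; rewrite /F1 /F2 /wavg.
rewrite (cintegral_sum _ mD) => [|e]; last by apply: cintegrableZ => //; exact: G1.
rewrite (cintegral_sum _ measurableT) => [|e]; last by apply: cintegrableZ => //; exact: G2.
rewrite mulr_sumr -big_split /=; apply: eq_bigr => e _.
rewrite !cintegralZ //; last exact: G1.
rewrite sgn_gtermE //; first by ring.
- exact: ltW.
- by have := latx0 e t; apply: contraTneq => ->; rewrite normr0 -ltNge.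
Qed.

(** The termwise bounds degenerate as d tends to 0. The dominating functions come instead from
    [Th_decay] and [Th_sector], that is, from the cancellation in the dual series. *)
Theorem theta_split :
  [/\ cintegrable `]0, +oo[ (fun y => Th y%:C / rsqrt b y),
      cintegrable setT (fun v => (omega v)%:C * Th (cw v)) &
  zsum (wavg (fun x => (Num.sg x)%:C * gterm k (- b) x)) =
  cintegral `]0, +oo[ (fun y => Th y%:C / rsqrt b y) +
  sqrtc b * cintegral setT (fun v => (omega v)%:C * Th (cw v))].
Proof.
pose D : set R := `]0, +oo[%classic; have mD : measurable D by exact: measurable_itv.
have hn (n : nat) : 0 < n.+1%:R^-1 :> R by rewrite invr_gt0 ltr0n.
pose s := Num.sqrt `|Im b|; have s0 : 0 < s by exact: sqrt_Im_gt0.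
have [C C0 HC] := Th_decay k M0 x00 latx0 w0.
have [C' HC'] := @Th_sector R M E w mu k M0 w0 qb (normc b + 1) qb_gt0 (ltr_wpDl (normc_ge0 b) ltr01).
have J1 : rintegrable D (fun y => C / s * expR (- (kap x0 * y))).
  by apply: rintegrableZ => //; apply: rintegrable_expR; exact: kap_gt0.
have J2 : rintegrable setT (fun v : R => C' * omega v).
  by apply: rintegrableZ => //; exact: rintegrable_omega.
have [i1 c1] : cintegrable D (fun y => Th y%:C / rsqrt b y) /\
    ccvg \oo (fun n => cintegral D (fun y => Th (y + n.+1%:R^-1)%:C / rsqrt b y))
      (cintegral D (fun y => Th y%:C / rsqrt b y)).
  apply: (dominated_cintegral mD _ _ _ J1).
  (* Measurability is read off from the integrability obtained with d = 1/(n + 1). *)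
  - move=> n; have [[mr mi] _ _] := theta_split_pos (hn n).
    by split; apply/measurable_EFinP; [exact: measurable_int mr|exact: measurable_int mi].
  - move=> y; rewrite /D /= in_itv /= andbT => y0.
    apply: ccvgM; last exact: ccvg_cst.
    have := @Th_cvg R M x0 E w mu k M0 latx0 y%:C y0.
    by under eq_fun do rewrite -realcD.
  - move=> n y; rewrite /D /= in_itv /= andbT => y0.
    apply: le_trans (normc_div_rsqrt _ _) _; rewrite -/s mulrAC ler_wpM2r ?invr_ge0 ?(ltW s0) //.
    apply: le_trans (HC _ (addr_gt0 y0 (hn n))) _; rewrite ler_wpM2l // ler_expR lerN2.
    by rewrite ler_wpM2l ?(ltW (kap_gt0 x00)) // lerDl ltW.
have [i2 c2] : cintegrable setT (fun v => (omega v)%:C * Th (cw v)) /\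
    ccvg \oo (fun n => cintegral setT (fun v => (omega v)%:C * Th (cw v + (n.+1%:R^-1)%:C)))
      (cintegral setT (fun v => (omega v)%:C * Th (cw v))).
  apply: (dominated_cintegral measurableT _ _ _ J2).
  - move=> n; have [_ [mr mi] _] := theta_split_pos (hn n).
    by split; apply/measurable_EFinP; [exact: measurable_int mr|exact: measurable_int mi].
  - move=> v _; apply: ccvgM; first exact: ccvg_cst.
    by apply: Th_cvg => //; exact: Re_cw_gt0.
  - move=> n v _; rewrite normcM normc_real (ger0_norm (omega_ge0 _)) mulrC ler_wpM2r ?omega_ge0 //.
    have [H1 H2 H3] := cw_sector v (ltW (hn n)); apply: HC' => //.
    by apply: le_trans H3 _; rewrite lerD2l invf_le1 ?ltr0n // ler1n.
split=> //.
have rb : 0 < Re (- b) by rewrite reN oppr_gt0.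
have [L HL] := @zsum_gterm_lip R M x0 E w mu M0 latx0 (fun x => (Num.sg x)%:C) k (- b) rb sgn_normc_le.
have H0 := cvg_lip_harmonic HL.
apply: ccvg_unique H0 _.
have -> : (fun n : nat => zsum (wavg (fun x => (Num.sg x)%:C * gterm k (- b + (n.+1%:R^-1)%:C) x))) =
  (fun n => cintegral D (fun y => Th (y + n.+1%:R^-1)%:C / rsqrt b y) +
  sqrtc b * cintegral setT (fun v => (omega v)%:C * Th (cw v + (n.+1%:R^-1)%:C))).
  by apply/funext => n; have [_ _ ->] := theta_split_pos (hn n).
by apply: ccvgD => //; apply: ccvgM => //; exact: ccvg_cst.
Qed.
End ThetaSplit.

(** * The integral of one dual term *)

Section DualIntegral.
Context {R : realType}.
Variables (a : R[i]) (xi : R).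
Hypothesis a0 : 0 < Re a.
Hypothesis xi0 : xi != 0.
Implicit Types v : R.
Local Notation psi v := ((1 + v ^+ 2)%:C : R[i]).
Local Notation psiV v := (((1 + v ^+ 2)^-1)%:C : R[i]).
Local Notation Q j v := (hermq xi%:C (a * psi v) j).
Local Notation ex v := (cexp (- pi%:C * a * (xi ^+ 2)%:C * psi v)).

Lemma psi_neq0 v : psi v != 0.
Proof. by rewrite realc_neq0 gt_eqF // onepsqr_gt0. Qed.

Lemma psiVE v : psiV v = (psi v)^-1.
Proof. exact: realcV. Qed.

Lemma cder_psi v : cder (fun v => psi v) v (2 * v%:C).
Proof.
have H : is_derive v 1 (fun t : R => 1 + t ^+ 2) (2 * v).
  apply: (is_derive_eq (is_derive_add (is_derive_const 1 v) (is_deriveX 2 (is_derive_id v 1)))).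
  by rewrite add0r /= expr1 /GRing.scale /= mulr1.
by apply: cder_eq (cder_real H) _; rewrite realcM realc_nat.
Qed.

Lemma cder_hermq j v : cder (fun v => Q j v) v
  (v%:C * j%:R * (Q j v / psi v - 'i * a * xi%:C * Q j.-1 v)).
Proof.
pose S j := forall v, cder (fun v => Q j v) v
  (v%:C * j%:R * (Q j v / psi v - 'i * a * xi%:C * Q j.-1 v)).
suff : S j /\ S j.+1 by case=> H _; exact: H.
elim: j => [|j [IH1 IH2]].
  split=> t.
    by apply: cder_eq (cder_cst 1 t) _; rewrite mulr0 mul0r.
  rewrite (_ : (fun v => _) = fun v => - 'i * xi%:C * a * psi v); last first.
    by apply/funext => s /=; ring.
  apply: cder_eq (cderZ _ (cder_psi t)) _; rewrite [Q _ _]/= [Q _ _]/=.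
  by move: (psi t) (psi_neq0 t) => s s0; field.
split=> // t.
have -> : (fun v => Q j.+2 v) = fun v => a * psi v * (j.+1%:R / (2 * pi%:C) * Q j v - 'i * xi%:C * Q j.+1 v).
  by apply/funext => s; rewrite hermqS.
have d1 := cderZ a (cder_psi t).
have d2 : cder (fun v => j.+1%:R / (2 * pi%:C) * Q j v - 'i * xi%:C * Q j.+1 v) t
  (j.+1%:R / (2 * pi%:C) * (t%:C * j%:R * (Q j t / psi t - 'i * a * xi%:C * Q j.-1 t)) +
   - 'i * xi%:C * (t%:C * j.+1%:R * (Q j.+1 t / psi t - 'i * a * xi%:C * Q j t))).
  rewrite (_ : (fun v => _) = fun v => j.+1%:R / (2 * pi%:C) * Q j v + - 'i * xi%:C * Q j.+1 v).
    by apply: cderD; apply: cderZ; [exact: IH1|exact: IH2].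
  by apply/funext => s; rewrite !mulNr.
apply: cder_eq (cderM d1 d2) _.
rewrite [Q j.+2 t]hermqS [j.+2.-1]/= [j.+1.-1]/= [Q j.+1 t]hermqS.
have p0 := psi_neq0 t; have pp0 := pi_neq0 R.
have pc0 : pi%:C != 0 :> R[i] by rewrite realc_neq0.
have i2 : 'i ^+ 2 = -1 :> R[i] by exact: sqr_i.
move: (Q j t) (Q j.-1 t) (psi t) (pi%:C : R[i]) p0 pc0 => q0 q1 s pp p0 pc0.
rewrite -[j.+2%:R]natr1 -[j.+1%:R]natr1; move: (j%:R : R[i]) => jj.
field: i2.
by rewrite p0 pc0.
Qed.

(** The Hermite factor times the Gaussian of the dual term at frequency xi, for 1/c = a (1 + v^2).
    Below, [I] and [K] are its integrals without and with the weight 1/(1 + v^2). *)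
Definition ga (j : nat) v : R[i] := Q j v * ex v.

Lemma cder_ex v : cder (fun v => ex v) v (- pi%:C * a * (xi ^+ 2)%:C * (2 * v%:C) * ex v).
Proof. by apply: cder_exp; apply: cderZ; exact: cder_psi. Qed.

Lemma cder_ga j v : cder (ga j) v
  (v%:C * j%:R * (Q j v / psi v - 'i * a * xi%:C * Q j.-1 v) * ex v +
   Q j v * (- pi%:C * a * (xi ^+ 2)%:C * (2 * v%:C) * ex v)).
Proof. exact: cderM (cder_hermq j v) (cder_ex v). Qed.

Lemma ga_cvg j v : ccvg (nbhs v) (ga j) (ga j v).
Proof. exact: cder_cvg (cder_ga j v). Qed.

Lemma psiV_cvg v : ccvg (nbhs v) (fun v => psiV v) (psiV v).
Proof. by apply: ccvg_real; exact: continuous_oneDsqrV. Qed.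

(** The factor 1 + |v| serves the boundary term [v * ga j v] of the integration by parts. *)
Lemma ga_le j : exists C, forall v, (1 + `|v|) * normc (ga j v) <= C / (1 + v ^+ 2).
Proof.
have [B B0 HB] := @hermq_le R j.
pose k := pi * (Re a * xi ^+ 2).
have k0 : 0 < k by rewrite mulr_gt0 ?pi_gt0 // mulr_gt0 // lt_def sqrf_eq0 xi0 sqr_ge0.
have [C HC] := poly_gauss_le (2 * j).+1 k0.
pose K := B * (1 + `|xi|) ^+ j * (1 + normc a) ^+ j.
have na := normc_ge0 a.
have K0 : 0 <= K by rewrite !mulr_ge0 ?exprn_ge0 ?addr_ge0.
exists (K * C) => v; rewrite /ga normcM.
have v0 := normr_ge0 v.
have e1 : normc (ex v) <= expR (- k * v ^+ 2).
  rewrite normc_cexp ler_expR !(reM, imM, reN, imN, re_real, im_real) !(mulr0, mul0r, oppr0, subr0, add0r, addr0).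
  have -> : - pi * Re a * xi ^+ 2 * (1 + v ^+ 2) = - k + - k * v ^+ 2 by rewrite /k; ring.
  by rewrite gerDr oppr_le0 ltW.
have q1 : normc (Q j v) <= K * (1 + `|v|) ^+ (2 * j).
  apply: le_trans (HB _ _) _; rewrite normc_real /K -!mulrA ler_wpM2l // ler_wpM2l ?exprn_ge0 ?addr_ge0 //.
  rewrite exprM -exprMn lerXn2r ?nnegrE ?mulr_ge0 ?addr_ge0 ?exprn_ge0 ?normc_ge0 //.
  rewrite normcM normc_real gtr0_norm ?onepsqr_gt0 // -(real_normK (num_real v)).
  by move: (normc a) (`|v|) na v0 => A x A0 x0'; nra.
apply: le_trans (_ : _ <= (1 + `|v|) * (K * (1 + `|v|) ^+ (2 * j) * expR (- k * v ^+ 2))) _.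
  by rewrite ler_wpM2l ?addr_ge0 // ler_pM ?normc_ge0.
have -> : (1 + `|v|) * (K * (1 + `|v|) ^+ (2 * j) * expR (- k * v ^+ 2)) =
  K * ((1 + `|v|) ^+ (2 * j).+1 * expR (- k * v ^+ 2)) by rewrite [_ ^+ (2 * j).+1]exprS; ring.
by rewrite -[leRHS]mulrA ler_wpM2l.
Qed.

Lemma ga_integrable j : cintegrable setT (ga j).
Proof.
have [C HC] := ga_le j.
apply: (@cintegrable_le _ _ _ (fun v => C / (1 + v ^+ 2))) => //.
- by apply: cmeas_continuous => // v; exact: ga_cvg.
- move=> v _; apply: le_trans (HC v); rewrite ler_peMl ?normc_ge0 //.
  by rewrite lerDl.
- by apply: rintegrableZ => //; exact: rintegrable_inv1sqr.
Qed.

Lemma gaV_integrable j : cintegrable setT (fun v => psiV v * ga j v).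
Proof.
have [C HC] := ga_le j.
apply: (@cintegrable_le _ _ _ (fun v => C / (1 + v ^+ 2))) => //.
- by apply: cmeas_continuous => // v; apply: ccvgM; [exact: psiV_cvg|exact: ga_cvg].
- move=> v _; apply: le_trans (HC v); rewrite normcM ler_wpM2r ?normc_ge0 //.
  rewrite normc_real gtr0_norm ?invr_gt0 ?onepsqr_gt0 //.
  by apply: le_trans (inv1sqr_le1 v) _; rewrite lerDl.
- by apply: rintegrableZ => //; exact: rintegrable_inv1sqr.
Qed.

Local Notation I j := (cintegral setT (ga j)).
Local Notation K j := (cintegral setT (fun v => psiV v * ga j v)).

(** The outer factor 1 + v^2 in the recurrence of [hermq] cancels the weight. *)
Lemma gaV_rec j : K j.+1 = a * (j%:R / (2 * pi%:C) * I j.-1 - 'i * xi%:C * I j).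
Proof.
have i1 := ga_integrable j; have i2 := ga_integrable j.-1.
transitivity (cintegral setT (fun v => a * j%:R / (2 * pi%:C) * ga j.-1 v + - (a * 'i * xi%:C) * ga j v)).
  apply: eq_cintegral => v _; rewrite /ga hermqS psiVE.
  move: (ex v) (Q j v) (Q j.-1 v) (psi v) (psi_neq0 v) (pi : R) (pi_neq0 R) => e q0 q1 s s0 pp pp0.
  have pc : pp%:C != 0 :> R[i] by rewrite realc_neq0.
  by field; rewrite pc s0.
rewrite cintegralD //; [|exact: cintegrableZ..].
by rewrite !cintegralZ //; ring.
Qed.

(** The derivative of [v * ga j v] integrates to zero; writing v^2 = (1 + v^2) - 1 brings in both
    kinds of integrals. *)
Lemma ga_parts j : I j + j%:R * (I j - K j) - 2 * pi%:C * 'i * xi%:C * (I j.+1 - K j.+1) = 0.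
Proof.
pose f' v := ga j v + (j%:R * (ga j v + -1 * (psiV v * ga j v)) +
  (- (2 * pi%:C * 'i * xi%:C)) * (ga j.+1 v + -1 * (psiV v * ga j.+1 v))).
have iA i : cintegrable setT (fun v => ga i v + -1 * (psiV v * ga i v)).
  by apply: cintegrableD => //; [exact: ga_integrable|apply: cintegrableZ => //; exact: gaV_integrable].
have iA' i c : cintegrable setT (fun v => c * (ga i v + -1 * (psiV v * ga i v))).
  by apply: cintegrableZ => //; exact: iA.
have EA i : cintegral setT (fun v => ga i v + -1 * (psiV v * ga i v)) = I i - K i.
  rewrite cintegralD //; [|exact: ga_integrable|by apply: cintegrableZ => //; exact: gaV_integrable].
  by rewrite cintegralZ ?mulN1r //; exact: gaV_integrable.
have -> : I j + j%:R * (I j - K j) - 2 * pi%:C * 'i * xi%:C * (I j.+1 - K j.+1) = cintegral setT f'.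
  rewrite /f' cintegralD //; [|exact: ga_integrable|exact: cintegrableD].
  by rewrite cintegralD // !cintegralZ // !EA mulNr addrA.
have cA i v : ccvg (nbhs v) (fun v => ga i v + -1 * (psiV v * ga i v)) (ga i v + -1 * (psiV v * ga i v)).
  apply: ccvgD; first exact: ga_cvg.
  by apply: ccvgM; [exact: ccvg_cst|apply: ccvgM; [exact: psiV_cvg|exact: ga_cvg]].
apply: (@gwave_FTC R (fun v => v%:C * ga j v)).
- move=> v; apply: cder_eq (cderM (cder_id v) (cder_ga j v)) _.
  rewrite /f' /ga hermqS psiVE.
  have v2 : v%:C ^+ 2 = psi v - 1 by rewrite -realcX realcD -[1%:C]/(1 : R[i]); ring.
  have i2 : 'i ^+ 2 = -1 :> R[i] by exact: sqr_i.
  rewrite realcX.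
  move: (ex v) (Q j v) (Q j.-1 v) (psi v) (psi_neq0 v) v2 (pi : R) (pi_neq0 R) => e q0 q1 s s0 v2 pp pp0.
  have ps0 : pp%:C != 0 :> R[i] by rewrite realc_neq0.
  by field: i2 v2; rewrite s0 ps0.
- move=> v; apply: ccvgD; first exact: ga_cvg.
  by apply: ccvgD; (apply: ccvgM; [exact: ccvg_cst|exact: cA]).
- rewrite /f'; apply: cintegrableD => //; first exact: ga_integrable.
  exact: cintegrableD.
- have [C HC] := ga_le j.
  have H (s : nat -> R) : (forall n, `|s n| = n.+1%:R) -> ccvg \oo (fun n => (s n)%:C * ga j (s n)) 0.
    move=> sn; apply: (@ccvg_norm _ _ _ _ _ _ (fun n => C * (n.+1%:R)^-1)).
      apply: nearW => n; rewrite subr0 normcM normc_real.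
      have C0 : 0 <= C.
        have := HC 0; rewrite expr0n addr0 divr1; apply: le_trans.
        by rewrite mulr_ge0 ?normc_ge0 // normr0 addr0.
      apply: le_trans (_ : _ <= (1 + `|s n|) * normc (ga j (s n))) _.
        by rewrite ler_wpM2r ?normc_ge0 // lerDr.
      apply: le_trans (HC _) _; rewrite ler_wpM2l // lef_pV2 ?posrE ?onepsqr_gt0 ?ltr0n //.
      rewrite -(real_normK (num_real (s n))) sn.
      have : 1 <= n.+1%:R :> R by rewrite ler1n.
      by move: (n.+1%:R : R) => x x1; nra.
    by rewrite -[X in _ --> X](mulr0 C); apply: cvgM; [exact: cvg_cst|exact: cvg_harmonic].
  have H1 := H (fun n => n.+1%:R) (fun n => ger0_norm (ler0n _ _)).
  have H2 := H (fun n => - n.+1%:R) (fun n => etrans (normrN _) (ger0_norm (ler0n _ _))).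
  rewrite -[X in ccvg _ _ X](subr0 (0 : R[i])).
  by apply: ccvgD; [exact: H1|apply: ccvgN; exact: H2].
Qed.

(** The unweighted integrals are eliminated between [gaV_rec] and [ga_parts]. Up to an index shift,
    this is the recurrence of [hermq] at (xi, a). *)
Lemma gaV_rec2 j : K j.+2 = a * (j%:R / (2 * pi%:C) * K j - 'i * xi%:C * K j.+1).
Proof.
rewrite [LHS]gaV_rec /=; have := ga_parts j.
rewrite -[j.+1%:R]natr1.
move: (I j) (K j) (I j.+1) (K j.+1) => i0 k0 i1 k1 H.
have ps0 : pi%:C != 0 :> R[i] by rewrite realc_neq0 pi_neq0.
move: (pi%:C : R[i]) ps0 H => pp pp0 H.
apply/eqP; rewrite -subr_eq0; apply/eqP.
transitivity (a / (2 * pp) * 0); last by rewrite mulr0.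
by rewrite -H; field; rewrite pp0.
Qed.

(** A Gaussian integral of scale |xi|; this absolute value is the origin of the sign in the dual
    series. *)
Lemma ga0_integral : I 0 = cexp (- pi%:C * a * (xi ^+ 2)%:C) / (`|xi|%:C * sqrtc a).
Proof.
have x0 : 0 < `|xi| by rewrite normr_gt0.
have E : I 0 = cexp (- pi%:C * a * (xi ^+ 2)%:C) * gfourier `|xi| 0 0 a 0.
  rewrite /gfourier -cintegralZ //; last by apply: gwave_integrable.
  apply: eq_cintegral => v _; rewrite /ga /= mul1r gwave0 /gterm expr0 -[1%:C]/(1 : R[i]) mul1r -cexpD.
  congr cexp; rewrite addr0 exprMn real_normK ?num_real //; move: (pi : R) => pp.
  by rewrite [(1 + _)%:C]realcD -[1%:C]/(1 : R[i]) !realcE; ring.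
rewrite E gfourierE // /gdual /gdual0 /= mulr1 !(mulr0, mul0r) expr0n.
by rewrite [X in cexp X / _]/= mulr0 mul0r cexp0 mulr1 mul1r.
Qed.

(** Both sides obey the same two-term recurrence in j, and at j = 0 the quotient xi / |xi| supplies
    the sign. *)
Theorem gaV_integral j : sqrtc a * K j.+1 =
  - 'i * a * (Num.sg xi)%:C * (hermq xi%:C a j * cexp (- pi%:C * a * (xi ^+ 2)%:C)).
Proof.
set e := cexp _.
pose S j := sqrtc a * K j.+1 = - 'i * a * (Num.sg xi)%:C * (hermq xi%:C a j * e).
suff : S j /\ S j.+1 by case.
have S0 : S 0.
  rewrite /S gaV_rec ga0_integral -/e !mul0r add0r /= mul1r.
  have sE : xi = Num.sg xi * `|xi| by rewrite -numEsg.
  rewrite [in LHS]sE realcM -sE.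
  have n0 : `|xi|%:C != 0 :> R[i] by rewrite realc_neq0 normr_eq0.
  have s0 : sqrtc a != 0.
    by apply/eqP => s0; have := sqr_sqrtc a; rewrite s0 expr0n => aa; have := a0; rewrite -aa ltxx.
  by field; rewrite n0 s0.
elim: j => [|j [IH1 IH2]].
  split=> //; rewrite /S gaV_rec2 !mul0r add0r.
  transitivity (- a * 'i * xi%:C * (sqrtc a * K 1)); first by ring.
  by rewrite S0 /=; ring.
split=> //; rewrite /S gaV_rec2.
transitivity (a * (j.+1%:R / (2 * pi%:C) * (sqrtc a * K j.+1) - 'i * xi%:C * (sqrtc a * K j.+2))); first by ring.
by rewrite IH1 IH2 [hermq _ _ j.+2]hermqS; ring.
Qed.
End DualIntegral.

(** * The second integral as a dual false theta series *)

Section ThetaDualIntegral.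
Context {R : realType}.
Variables (M : R) (E : finType) (w : E -> R[i]) (mu : E -> R) (k : nat) (a : R[i]).
Hypothesis M0 : 0 < M.
Hypothesis w0 : \sum_e w e = 0.
Hypothesis a0 : 0 < Re a.
Local Notation b := (- a^-1).
Implicit Types v : R.

(** The value found by [gaV_integral] for the m-th dual term with shift u: a term of a false theta
    series at parameter a. *)
Definition dualterm (u : R) (m : int) : R[i] :=
  cexp ((2 * pi * u * (m%:~R / M))%:C * 'i) / M%:C *
  (- 'i * a * (Num.sg (m%:~R / M))%:C * (hermq (m%:~R / M)%:C a k *
   cexp (- pi%:C * a * ((m%:~R / M) ^+ 2)%:C))).

Lemma a_neq0 : a != 0. Proof. exact: Re_lt0_neq0. Qed.

Lemma Re_b_lt0 : Re b < 0.
Proof. by rewrite reN Re_inv oppr_lt0 divr_gt0 // exprn_gt0 // normc_gt0 a_neq0. Qed.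

Lemma sqrtc_gt0 : 0 < Re (sqrtc a).
Proof. exact: le_lt_trans (normr_ge0 _) (sqrtc_pos a0). Qed.

Lemma cwE v : cw b v = (a * (1 + v ^+ 2)%:C)^-1.
Proof. by rewrite /cw opprK invfM realcV. Qed.

Lemma sqrtc_cw v : sqrtc (cw b v) = (sqrtc a * (Num.sqrt (1 + v ^+ 2))%:C)^-1.
Proof.
apply: sqrtc_unique.
  by rewrite cwE exprVn exprMn sqr_sqrtc -realcX sqr_sqrt_onepsqr.
have s0 := sqrt_onepsqr_gt0 v.
have r0 : 0 < Re (sqrtc a * (Num.sqrt (1 + v ^+ 2))%:C).
  by rewrite reM im_real mulr0 subr0 re_real mulr_gt0 // sqrtc_gt0.
by rewrite Re_inv divr_gt0 // exprn_gt0 // normc_gt0; exact: Re_lt0_neq0.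
Qed.

(** The root of 1/c contributes sqrt(1 + v^2), which turns the weight (1 + v^2)^(-3/2) into 1/(1 +
    v^2). *)
Lemma omega_gdual u v (m : int) : (omega v)%:C * gdual M u k.+1 (cw b v) m%:~R =
  cexp ((2 * pi * u * (m%:~R / M))%:C * 'i) / M%:C *
  (sqrtc a * (((1 + v ^+ 2)^-1)%:C * ga a (m%:~R / M) k.+1 v)).
Proof.
rewrite /gdual /gdual0 sqrtc_cw cwE !invrK /ga /omega.
have -> : (1 + v ^+ 2)^-1 = (Num.sqrt (1 + v ^+ 2))^-1 ^+ 2 by rewrite exprVn sqr_sqrt_onepsqr.
have -> : cexp (- pi%:C * ((m%:~R / M) ^+ 2)%:C * (a * (1 + v ^+ 2)%:C)) =
  cexp (- pi%:C * a * ((m%:~R / M) ^+ 2)%:C * (1 + v ^+ 2)%:C) by congr cexp; ring.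
have := sqrt_onepsqr_gt0 v; move: (Num.sqrt _) => s s0.
have sa0 : sqrtc a != 0 by apply: Re_lt0_neq0; exact: sqrtc_gt0.
have M1 : M%:C != 0 :> R[i] by rewrite realc_neq0 gt_eqF.
have s1 : s%:C != 0 :> R[i] by rewrite realc_neq0 gt_eqF.
rewrite !realcE; move: (cexp _) (cexp _) (hermq _ _ _) => c1 c2 h.
by field; rewrite s1 M1.
Qed.

Theorem theta_dual_integral :
  fast (fun m => \sum_e w e * dualterm (mu e) m) /\
  cintegral setT (fun v => (omega v)%:C * Th M w mu k (cw b v)) =
  zsum (fun m => \sum_e w e * dualterm (mu e) m).
Proof.
have b1 := Re_b_lt0; have q0 := qb_gt0 b1; have n0 := normc_b_gt0 b1.
have [C C0 HC] := @wdual_le R M E w mu k M0 w0 (qb b) (normc b) q0 n0.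
have sec v : dec C (wdual M w mu k (cw b v)).
  have := cw_sector b1 v (lexx 0); rewrite -[0%:C]/(0 : R[i]) !addr0 => -[H1 H2 H3].
  exact: HC.
pose f m v := (omega v)%:C * wdual M w mu k (cw b v) m.
have fE m v : f m v = \sum_e w e * (cexp ((2 * pi * mu e * (m%:~R / M))%:C * 'i) / M%:C *
    (sqrtc a * (((1 + v ^+ 2)^-1)%:C * ga a (m%:~R / M) k.+1 v))).
  by rewrite /f /wdual mulr_sumr; apply: eq_bigr => e _; rewrite mulrCA omega_gdual.
have mg m : cmeas setT (fun v => ((1 + v ^+ 2)^-1)%:C * ga a (m%:~R / M) k.+1 v).
  by apply: cmeas_continuous => // v; apply: ccvgM; [exact: psiV_cvg|exact: ga_cvg].
have mf m : cmeas setT (f m).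
  rewrite (funext (fE m)).
  by apply: cmeas_sum => e; do 3!(apply: cmeasM; first exact: cmeas_cst).
have df v : setT v -> dec (C * omega v) (f^~ v).
  move=> _ m; rewrite /f normcM normc_real (ger0_norm (omega_ge0 _)).
  by apply: le_trans (ler_wpM2l (omega_ge0 v) (sec v m)) _; rewrite mulrA [omega v * C]mulrC.
have [ff [_ E1]] := zsum_cintegral measurableT mf df (rintegrableZ C measurableT rintegrable_omega).
have fI m : cintegral setT (f m) = \sum_e w e * dualterm (mu e) m.
  (* At frequency 0 the left side vanishes because the weights sum to zero, the right side because
     sgn 0 = 0. *)
  have [->|m0] := eqVneq m 0.
    rewrite big1 => [|e _]; last by rewrite /dualterm mul0r sgr0 -[0%:C]/(0 : R[i]) !(mulr0, mul0r).
    rewrite (_ : f 0 = fun=> 0); first exact: cintegral0.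
    by apply/funext => v; rewrite /f wdual0 // mulr0.
  have x0 : m%:~R / M != 0 by rewrite mulf_neq0 ?intr_eq0 // invr_eq0 gt_eqF.
  have iK := gaV_integrable a0 x0 k.+1.
  rewrite (funext (fE m)).
  rewrite (cintegral_sum _ measurableT) => [|e]; last by do 3!(apply: cintegrableZ => //).
  apply: eq_bigr => e _; rewrite !cintegralZ //; try by do 3?(apply: cintegrableZ => //).
  by rewrite gaV_integral.
have -> : (fun m => \sum_e w e * dualterm (mu e) m) = fun m => cintegral setT (f m).
  by apply/funext => m; rewrite fI.
split=> //; rewrite E1; apply: eq_cintegral => v _.
rewrite Th_dual //; last exact: Re_cw_gt0.
by rewrite -zsumZ //; exists C; exact: sec.
Qed.
End ThetaDualIntegral.

(** * Explicit Hermite polynomials *)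

Section HermiteClosedForm.
Context {R : realType}.
Implicit Types (x v A B tau : R[i]).

(** For N > k/2 this is the coefficient of z^k in exp(A z^2 + B z); larger N add nothing. *)
Definition hsum A B (N k : nat) : R[i] :=
  \sum_(s < N | (2 * s <= k)%N) A ^+ s / s`!%:R * (B ^+ (k - 2 * s) / (k - 2 * s)`!%:R).

Lemma fact_neq0 m : m`!%:R != 0 :> R[i].
Proof. by rewrite pnatr_eq0 -lt0n fact_gt0. Qed.

Lemma divpowS A m : m.+1%:R * (A ^+ m.+1 / m.+1`!%:R) = A * (A ^+ m / m`!%:R).
Proof.
have m0 : m.+1%:R != 0 :> R[i] by rewrite pnatr_eq0.
rewrite factS natrM exprS; move: (m.+1%:R : R[i]) m0 (m`!%:R : R[i]) (fact_neq0 m) => u u0 f f0.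
by field; rewrite f0 u0.
Qed.

(** Comparison of coefficients in F' = (2 A z + B) F for F = exp(A z^2 + B z). *)
Lemma hsum_rec A B N k : k.+1%:R * hsum A B N.+1 k.+1 =
  2 * A * (if k is k'.+1 then hsum A B N k' else 0) + B * hsum A B N.+1 k.
Proof.
pose F s := A ^+ s / s`!%:R; pose G t := B ^+ t / t`!%:R.
have -> : k.+1%:R * hsum A B N.+1 k.+1 =
  \sum_(s < N.+1 | (2 * s <= k.+1)%N) (2 * (s%:R * F s) * G (k.+1 - 2 * s)%N) +
  \sum_(s < N.+1 | (2 * s <= k.+1)%N) (F s * ((k.+1 - 2 * s)%:R * G (k.+1 - 2 * s)%N)).
  rewrite /hsum mulr_sumr -big_split /=; apply: eq_bigr => s ks.
  rewrite -{1}(subnKC ks) natrD natrM -/(F s) -/(G _); ring.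
congr (_ + _).
- rewrite big_mkcond big_ord_recl /= mul0r mulr0 mul0r add0r.
  case: k => [|k]; first by rewrite mulr0 big1 // => i _; rewrite ifF // ; apply/negP; rewrite /bump; lia.
  rewrite /hsum [in RHS]big_mkcond mulr_sumr; apply: eq_bigr => i _.
  have -> : (2 * bump 0 i <= k.+2)%N = (2 * i <= k)%N by rewrite /bump; lia.
  case: ifP => // ik; last by rewrite mulr0.
  have -> : (k.+2 - 2 * bump 0 i = k - 2 * i)%N by rewrite /bump; lia.
  by rewrite /F /G divpowS; ring.
- rewrite /hsum big_mkcond [in RHS]big_mkcond mulr_sumr; apply: eq_bigr => i _.
  case: ifP => i1; case: ifP => i2; last 2 first.
  + lia.
  + by rewrite mulr0.
  + have -> : (k.+1 - 2 * i = (k - 2 * i).+1)%N by lia.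
    by rewrite /F /G divpowS; ring.
  + have -> : (k.+1 - 2 * i = 0)%N by lia.
    by rewrite mul0r !mulr0.
Qed.

Lemma hsum_widen A B N N' k : (k./2 < N)%N -> (N <= N')%N -> hsum A B N' k = hsum A B N k.
Proof.
move=> kN NN; rewrite /hsum (big_ord_widen_cond _ (fun s => (2 * s <= k)%N)
  (fun s => A ^+ s / s`!%:R * (B ^+ (k - 2 * s) / (k - 2 * s)`!%:R)) NN).
by apply: eq_bigl => i; lia.
Qed.

(** With A = v/(4 pi) and B = -i x v, [hsum_rec] becomes the recurrence of [hermq]. *)
Lemma hermq_closed x v k :
  hermq x v k = k`!%:R * hsum (v / (4 * pi%:C)) (- 'i * x * v) k.+1 k.
Proof.
have pc0 : pi%:C != 0 :> R[i] by rewrite realc_neq0 pi_neq0.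
pose S k := hermq x v k = k`!%:R * hsum (v / (4 * pi%:C)) (- 'i * x * v) k.+1 k.
suff : S k /\ S k.+1 by case.
elim: k => [|k [IH1 IH2]].
  split.
    rewrite /S /hsum big_mkcond big_ord_recl big_ord0 /= addr0 muln0 subn0 !expr0.
    by rewrite fact0 divr1 !mulr1.
  rewrite /S /hsum big_mkcond !big_ord_recl big_ord0 /= !addr0 muln0 subn0 expr0 expr1.
  by rewrite fact0 divr1 !mul1r divr1.
split=> //; rewrite /S hermqS [k.+1.-1]/= IH1 IH2 [k.+2`!]factS natrM [RHS]mulrAC hsum_rec.
rewrite (@hsum_widen _ _ k.+1 k.+2 k) //; last by lia.
rewrite (@hsum_widen _ _ k.+2 k.+3 k.+1) //; last by lia.
move: (hsum _ _ _ _) (hsum _ _ _ _) => h1 h2; rewrite factS natrM.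
by move: (pi%:C : R[i]) pc0 {IH1 IH2 S} => pp pp0; field.
Qed.

(** The closed form at v = -i tau, read backwards with s = kappa - r: here the coefficients d
    arise. *)
Lemma hermq_dcoef (x tau : R[i]) k : hermq x (- 'i * tau) k =
  (-1) ^+ odd k * tau ^+ (k./2 + odd k) / ((2 * pi)%:C * 'i) ^+ k./2 *
  \sum_(r < k./2.+1) dcoef R k./2 (odd k) r * tau ^+ r * x ^+ (2 * r + odd k).
Proof.
have pc0 : pi%:C != 0 :> R[i] by rewrite realc_neq0 pi_neq0.
have i0 : 'i != 0 :> R[i] by apply/eqP => /(congr1 (@complex.Im R))/eqP; rewrite /= oner_eq0.
have i2 : 'i ^+ 2 = -1 :> R[i] by exact: sqr_i.
have ke := odd_double_half k.
rewrite hermq_closed (@hsum_widen _ _ (k./2).+1) //; last by lia.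
rewrite /hsum (reindex_inj rev_ord_inj) /= !mulr_sumr.
rewrite (eq_bigl xpredT) => [|r]; last by have := ltn_ord r; lia.
apply: eq_bigr => r _; rewrite subSS.
have rk := ltn_ord r.
have -> : (k - 2 * (k./2 - r) = 2 * r + odd k)%N by lia.
rewrite /dcoef.
have -> : (2 * k./2 + odd k = k)%N by lia.
have kr : k./2 = (k./2 - r + r)%N by lia.
have -> : - 'i * tau / (4 * pi%:C) = tau / (4 * pi%:C * 'i).
  by move: (pi%:C : R[i]) pc0 => pp pp0; field: i2; rewrite pp0 i0.
have -> : - 'i * x * (- 'i * tau) = - (tau * x).
  by rewrite (_ : _ * _ = 'i ^+ 2 * (tau * x)); [rewrite i2 mulN1r|ring].
have p2 : (2 * pi)%:C = 2 * pi%:C :> R[i] by rewrite realcM realc_nat.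
have p4 : (4 * pi)%:C = 4 * pi%:C :> R[i] by rewrite realcM realc_nat.
have f1 := fact_neq0 (k./2 - r); have f2 := fact_neq0 (2 * r + odd k).
rewrite p2 p4; move: (pi%:C : R[i]) pc0 {p2 p4} => pp pp0; rewrite [(- (tau * x)) ^+ _]exprNn.
have -> : (-1) ^+ (2 * r + odd k) = (-1) ^+ odd k :> R[i] by rewrite exprD exprM sqrrN !expr1n mul1r.
have -> : 4 * pp * 'i = 2 * (2 * pp * 'i) :> R[i] by ring.
have z0 : 2 * pp * 'i != 0 :> R[i] by rewrite !mulf_neq0 ?pnatr_eq0.
move: (2 * pp * 'i) z0 (nat_of_ord r) {rk} kr f1 f2 => z z0 q kr f1 f2.
move: (k./2 - q)%N kr f1 => s -> f1.
have E2 (y : R[i]) : y ^+ (2 * q + odd k) = y ^+ q * y ^+ q * y ^+ odd k.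
  by rewrite mul2n -addnn !exprD.
rewrite expr_div_n !E2 !exprMn !exprD.
move: ((2 * q + odd k)`!%:R : R[i]) f2 (s`!%:R : R[i]) f1 => u u0 v v0.
have z1 := expf_neq0 q z0; have z2 := expf_neq0 s z0.
have t2 m : 2 ^+ m != 0 :> R[i] by rewrite expf_neq0 // pnatr_eq0.
have t3 := t2 q; have t4 := t2 s.
move: (2 ^+ q) (2 ^+ s) (z ^+ q) (z ^+ s) t3 t4 z1 z2 => a b c d a0 b0 c0 d0.
by field; rewrite ?u0 ?v0 ?a0 ?b0 ?c0 ?d0.
Qed.
End HermiteClosedForm.

(** * The theta functions attached to the Seifert data *)

Section SeifertTheta.
Variables (n : nat) (p : 'I_n -> nat).
Hypothesis n_gt0 : (0 < n)%N.
Hypothesis p_ge2 : forall j, (2 <= p j)%N.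
Hypothesis p_coprime : forall i j, i != j -> coprime (p i) (p j).
Context (R : realType).
Implicit Types (eps : {ffun 'I_n -> bool}) (tau : R[i]).
Local Notation M := (sqrt2P p R).
Local Notation P2 := ((2 * bigP p)%N).

Definition weight (k : nat) eps : R[i] := (sign_prod R eps * coef p R eps k)%:C.
Definition shiftl eps : R := (ell p eps)%:~R / M.

Lemma P2_gt0 : (0 < P2)%N. Proof. by rewrite muln_gt0 bigP_gt0. Qed.

Lemma sqr_sqrt2P : M ^+ 2 = P2%:R.
Proof. by rewrite sqr_sqrtr -?natrM // ler0n. Qed.

Lemma sqrt2P_gt0 : 0 < M.
Proof. by rewrite sqrtr_gt0 -natrM ltr0n P2_gt0. Qed.

Lemma sqrt2P_neq0 : M != 0. Proof. by rewrite gt_eqF // sqrt2P_gt0. Qed.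

Lemma latticeE (t l : int) : M * t%:~R + l%:~R / M = (l + P2%:Z * t)%:~R / M.
Proof.
rewrite intrD intrM -[P2%:~R]/(P2%:R) -sqr_sqrt2P.
by field; exact: sqrt2P_neq0.
Qed.

(** Times [M] the lattice point is the integer ell + 2P t, which is nonzero because 0 < ell < 2P. *)
Lemma lattice_ge eps (t : int) : M^-1 <= `|M * t%:~R + shiftl eps|.
Proof.
rewrite /shiftl latticeE normrM normfV (gtr0_norm sqrt2P_gt0).
rewrite -[leLHS]mul1r ler_wpM2r ?invr_ge0 ?(ltW sqrt2P_gt0) // -intr_norm ler1z.
have := ell_bounds p_ge2 eps n_gt0 p_coprime; have := P2_gt0.
move: (ell p eps) P2 => l q q0 lq.
have : l + q%:Z * t != 0; last by lia.
apply/eqP => E; have [t0|[t0|t0]] : t = 0 \/ 1 <= t \/ t <= -1 by lia.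
- by move: E; rewrite t0; lia.
- by nia.
- by nia.
Qed.

Lemma qpow_gauss tau (x : R) : qpow tau (x ^+ 2 / 2) = cexp (- pi%:C * (- 'i * tau) * (x ^+ 2)%:C).
Proof.
rewrite /qpow; congr cexp; move: (pi : R) => pp.
have -> : 2 * pp * (x ^+ 2 / 2) = pp * x ^+ 2 by field.
by rewrite !realcE; ring.
Qed.

Lemma Re_mi_mul tau : Re (- 'i * tau) = Im tau.
Proof. by rewrite mulNr reN reM re_i im_i mul0r mul1r sub0r opprK. Qed.

Lemma theta_gterm k mu tau : theta p k mu tau =
  zsum (fun t => gterm k (- 'i * tau) (M * t%:~R + mu)).
Proof. by congr zsum; apply/funext => t; rewrite /gterm -qpow_gauss. Qed.

Lemma theta_tilde_gterm k mu tau : theta_tilde p k mu tau =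
  zsum (fun t => (Num.sg (M * t%:~R + mu))%:C * gterm k (- 'i * tau) (M * t%:~R + mu)).
Proof. by congr zsum; apply/funext => t; rewrite /gterm -qpow_gauss mulrA -realcM. Qed.

Lemma sgn_fast (u v : int -> R[i]) (x : int -> R) : fast v ->
  (forall t, u t = (Num.sg (x t))%:C * v t) -> fast u.
Proof.
move=> fv uE; apply: (fast_le fv) => t; rewrite uE normcM ler_piMl ?normc_ge0 //.
exact: sgn_normc_le.
Qed.

Lemma theta_tilde_fast k mu tau : 0 < Im tau ->
  fast (fun t => (Num.sg (M * t%:~R + mu))%:C * gterm k (- 'i * tau) (M * t%:~R + mu)).
Proof.
move=> t0; apply: (sgn_fast (v := fun t => gterm k (- 'i * tau) (M * t%:~R + mu))
  (x := fun t => M * t%:~R + mu)) => //.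
by apply: gterm_fast; rewrite ?sqrt2P_gt0 // Re_mi_mul.
Qed.

Lemma eta1_Th k (y : R) : 0 < y ->
  eta1 p k (y *i) = - 2^-1 * Th M (weight k) shiftl k y%:C.
Proof.
move=> y0; rewrite /eta1 /Th /wavg; congr (_ * _).
have aE : - 'i * (y *i) = y%:C :> R[i].
  by apply: complex_ext; rewrite mulNr ?reN ?imN ?reM ?imM /=; ring.
rewrite zsum_sum => [|e]; last first.
  by apply: fastZ; apply: gterm_fast; rewrite ?sqrt2P_gt0.
apply: eq_bigr => e _; rewrite theta_gterm aE zsumZ //.
by apply: gterm_fast; rewrite ?sqrt2P_gt0.
Qed.

Lemma theta_tilde_wavg k tau : 0 < Im tau ->
  \sum_eps weight k eps * theta_tilde p k (shiftl eps) tau =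
  zsum (wavg M (weight k) shiftl (fun x => (Num.sg x)%:C * gterm k (- 'i * tau) x)).
Proof.
move=> t0; rewrite /wavg zsum_sum => [|e]; last by apply: fastZ; exact: theta_tilde_fast.
by apply: eq_bigr => e _; rewrite theta_tilde_gterm zsumZ //; exact: theta_tilde_fast.
Qed.

(** The part of a dual term that depends on m, for a single monomial of the Hermite polynomial. *)
Definition dualwave eps (j : nat) tau (m : int) : R[i] :=
  cexp ((2 * pi * shiftl eps * (m%:~R / M))%:C * 'i) *
  ((Num.sg (m%:~R / M))%:C * gterm j (- 'i * tau) (m%:~R / M)).

Lemma normc_cexp_i (x : R) : normc (cexp (x%:C * 'i)) = 1.
Proof. by rewrite normc_cexp reM im_real re_i mulr0 mul0r subr0 expR0. Qed.

Lemma dualwave_fast eps j tau : 0 < Im tau -> fast (dualwave eps j tau).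
Proof.
move=> t0.
have f0 : fast (fun t : int => gterm j (- 'i * tau) (M^-1 * t%:~R + 0)).
  by apply: gterm_fast; rewrite ?invr_gt0 ?sqrt2P_gt0 // Re_mi_mul.
apply: (fast_le f0) => m; rewrite /dualwave addr0 [M^-1 * _]mulrC normcM normc_cexp_i mul1r normcM.
by rewrite ler_piMl ?normc_ge0 // sgn_normc_le.
Qed.

(** The phase exp(2 pi i ell m / (2P)) depends only on m modulo 2P, so each residue class nu
    contributes one false theta function. *)
Lemma zsum_dualwave eps j tau : 0 < Im tau -> zsum (dualwave eps j tau) =
  \sum_(nu < P2) cexp ((2 * pi * (ell p eps)%:~R * nu%:R / (2 * (bigP p)%:R))%:C * 'i) *
    theta_tilde p j (nu%:R / M) tau.
Proof.
move=> t0; rewrite (zsum_residue P2_gt0 (dualwave_fast eps j t0)); apply: eq_bigr => nu _.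
rewrite theta_tilde_gterm -zsumZ; last exact: theta_tilde_fast.
congr zsum; apply/funext => t; rewrite /dualwave -latticeE -[nu%:~R]/(nu%:R); congr (_ * _).
have M1 := sqrt2P_neq0.
have -> : 2 * pi * shiftl eps * (M * t%:~R + nu%:R / M) =
    2 * pi * (ell p eps)%:~R * nu%:R / (2 * (bigP p)%:R) + 2 * pi * (ell p eps * t)%:~R.
  rewrite /shiftl -natrM -sqr_sqrt2P intrM.
  by move: M M1 (pi : R) => m m1 pp; field.
by rewrite realcD mulrDl cexpD cexp_2pi_int mulr1.
Qed.

(** [hermq_dcoef] is applied under the sum and [zsum_dualwave] to each monomial; the factor -2
    undoes the -1/2 in [eta_tilde]. *)
Lemma dual_eta k tau : 0 < Im tau ->
  zsum (fun m => \sum_eps weight k eps * dualterm M k (- 'i * tau) (shiftl eps) m) =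
  M%:C^-1 * (- 'i * (- 'i * tau)) *
  ((-1) ^+ odd k * tau ^+ (k./2 + odd k) / ((2 * pi)%:C * 'i) ^+ k./2 *
  \sum_(r < k./2.+1) dcoef R k./2 (odd k) r * tau ^+ r * (- 2 * eta_tilde p k r tau)).
Proof.
move=> t0; set pref := _ / _.
have E m : \sum_eps weight k eps * dualterm M k (- 'i * tau) (shiftl eps) m =
  M%:C^-1 * (- 'i * (- 'i * tau)) * pref * \sum_(r < k./2.+1) (dcoef R k./2 (odd k) r * tau ^+ r) *
    \sum_eps weight k eps * dualwave eps (2 * r + odd k) tau m.
  under [in RHS]eq_bigr do rewrite mulr_sumr.
  rewrite exchange_big /= mulr_sumr; apply: eq_bigr => e _.
  rewrite /dualterm hermq_dcoef -/pref; set S := \sum_(r < _) _; set c1 := cexp _.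
  set sg := (Num.sg _)%:C; set c2 := cexp _.
  transitivity (M%:C^-1 * (- 'i * (- 'i * tau)) * pref * (S * (weight k e * c1 * sg * c2))).
    by ring.
  congr (_ * _); rewrite /S mulr_suml; apply: eq_bigr => r _.
  rewrite /dualwave /gterm -/c1 -/sg -/c2 realcX; ring.
rewrite (funext E).
have fw r : fast (fun m => \sum_eps weight k eps * dualwave eps (2 * r + odd k) tau m).
  by apply: fast_sum => e; apply: fastZ; exact: dualwave_fast.
rewrite zsumZ; last by apply: fast_sum => r; exact: fastZ.
rewrite [RHS]mulrA; congr (_ * _).
rewrite zsum_sum => [|r]; last exact: fastZ.
apply: eq_bigr => r _; rewrite zsumZ // /eta_tilde; congr (_ * _).
rewrite zsum_sum => [|e]; last by apply: fastZ; exact: dualwave_fast.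
rewrite mulrA (_ : - 2 * - 2^-1 = 1) ?mul1r; last by field.
rewrite [RHS]exchange_big /=; apply: eq_bigr => e _.
rewrite zsumZ; last exact: dualwave_fast.
rewrite zsum_dualwave // mulr_sumr; apply: eq_bigr => nu _.
by rewrite mulrA.
Qed.
End SeifertTheta.

(** * The branch of the square root and the sign of Re tau *)

Section SqrtConstant.
Context {R : realType}.
Implicit Types tau : R[i].

(** sqrt(-i) / sqrt(tau) is a root of -i/tau, and its real part has the sign of Re s - Im s for s =
    sqrt tau. As Re s + Im s > 0 and Re tau = (Re s)^2 - (Im s)^2, this is the sign of Re tau. *)
Lemma sqrtc_inv_mul tau : 0 < Im tau -> Re tau != 0 ->
  sqrtc (- 'i / tau) * tau = (Num.sg (Re tau))%:C * (sqrtc (- 'i) * sqrtc tau).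
Proof.
move=> t0 t1; set g := Num.sg (Re tau).
have n0 : tau != 0 by apply: contraTneq t0 => ->; rewrite ltxx.
have s2 := sqr_sqrtc tau; set s := sqrtc tau in s2 *.
have s0 : s != 0 by apply: contraNneq n0 => s0; rewrite -s2 s0 expr0n.
have g2 : g%:C ^+ 2 = 1 by rewrite -realcX /g sqr_sg t1.
have rei : 0 < Re (sqrtc (- 'i : R[i])).
  rewrite lt_def Re_sqrtc_ge0 andbT; apply/eqP => r0.
  have : Im (sqrtc (- 'i : R[i]) ^+ 2) = -1 by rewrite sqr_sqrtc imN im_i.
  by rewrite expr2 imM r0 mul0r mulr0 addr0 => /eqP; rewrite eq_sym oppr_eq0 oner_eq0.
set si := sqrtc (- 'i) in rei *.
have si2 : si ^+ 2 = - 'i := sqr_sqrtc _.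
rewrite (@sqrtc_unique R (- 'i / tau) (g%:C * (si / s))); first last.
- have : Im (s ^+ 2) = Im tau by rewrite s2.
  have : Re (s ^+ 2) = Re tau by rewrite s2.
  have : Re (si ^+ 2) = 0 by rewrite si2 reN re_i oppr0.
  have : Im (si ^+ 2) = -1 by rewrite si2 imN im_i.
  rewrite !Re_sqr !expr2 !imM; have q0 := Re_sqrtc_ge0 tau; rewrite -/s in q0.
  have nn : 0 < normc s ^+ 2 by rewrite exprn_gt0 // normc_gt0.
  have : Re (g%:C * (si / s)) = g * (Re si * Re s + Im si * Im s) / normc s ^+ 2.
    case: (s) (si) nn => [x y] [z t] /= nn.
    by rewrite mul0r subr0 sqr_sqrtr ?addr_ge0 ?sqr_ge0 //; ring.
  move=> ->; move: (Re si) (Im si) (Re s) (Im s) rei q0 => x y u v x0 u0 E1 E2 E3 E4.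
  (* From (x + i y)^2 = -i and x > 0: the principal root of -i lies on the diagonal of the fourth
     quadrant. *)
  have yx : y = - x by nra.
  have v0 : 0 < v by nra.
  have u1 : 0 < u by nra.
  apply: divr_gt0 => //; rewrite yx mulNr -mulrBr mulrCA pmulr_rgt0 //.
  rewrite /g -E3.
  have uv : 0 < u + v by rewrite addr_gt0.
  rewrite (_ : u * u - v * v = (u - v) * (u + v)); last by ring.
  rewrite sgrM (gtr0_sg uv) mulr1 -normrEsg normr_gt0.
  apply: contraNneq t1 => uv0; rewrite -E3 (_ : u * u - v * v = (u - v) * (u + v)); last by ring.
  by rewrite uv0 mul0r.
- by rewrite !exprMn g2 mul1r exprVn s2 si2.
- by rewrite -s2; field.
Qed.
End SqrtConstant.

(** * Cancellation in sums over sign vectors *)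

Section SignedSums.
Variables (n : nat).
Context {R : realType}.
Implicit Types (eps : {ffun 'I_n -> bool}) (c : R) (x : 'I_n -> R).

Definition flip (j : 'I_n) eps : {ffun 'I_n -> bool} :=
  [ffun i => if i == j then ~~ eps i else eps i].

Lemma flipK j : involutive (flip j).
Proof. by move=> eps; apply/ffunP => i; rewrite !ffunE; case: eqP => // _; rewrite negbK. Qed.

(* Expanding the power, each monomial misses a coordinate, and flipping it changes the sign. *)
Lemma sum_sign_power c x d : (d < n)%N ->
  \sum_eps sign_prod R eps * (c + \sum_j (-1) ^+ eps j * x j) ^+ d = 0.
Proof.
(* [None] stands for the constant c, so the power expands over functions into [option 'I_n]. *)
move=> dn; pose t eps (o : option 'I_n) := if o is Some j then (-1) ^+ eps j * x j else c.
have tE eps : c + \sum_j (-1) ^+ eps j * x j = \sum_o t eps o.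
  rewrite (bigD1 None) //= (@reindex_omap _ _ _ _ _ (@Some 'I_n) id) => [|[]] //=.
  by congr (_ + _); apply: eq_bigl => j; rewrite eqxx.
have pE eps : (c + \sum_j (-1) ^+ eps j * x j) ^+ d =
    \sum_(f : {ffun 'I_d -> option 'I_n}) \prod_i t eps (f i).
  rewrite tE -(bigA_distr_bigA (fun _ => t eps)) /=.
  by rewrite prodr_const card_ord.
under eq_bigr do rewrite pE mulr_sumr.
rewrite exchange_big big1 //= => f _.
have [j jf] : exists j : 'I_n, Some j \notin codom f.
  apply/existsP; rewrite -[X in is_true X]negbK negb_exists; apply/negP => /forallP H.
  have : (n <= d)%N.
    rewrite -[leqLHS]card_ord -[leqRHS]card_ord.
    have <- : #|[seq Some j | j : 'I_n]| = #|'I_n| by rewrite fintype.card_image // => ? ? [].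
    apply: leq_trans (_ : _ <= #|codom f|)%N _; last exact: leq_image_card.
    by apply: subset_leq_card; apply/fintype.subsetP => _ /mapP[j _ ->]; have := H j; rewrite negbK.
  by rewrite leqNgt dn.
set S := \sum_eps _; suff : S = - S by move=> H; lra.
rewrite {1}/S (reindex_inj (inv_inj (flipK j))) -sumrN; apply: eq_bigr => eps _.
rewrite -mulNr; congr (_ * _).
  rewrite /sign_prod (bigD1 j) //= [in RHS](bigD1 j) //= ffunE eqxx -mulNr; congr (_ * _).
    by case: (eps j); rewrite ?expr0 ?expr1 ?opprK.
  by apply: eq_bigr => i ij; rewrite ffunE (negPf ij).
apply: eq_bigr => i _; have : f i != Some j by apply: contraNneq jf => <-; exact: codom_f.
case: (f i) => // j' jj; rewrite /t ffunE ifN //; by apply: contraNneq jj => ->.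
Qed.
End SignedSums.

(** * The binomial coefficient as a polynomial *)

Section BinomialPolynomial.
Context {R : realType}.
Implicit Types (y : R).

(** The polynomial in y that interpolates the binomial coefficient C(y + N, N). *)
Definition bpoly (N : nat) y : R := (N`!%:R)^-1 * \prod_(i < N) (y + i.+1%:R).

Lemma bpoly_nat N m : bpoly N m%:R = 'C(m + N, N)%:R.
Proof.
have f0 (k : nat) : k`!%:R != 0 :> R by rewrite pnatr_eq0 -lt0n fact_gt0.
have H : m`!%:R * \prod_(i < N) (m%:R + i.+1%:R) = (m + N)`!%:R :> R.
  elim: N => [|N IH]; first by rewrite big_ord0 mulr1 addn0.
  by rewrite big_ord_recr /= mulrA IH -natrD addnS -natrM mulnC factS.
have := bin_fact (leq_addl m N); rewrite addnK => /(congr1 (fun k => k%:R : R)).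
rewrite -H !natrM /bpoly => E; apply: (mulfI (f0 m)); rewrite mulrCA -E.
by field; rewrite f0.
Qed.

(** The reflection permutes the N linear factors and changes the sign of each. *)
Lemma bpoly_refl N y : bpoly N (- N.+1%:R - y) = (-1) ^+ N * bpoly N y.
Proof.
rewrite /bpoly mulrCA; congr (_ * _).
have -> : (-1) ^+ N = \prod_(i < N) (-1) :> R by rewrite prodr_const card_ord.
rewrite -big_split [RHS](reindex_inj rev_ord_inj) /=; apply: eq_bigr => i _.
have -> : N.+1%:R = (N - i.+1).+1%:R + i.+1%:R :> R.
  by rewrite -natrD; congr _%:R; have := ltn_ord i; lia.
by ring.
Qed.

Lemma bpoly_root N (m : int) : - N%:Z <= m -> m < 0 -> bpoly N m%:~R = 0.
Proof.
move=> mN m0; have mE : m = - (`|m|%N)%:Z by lia.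
have m1 : (`|m|.-1 < N)%N by lia.
have -> : m%:~R = - (`|m|.-1.+1%N)%:R :> R.
  by rewrite {1}mE mulrNz prednK //; lia.
by rewrite /bpoly (bigD1 (Ordinal m1)) //= addNr mul0r mulr0.
Qed.

Lemma stirling1_small a b : (a < b)%N -> stirling1 a b = 0%N.
Proof.
elim: a b => [|a IH] [|b] //= ab; by rewrite !IH //; lia.
Qed.

(** The Stirling numbers expand y (y + 1) ... (y + N); dividing by y shifts the lower index by
    one. *)
Lemma rising_stirling N y :
  \prod_(i < N) (y + i.+1%:R) = \sum_(l < N.+1) (stirling1 N.+1 l.+1)%:R * y ^+ l.
Proof.
elim: N => [|N IH]; first by rewrite big_ord0 big_ord_recl big_ord0 /= expr0 addr0 mulr1.
rewrite big_ord_recr [LHS]/= IH mulrDr.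
have E l : stirling1 N.+2 l.+1 = (stirling1 N.+1 l + N.+1 * stirling1 N.+1 l.+1)%N by [].
under [RHS]eq_bigr do rewrite E natrD mulrDl.
rewrite big_split /=; congr (_ + _).
- rewrite [RHS]big_ord_recl /= mul0r add0r mulr_suml; apply: eq_bigr => i _.
  by rewrite /bump /= add1n exprSr mulrA.
- rewrite [RHS]big_ord_recr [X in _ = _ + X](_ : _ = 0); last first.
    by rewrite !stirling1_small // !muln0 mul0r.
  rewrite addr0 mulr_suml; apply: eq_bigr => i _.
  by rewrite natrM; ring.
Qed.
End BinomialPolynomial.

(** * [hatPsi] as a combination of false theta functions *)

Section HatPsi.
Variables (n : nat) (p : 'I_n -> nat).
Hypothesis n_ge3 : (3 <= n)%N.
Hypothesis p_ge2 : forall j, (2 <= p j)%N.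
Context (R : realType).
Implicit Types (eps : {ffun 'I_n -> bool}) (m t : int).
Local Notation M := (sqrt2P p R).
Local Notation P := (bigP p).
Local Notation P2 := ((2 * P)%N).

Lemma realc_sum I (s : seq I) (F : I -> R) : (\sum_(i <- s) F i)%:C = \sum_(i <- s) (F i)%:C :> R[i].
Proof. exact: rmorph_sum. Qed.

(** [coef] is a polynomial in the shift of degree at most n - 3 < n, so [sum_sign_power] applies to
    each monomial. *)
Lemma weight_sum0 k : (k <= n - 3)%N -> \sum_eps weight p R k eps = 0.
Proof.
move=> kn; rewrite /weight -realc_sum [X in X%:C](_ : _ = 0) //.
under eq_bigr do rewrite /coef mulrCA mulr_sumr.
rewrite -mulr_sumr exchange_big /= big_nat big1 ?mulr0 // => l /andP[kl lN].
transitivity ((- 2) ^- l * (stirling1 (n - 2) l.+1)%:R * 'C(l, k)%:R *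
    \sum_eps sign_prod R eps * Defs.shift p R eps ^+ (l - k)).
  by rewrite mulr_sumr; apply: eq_bigr => eps _; ring.
rewrite /Defs.shift sum_sign_power ?mulr0 //; lia.
Qed.

Lemma P_neq0 : P%:R != 0 :> R.
Proof. by rewrite pnatr_eq0 -lt0n bigP_gt0. Qed.

(** The meaning of [coef]: the coefficients of the binomial polynomial in the variable 2P y + P
    shift, whose square is in the exponent of q. *)
Lemma coef_bpoly eps (y : R) : \sum_(k < (n - 3).+1) coef p R eps k *
    (2 * P%:R * y + P%:R * Defs.shift p R eps) ^+ k = bpoly (n - 3) y.
Proof.
have P0 := P_neq0.
rewrite /bpoly rising_stirling /coef.
have -> : (n - 2 = (n - 3).+1)%N by lia.
set s := Defs.shift _ _ _; set N := (n - 3)%N; set S := stirling1 N.+1.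
(* As s + Z = -2y, the power y^l is (-2)^(-l) (s + Z)^l, and -P Z is the new variable. *)
pose Z := - (2 * y + s).
have E k : (-1) ^+ k / (P%:R ^+ k * N`!%:R) *
    (\sum_(k <= l < N.+1) (-2) ^- l * s ^+ (l - k) * (S l.+1)%:R * 'C(l, k)%:R) *
    (2 * P%:R * y + P%:R * s) ^+ k =
  \sum_(l < N.+1) (N`!%:R)^-1 * ((S l.+1)%:R * (-2) ^- l) *
    (if (k < l.+1)%N then (s ^+ (l - k) * Z ^+ k) *+ 'C(l, k) else 0).
  rewrite (big_nat_widenl k 0) // big_mkord big_mkcondr mulr_sumr mulr_suml.
  apply: eq_bigr => l _; rewrite ltnS; case: ifP => _; last by rewrite !mulr0 mul0r.
  have -> : Z ^+ k = (-1) ^+ k / P%:R ^+ k * (2 * P%:R * y + P%:R * s) ^+ k.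
    by rewrite -expr_div_n -exprMn; congr (_ ^+ k); rewrite /Z; field.
  rewrite -mulr_natr invfM.
  by move: (_ ^+ k) (_ ^+ k) (_ ^- k) ((-2) ^- l) (s ^+ _) (N`!%:R^-1) => a b c d e f; ring.
under eq_bigr do rewrite E.
rewrite exchange_big mulr_sumr /=; apply: eq_bigr => l _.
rewrite -mulr_sumr -mulrA; congr (_ * _); rewrite -mulrA; congr (_ * _).
rewrite -big_mkcond -(big_ord_widen N.+1 (fun k => (s ^+ (l - k) * Z ^+ k) *+ 'C(l, k))) // -exprDn.
have -> : s + Z = -2 * y by rewrite /Z; ring.
rewrite exprMn mulrA mulVf ?mul1r // expf_neq0 // .
Qed.

Variable sigma : R[i].
Hypothesis sigma0 : 0 < Im sigma.

Definition lat eps t : int := ell p eps + P2%:Z * t.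

Definition Gt eps k t : R[i] := (lat eps t)%:~R ^+ k * qpow sigma ((lat eps t)%:~R ^+ 2 / (4 * P%:R)).

Lemma sqrt2P4 (x : R) : (M * x) ^+ 2 / (4 * P%:R) = x ^+ 2 / 2.
Proof.
have P0 := P_neq0; rewrite exprMn sqr_sqrt2P natrM; move: (P%:R : R) P0 => y y0.
by field.
Qed.

Lemma lat_real eps t : (lat eps t)%:~R = M * (M * t%:~R + shiftl p R eps).
Proof. by rewrite /shiftl latticeE // mulrC divfK // sqrt2P_neq0. Qed.

Lemma GtE eps k t : Gt eps k t = (M ^+ k)%:C *
  gterm k (- 'i * sigma) (M * t%:~R + shiftl p R eps).
Proof.
rewrite /Gt -[(lat eps t)%:~R in LHS]realc_int lat_real sqrt2P4 qpow_gauss /gterm.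
by rewrite -realcX exprMn realcM mulrA.
Qed.

Lemma Gt_fast eps k : fast (Gt eps k).
Proof.
rewrite (funext (GtE eps k)); apply: fastZ; apply: gterm_fast; rewrite ?sqrt2P_gt0 //.
by rewrite Re_mi_mul.
Qed.

Lemma int_fast (s : int -> int) (v : int -> R[i]) : fast v -> (forall t, `|s t| <= 1) ->
  fast (fun t => (s t)%:~R * v t).
Proof.
move=> fv s1; apply: (fast_le fv) => t; rewrite normcM ler_piMl ?normc_ge0 //.
by rewrite -realc_int normc_real -intr_norm lerz1.
Qed.

Lemma sgn_eps_le eps m : `|sgn_eps p eps m| <= 1.
Proof. by rewrite /sgn_eps; do 2?case: ifP. Qed.

Lemma sg_le m : `|Num.sg m| <= 1.
Proof. by rewrite normr_sg; case: (_ != 0). Qed.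

Lemma calP_split : calP p sigma =
  2^-1 * \sum_eps (sign_prod R eps)%:C * \sum_(k < (n - 3).+1) (coef p R eps k)%:C *
    zsum (fun t => (sgn_eps p eps (lat eps t))%:~R * Gt eps k t) -
  2^-1 * \sum_(k < (n - 3).+1) (M ^+ k)%:C *
    \sum_eps weight p R k eps * theta_tilde p k (shiftl p R eps) sigma.
Proof.
rewrite /calP -mulrBr; congr (_ * _).
under [X in _ = _ - X]eq_bigr do rewrite mulr_sumr.
rewrite exchange_big -sumrB /=; apply: eq_bigr => eps _.
rewrite !mulr_sumr -sumrB; apply: eq_bigr => k _.
have f1 := int_fast (Gt_fast eps k) (fun t => sgn_eps_le eps (lat eps t)).
have f2 := int_fast (Gt_fast eps k) (fun t => sg_le (lat eps t)).
have -> : (M ^+ k)%:C * (weight p R k eps * theta_tilde p k (shiftl p R eps) sigma) =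
    (sign_prod R eps)%:C * ((coef p R eps k)%:C * zsum (fun t => (Num.sg (lat eps t))%:~R * Gt eps k t)).
  rewrite theta_tilde_gterm mulrCA /weight realcM -mulrA; congr (_ * (_ * _)).
  rewrite -zsumZ; last exact: theta_tilde_fast.
  congr zsum; apply/funext => t; rewrite GtE mulrCA; congr (_ * _).
  have -> : (Num.sg (lat eps t))%:~R = (Num.sg ((lat eps t)%:~R : R))%:C :> R[i].
    rewrite -realc_int; congr (_%:C).
    have [z0|z0|<-] := ltrgtP 0 (lat eps t); last by rewrite !sgr0.
    - by rewrite !gtr0_sg // ltr0z.
    - by rewrite !ltr0_sg // ltrz0.
  by rewrite lat_real sgrM (gtr0_sg (sqrt2P_gt0 p_ge2 R)) mul1r.
rewrite -mulrBr -mulrBr -zsumB //; congr (_ * (_ * zsum _)); apply/funext => t.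
by rewrite -mulrBl -intrB /Gt mulrA.
Qed.

Definition Qe eps m : R[i] := qpow sigma ((2 * P%:R * m%:~R + P%:R * Defs.shift p R eps) ^+ 2 / (4 * P%:R)).

(** The terms of [Psi] extended by zero to negative indices, so that reflections act on a sum over
    all integers. *)
Definition upos eps m : R[i] := if 0 <= m then (bpoly (n - 3) m%:~R)%:C * Qe eps m else 0.

(** Translation by [m0] passes from the residue [ell] to the number P shift of which it is the
    remainder. *)
Lemma lat_m0 eps m : (lat eps (m + m0 p eps))%:~R = 2 * P%:R * m%:~R + P%:R * Defs.shift p R eps :> R.
Proof.
have -> : lat eps (m + m0 p eps) = P2%:Z * m + numer p eps.
  by rewrite m0_ellE /lat; ring.
by rewrite intrD intrM numerE // -[P2%:~R]/(P2%:R) natrM.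
Qed.

Lemma sum_coef_Gt eps m : \sum_(k < (n - 3).+1) (coef p R eps k)%:C * Gt eps k (m + m0 p eps) =
  (bpoly (n - 3) m%:~R)%:C * Qe eps m.
Proof.
rewrite -(coef_bpoly eps) realc_sum mulr_suml; apply: eq_bigr => k _.
by rewrite /Gt -[(lat _ _)%:~R in LHS]realc_int lat_m0 -realcX realcM mulrA.
Qed.

Lemma bQ_fast eps : fast (fun m => (bpoly (n - 3) m%:~R)%:C * Qe eps m).
Proof.
rewrite -(funext (sum_coef_Gt eps)); apply: fast_sum => k; apply: fastZ.
exact: fast_add (Gt_fast eps k).
Qed.

Lemma upos_fast eps : fast (upos eps).
Proof.
apply: (fast_le (bQ_fast eps)) => m; rewrite /upos; case: ifP => // _.
by rewrite normc0 normc_ge0.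
Qed.

Lemma zsum_upos eps : zsum (upos eps) = csum (fun m : nat => 'C(m + n - 3, n - 3)%:R *
  qpow sigma ((2 * P%:R * m%:R + P%:R * Defs.shift p R eps) ^+ 2 / (4 * P%:R))).
Proof.
rewrite zsum_posz //; congr csum; apply/funext => j; rewrite /upos /Qe /=.
by rewrite -[j%:~R]/(j%:R) bpoly_nat realc_nat addnBA.
Qed.

Definition neg eps : {ffun 'I_n -> bool} := [ffun j => ~~ eps j].

Lemma negK : involutive neg.
Proof. by move=> eps; apply/ffunP => j; rewrite !ffunE negbK. Qed.

Lemma sign_neg eps : sign_prod R (neg eps) = (-1) ^+ n * sign_prod R eps.
Proof.
rewrite /sign_prod.
have -> : (-1) ^+ n = \prod_(j < n) (-1) :> R by rewrite prodr_const card_ord.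
rewrite -big_split; apply: eq_bigr => j _ /=.
by rewrite ffunE; case: (eps j); rewrite ?expr0 ?expr1 ?mulrNN ?mulr1.
Qed.

Lemma shift_neg eps : Defs.shift p R (neg eps) = 2 * (n - 2)%:R - Defs.shift p R eps.
Proof.
rewrite /Defs.shift; have -> : \sum_j (-1) ^+ neg eps j / (p j)%:R = - \sum_j (-1) ^+ eps j / (p j)%:R :> R.
  rewrite -sumrN; apply: eq_bigr => j _; rewrite ffunE -mulNr; congr (_ / _).
  by case: (eps j); rewrite ?expr0 ?expr1 ?opprK.
by ring.
Qed.

(** The reflection m -> -(m + n - 2) with eps -> -eps fixes the exponent of q and changes the
    binomial polynomial by (-1)^(n-3). It misses the indices from -(n-3) to -1, where the polynomial
    vanishes. *)
Lemma upos_neg eps m : (if m < 0 then (bpoly (n - 3) m%:~R)%:C * Qe eps m else 0) =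
  (-1) ^+ (n - 3) * upos (neg eps) (- (m + (n - 2)%N%:Z)).
Proof.
have rE : (- (m + (n - 2)%N%:Z))%:~R = - ((n - 3).+1)%:R - m%:~R :> R.
  have -> : (n - 3).+1 = (n - 2)%N by lia.
  by rewrite mulrNz intrD -[((n - 2)%N%:Z)%:~R]/(((n - 2)%N)%:R : R); ring.
have QE : Qe (neg eps) (- (m + (n - 2)%N%:Z)) = Qe eps m.
  rewrite /Qe shift_neg rE; have -> : (n - 3).+1 = (n - 2)%N by lia.
  set s := Defs.shift _ _ _; set y := m%:~R; set c := (n - 2)%N%:R.
  have -> : 2 * P%:R * (- c - y) + P%:R * (2 * c - s) = - (2 * P%:R * y + P%:R * s) by ring.
  by rewrite sqrrN.
have bE : (bpoly (n - 3) m%:~R)%:C = (-1) ^+ (n - 3) * (bpoly (n - 3) (- (m + (n - 2)%N%:Z))%:~R)%:C :> R[i].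
  rewrite rE bpoly_refl; move: (bpoly _ _) => B; rewrite realcM mulrA realcX [(-1)%:C]realcN.
  by rewrite -[1%:C]/(1 : R[i]) -exprMn mulrNN mulr1 expr1n mul1r.
rewrite /upos QE; case: ifP => m1; case: ifP => m2.
- by rewrite bE [RHS]mulrA.
- rewrite mulr0 bE bpoly_root ?mulr0 ?mul0r //; lia.
- lia.
- by rewrite mulr0.
Qed.

(** After translation by [m0], [sgn_eps] acts as the sign of m, counted + at 0; the negative half is
    the positive half for -eps by [upos_neg], with (-1)^n = -(-1)^(n-3). *)
Lemma zsum_sgn_eps eps : \sum_(k < (n - 3).+1) (coef p R eps k)%:C *
    zsum (fun t => (sgn_eps p eps (lat eps t))%:~R * Gt eps k t) =
  zsum (upos eps) + (-1) ^+ n * zsum (upos (neg eps)).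
Proof.
have P20 := P2_gt0 p_ge2.
pose F m := (sgn_eps p eps (lat eps (m + m0 p eps)))%:~R * ((bpoly (n - 3) m%:~R)%:C * Qe eps m).
have fS k : fast (fun t => (sgn_eps p eps (lat eps t))%:~R * Gt eps k t).
  exact: int_fast (Gt_fast eps k) (fun t => sgn_eps_le eps (lat eps t)).
transitivity (zsum F).
  transitivity (zsum (fun t => \sum_(k < (n - 3).+1) (coef p R eps k)%:C *
      ((sgn_eps p eps (lat eps t))%:~R * Gt eps k t))).
    rewrite zsum_sum => [|k]; last exact: fastZ.
    by apply: eq_bigr => k _; rewrite zsumZ.
  rewrite -(zsum_add (m0 p eps)); last by apply: fast_sum => k; exact: fastZ.
  congr zsum; apply/funext => m; rewrite /F -sum_coef_Gt mulr_sumr.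
  by apply: eq_bigr => k _; rewrite mulrCA.
have fU := upos_fast (neg eps).
have fV : fast (fun m => upos (neg eps) (- (m + (n - 2)%N%:Z))).
  exact: (fast_add _ (fast_opp fU)).
have -> : F = fun m => upos eps m + (-1) ^+ n * upos (neg eps) (- (m + (n - 2)%N%:Z)).
  apply/funext => m.
  have -> : (-1) ^+ n * upos (neg eps) (- (m + (n - 2)%N%:Z)) =
      - (if m < 0 then (bpoly (n - 3) m%:~R)%:C * Qe eps m else 0).
    rewrite upos_neg -mulNr; congr (_ * _).
    by rewrite -{1}(subnKC n_ge3) exprD !exprS expr0; ring.
  rewrite /F /upos.
  (* In the gap 2 - n < m < 0, where [sgn_eps] is 0, the binomial polynomial vanishes, so 0 may be
     replaced by -1. *)
  have sE : (sgn_eps p eps (lat eps (m + m0 p eps)))%:~R * ((bpoly (n - 3) m%:~R)%:C * Qe eps m) =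
     (if 0 <= m then 1 else -1) * ((bpoly (n - 3) m%:~R)%:C * Qe eps m).
    rewrite /sgn_eps /lat; move: (m0 p eps) (ell p eps) P2 P20 => a l q q0.
    have -> : (a * q%:Z + l <= l + q%:Z * (m + a)) = (0 <= m) by nia.
    have -> : (l + q%:Z * (m + a) <= (a - n%:Z + 2) * q%:Z + l) = (m <= 2 - n%:Z) by nia.
    case: ifP => // m1; case: ifP => // m2.
    rewrite bpoly_root ?mul0r ?mulr0 //; lia.
  rewrite sE; case: (lerP 0 m) => m1; first by rewrite mul1r subr0.
  by rewrite mulN1r add0r.
rewrite zsumD //; [|exact: upos_fast|exact: fastZ].
rewrite zsumZ //; congr (_ + _ * _).
by rewrite (zsum_add _ (fast_opp fU)) zsum_opp.
Qed.

(** Passing to -eps multiplies the product of signs by (-1)^n, so the two halves of [zsum_sgn_eps]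
    contribute equally. *)
Lemma PsiE : Psi p sigma = 2^-1 * \sum_eps (sign_prod R eps)%:C *
  \sum_(k < (n - 3).+1) (coef p R eps k)%:C *
    zsum (fun t => (sgn_eps p eps (lat eps t))%:~R * Gt eps k t).
Proof.
rewrite /Psi; under eq_bigr do rewrite -zsum_upos.
under [in RHS]eq_bigr do rewrite zsum_sgn_eps mulrDr.
rewrite big_split /=.
have -> : \sum_eps (sign_prod R eps)%:C * ((-1) ^+ n * zsum (upos (neg eps))) =
    \sum_eps (sign_prod R eps)%:C * zsum (upos eps).
  rewrite [RHS](reindex_inj (inv_inj negK)) /=; apply: eq_bigr => eps _.
  by rewrite sign_neg realcM realcX realcN mulrA [_ * (-1) ^+ n]mulrC.
by move: (\sum_eps _) => S; field.
Qed.

(** The [sgn_eps] part of [calP] is [Psi] itself, so the difference keeps only the part with the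
    ordinary sign. *)
Theorem hatPsiE : hatPsi p sigma = 2^-1 * \sum_(k < (n - 3).+1) (M ^+ k)%:C *
    \sum_eps weight p R k eps * theta_tilde p k (shiftl p R eps) sigma.
Proof. by rewrite /hatPsi calP_split -PsiE opprB addrC subrK. Qed.
End HatPsi.

(** * Powers of 2P and the final computation *)

Section Assembly.
Context {R : realType}.

Lemma powR_half (x : R) (k : nat) : 0 <= x -> x `^ (k%:R / 2) = Num.sqrt x ^+ k.
Proof. by move=> x0; rewrite mulrC powRrM powR12_sqrt // powR_mulrn // sqrtr_ge0. Qed.

Lemma powR_half_pred (x : R) (k : nat) : 0 < x ->
  x `^ ((k%:R - 1) / 2) = Num.sqrt x ^+ k / Num.sqrt x.
Proof.
move=> x0; rewrite mulrBl powRD; last by apply/implyP => _; rewrite gt_eqF.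
by rewrite powR_half ?ltW // mul1r powRN powR12_sqrt // ltW.
Qed.
End Assembly.

Theorem theorem5p5 (R : realType) (n : nat) (p : 'I_n -> nat) (tau : R[i])
  (n_ge3 : (3 <= n)%N)
  (p_ge2 : forall j, (2 <= p j)%N)
  (p_coprime : forall i j, i != j -> coprime (p i) (p j))
  (tau_upper : 0 < complex.Im tau)
  (tau_re : complex.Re tau != 0) :
  let P : R := (\prod_j p j)%N%:R in
  let integrand (k : nat) (z : R[i]) : R[i] :=
    eta1 p k z / sqrtc (- 'i * (z + tau^-1)) in
  (forall k : nat, (k <= n - 3)%N -> iR_integrable (integrand k)) /\
  hatPsi p (- tau^-1) =
    (Num.sg (complex.Re tau))%:C *
    (\sum_(k < (n - 3).+1)
      let kappa := k./2 in
      let iota : nat := odd k in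
      (-1) ^+ iota * sqrtc (- 'i) * ((2 * P) `^ ((k%:R - 1) / 2))%:C *
      half_pow tau (kappa + iota) / ((2 * pi)%:C * 'i) ^+ kappa *
      \sum_(r < kappa.+1)
        dcoef R kappa iota r * tau ^+ r * eta_tilde p k r tau)
    + 'i * \sum_(k < (n - 3).+1)
        ((2 * P) `^ (k%:R / 2))%:C * iR_integral (integrand k).
Proof.
move=> P integrand.
have n0 : (0 < n)%N by exact: leq_trans n_ge3.
have PE : P = (bigP p)%:R by [].
have P0 : 0 < 2 * P by rewrite PE -natrM ltr0n P2_gt0.
have M0 := sqrt2P_gt0 p_ge2 R; set M := sqrt2P p R in M0.
have ME : M = Num.sqrt (2 * P) by [].
have x0 : 0 < M^-1 by rewrite invr_gt0.
have t0 : tau != 0 by apply: contraTneq tau_upper => ->; rewrite ltxx.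
have nt : 0 < normc tau ^+ 2 by rewrite exprn_gt0 // normc_gt0.
(* The theta parameter of tau is a; that of -1/tau is 1/a = -b. *)
pose a := - 'i * tau; have a0 : 0 < Re a by rewrite Re_mi_mul.
have i2 : 'i ^+ 2 = -1 :> R[i] by exact: sqr_i.
have i0 : 'i != 0 :> R[i] by apply/eqP => /(congr1 (@complex.Im R))/eqP; rewrite /= oner_eq0.
have aV : a^-1 = 'i / tau by rewrite /a; field: i2; rewrite t0 i0.
pose b := - a^-1.
have b1 : Re b < 0 by exact: Re_b_lt0.
have imV (z : R[i]) : Im z^-1 = - (Im z / normc z ^+ 2).
  by case: z => x y; rewrite /= sqr_sqrtr // addr_ge0 ?sqr_ge0.
have b0 : Im b != 0.
  rewrite /b aV imN oppr_eq0 imM re_i im_i mul0r add0r mul1r Re_inv.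
  by rewrite mulf_neq0 // invr_eq0 gt_eqF.
have s0 : 0 < Im (- tau^-1) by rewrite imN imV opprK divr_gt0.
have bE : - 'i * - tau^-1 = - b by rewrite /b opprK aV mulrNN.
have lx := lattice_ge n0 p_ge2 p_coprime R.
pose T k y : R[i] := Th M (weight p R k) (shiftl p R) k y.
have spl k : (k <= n - 3)%N -> _ := fun kn => theta_split k M0 x0 lx (weight_sum0 p n_ge3 R kn) b0 b1.
(* On z = i y one has -i (z + 1/tau) = y + b, and [eta1] is -1/2 times [Th]. *)
have intE k y : `]0, +oo[%classic y -> integrand k (y *i) = - 2^-1 * (T k y%:C / rsqrt b y).
  rewrite /= in_itv /= andbT => y0; rewrite /integrand eta1_Th // -mulrA; congr (_ * (_ / sqrtc _)).
  have -> : y *i = y%:C * 'i :> R[i] by apply: complex_ext; rewrite ?reM ?imM /=; ring.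
  by rewrite /b aV; field: i2; rewrite t0.
have int1 k : (k <= n - 3)%N -> iR_integrable (integrand k).
  move=> kn; have [i1 _ _] := spl k kn.
  apply: (eq_cintegrable (measurable_itv _) (fun y Dy => esym (intE k y Dy))).
  by apply: cintegrableZ => //; exact: measurable_itv.
split=> //.
rewrite hatPsiE // !mulr_sumr -big_split; apply: eq_bigr => k _; lazy beta zeta.
have kn : (k <= n - 3)%N by have := ltn_ord k; lia.
have [i1 _ E] := spl k kn.
rewrite theta_tilde_wavg // bE {}E.
have [_ ->] := @theta_dual_integral R M _ (weight p R k) (shiftl p R) k a M0 (weight_sum0 p n_ge3 R kn) a0.
rewrite dual_eta //.
have sb : sqrtc b * tau = (Num.sg (Re tau))%:C * (sqrtc (- 'i) * sqrtc tau).
  by rewrite -sqrtc_inv_mul // /b aV mulNr.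
rewrite powR_half_pred // powR_half ?ltW // -ME.
have -> : iR_integral (integrand k) = 'i * (- 2^-1 * cintegral `]0, +oo[ (fun y => T k y%:C / rsqrt b y)).
  rewrite /iR_integral (eq_cintegral (intE k)) cintegralZ //; exact: measurable_itv.
set J := cintegral _ _; set S := \sum_(r < _) dcoef _ _ _ _ * _ * eta_tilde _ _ _ _.
have -> : \sum_(r < (k./2).+1) dcoef R k./2 (odd k) r * tau ^+ r * (- 2 * eta_tilde p k r tau) = - 2 * S.
  by rewrite mulr_sumr; apply: eq_bigr => r _; ring.
rewrite [(M ^+ k / M)%:C]realcM realcV /half_pow -/M.
(* What remains is an identity between independent quantities, apart from [sb] and i^2 = -1. *)
move: (sqrtc b) (sqrtc (- 'i)) (sqrtc tau) (_ ^- k./2) ((-1) ^+ odd k) (tau ^+ (_ + _)) (M ^+ k)%:C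
  (M%:C^-1) (Num.sg _)%:C J S sb => B si st w e tk mk mi g J S sb.
change (2^-1 * (mk * (J + B * (mi * (- 'i * (- 'i * tau)) * (e * tk * w * (- 2 * S))))) =
  g * (e * si * (mk * mi) * (tk * st) * w * S) + 'i * (mk * ('i * (- 2^-1 * J)))).
(* The two factors i, one from the statement and one from dz = i dy, turn -1/2 into 1/2 in the
   Eichler term; [sb] then settles the branch in the other term. *)
transitivity (2^-1 * (mk * J) + mk * mi * e * tk * w * S * (B * tau)); first by field: i2.
by rewrite sb; field: i2.
Qed.
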